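(* The system $\mathsf{RCA}_0^\omega$ proves $\mathsf{HBC}_0\to\mathsf{NIN}$, where $\mathsf{HBC}_0$ is the statement: for every countable $A\subset\mathbb{R}^2$ with $(\forall x\in[0,1])(\exists(a,b)\in A)(x\in(a,b))$, there are $(a_0,b_0),\dots,(a_k,b_k)\in A$ with $(\forall x\in[0,1])(\exists i\le k)(x\in(a_i,b_i))$; and $\mathsf{NIN}$ is the statement: for any $Y:[0,1]\to\mathbb{N}$ there are $x,y\in[0,1]$ with $x\neq_{\mathbb{R}}y$ and $Y(x)=Y(y)$.
   Context: Finite types: $0$ is a type (natural numbers), and if $\sigma,\tau$ are types then so is $\sigma\to\tau$; $1:=0\to 0$ and $n+1:=n\to 0$; superscripts indicate types. $\mathsf{L}_\omega$ is the many-sorted language with variables of every finite type, constants $0,1,<_0,+_0,\times_0,=_0$ (with usual meaning), typed combinators $\Pi,\Sigma$, and recursor constants $\mathbf{R}_\sigma$. For $\tau=(\tau_1\to\dots\to\tau_k\to 0)$, $x=_\tau y$ abbreviates $\forall z_1^{\tau_1}\dots z_k^{\tau_k}(xz_1\dots z_k=_0 yz_1\dots z_k)$. $\mathsf{QF\text{-}AC}^{\sigma,\tau}$ is the schema $(\forall x^\sigma)(\exists y^\tau)A(x,y)\to(\exists Y^{\sigma\to\tau})(\forall x^\sigma)A(x,Y(x))$ for quantifier-free $A$ of $\mathsf{L}_\omega$. $\mathsf{RCA}_0^\omega$ (Kohlenbach's base theory, classical logic) has the following axioms: ordered semi-ring axioms for $0,1,<_0,+_0,\times_0$; defining axioms of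 $\Pi,\Sigma$ (giving $\lambda$-abstraction); $\mathbf{R}_0(f,m,0)=m$ and $\mathbf{R}_0(f,m,n+1)=f(n,\mathbf{R}_0(f,m,n))$; extensionality $x=_\rho y\to\varphi(x)=_\tau\varphi(y)$ for all types $\rho,\tau$; induction for quantifier-free formulas of $\mathsf{L}_\omega$; and $\mathsf{QF\text{-}AC}^{1,0}$. Finite sequences are coded as usual. Inside this theory a real is a sequence of rationals $(q_n)$ with $|q_n-q_{n+i}|<2^{-n}$ for all $n,i$; reals $x,y$ represented by $(q_n),(r_n)$ satisfy $x=_{\mathbb{R}}y$ iff $|q_n-r_n|\le 2^{-n+1}$ for all $n$. Functions on $[0,1]$, $\mathbb{R}$ or $\mathbb{R}^2$ with values in $\mathbb{N}$ or $\mathbb{R}$ are objects of the corresponding finite type that map $=_{\mathbb{R}}$-equal arguments to equal values. Subsets of $\mathbb{R}$ or $\mathbb{R}^2$ are given by characteristic functions. A set $A\subseteq\mathbb{R}$ is countable if there is $Y:\mathbb{R}\to\mathbb{N}$ with $(\forall x,y\in A)(Y(x)=Y(y)\to x=_{\mathbb{R}}y)$, and similarly for $A\subseteq\mathbb{R}^2$ with $Y:\mathbb{R}^2\to\mathbb{N}$. *)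

(* Defs.v *)
From Stdlib Require Import List.
Import ListNotations.

Set Implicit Arguments.
Unset Strict Implicit.
Unset Printing Implicit Defensive.

Inductive ty : Type :=
| N : ty
| Arr : ty -> ty -> ty.

Declare Scope ty_scope.
Delimit Scope ty_scope with ty.
Bind Scope ty_scope with ty.
Notation "s → t" := (Arr s t) (at level 55, right associativity) : ty_scope.
Notation "1" := (Arr N N) : ty_scope.
Notation "0" := N : ty_scope.

(** Terms and formulas are intrinsically typed; a context lists the types of
    the free variables, de Bruijn index 0 first. *)
Definition ctx := list ty.

Inductive var : ctx -> ty -> Type :=
| vz Γ σ : var (σ :: Γ) σ
| vs Γ σ τ : var Γ τ -> var (σ :: Γ) τ.
Arguments vz {Γ σ}.
Arguments vs {Γ σ τ} v.

Inductive const : ty -> Type :=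
| CZero : const 0
| COne : const 0
| CPlus : const (0 → 0 → 0)
| CTimes : const (0 → 0 → 0)
| CPi σ τ : const (σ → τ → σ)
| CSigma δ ρ τ : const ((δ → ρ → τ) → (δ → ρ) → δ → τ)
| CRec σ : const ((0 → σ → σ) → σ → 0 → σ).

Inductive tm (Γ : ctx) : ty -> Type :=
| Var τ : var Γ τ -> tm Γ τ
| Cst τ : const τ -> tm Γ τ
| App σ τ : tm Γ (σ → τ) -> tm Γ σ -> tm Γ τ.
Arguments Var {Γ τ} v.
Arguments Cst {Γ τ} c.
Arguments App {Γ σ τ} f a.

(** [=] and [<] are predicates of type 0 only; equality at higher types is the
    abbreviation [eqt] below. *)
Inductive fm (Γ : ctx) : Type :=
| Eq : tm Γ 0 -> tm Γ 0 -> fm Γ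
| Lt : tm Γ 0 -> tm Γ 0 -> fm Γ
| Bot : fm Γ
| And : fm Γ -> fm Γ -> fm Γ
| Or : fm Γ -> fm Γ -> fm Γ
| Imp : fm Γ -> fm Γ -> fm Γ
| All σ : fm (σ :: Γ) -> fm Γ
| Ex σ : fm (σ :: Γ) -> fm Γ.
Arguments Bot {Γ}.

Fixpoint qf Γ (φ : fm Γ) : Prop :=
  match φ with
  | Eq _ _ | Lt _ _ | Bot => True
  | And φ ψ | Or φ ψ | Imp φ ψ => qf φ /\ qf ψ
  | All _ | Ex _ => False
  end.

Definition ren (Γ Δ : ctx) := forall τ, var Γ τ -> var Δ τ.
Definition sub (Γ Δ : ctx) := forall τ, var Γ τ -> tm Δ τ.

Definition vcons Γ σ (T : ty -> Type) (t : T σ) (s : forall τ, var Γ τ -> T τ)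
  : forall τ, var (σ :: Γ) τ -> T τ :=
  fun τ v =>
    match v in var Γ' τ'
      return match Γ' with
             | [] => unit
             | σ' :: Γ'' => T σ' -> (forall τ, var Γ'' τ -> T τ) -> T τ'
             end
    with
    | vz => fun t _ => t
    | vs w => fun _ s => s _ w
    end t s.

Definition shift Γ σ : ren Γ (σ :: Γ) := fun _ v => vs v.

Fixpoint ren_tm Γ Δ (r : ren Γ Δ) τ (t : tm Γ τ) : tm Δ τ :=
  match t with
  | Var v => Var (r _ v)
  | Cst c => Cst c
  | App f a => App (ren_tm r f) (ren_tm r a)
  end.

Fixpoint sub_tm Γ Δ (s : sub Γ Δ) τ (t : tm Γ τ) : tm Δ τ :=
  match t with
  | Var v => s _ v
  | Cst c => Cst c
  | App f a => App (sub_tm s f) (sub_tm s a)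
  end.

Definition up_ren Γ Δ σ (r : ren Γ Δ) : ren (σ :: Γ) (σ :: Δ) :=
  vcons (T := var (σ :: Δ)) vz (fun _ v => vs (r _ v)).

Definition up_sub Γ Δ σ (s : sub Γ Δ) : sub (σ :: Γ) (σ :: Δ) :=
  vcons (T := tm (σ :: Δ)) (Var vz) (fun _ v => ren_tm (@shift Δ σ) (s _ v)).

Fixpoint ren_fm Γ Δ (r : ren Γ Δ) (φ : fm Γ) : fm Δ :=
  match φ with
  | Eq t u => Eq (ren_tm r t) (ren_tm r u)
  | Lt t u => Lt (ren_tm r t) (ren_tm r u)
  | Bot => Bot
  | And φ ψ => And (ren_fm r φ) (ren_fm r ψ)
  | Or φ ψ => Or (ren_fm r φ) (ren_fm r ψ)
  | Imp φ ψ => Imp (ren_fm r φ) (ren_fm r ψ)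
  | All φ => All (ren_fm (up_ren r) φ)
  | Ex φ => Ex (ren_fm (up_ren r) φ)
  end.

Fixpoint sub_fm Γ Δ (s : sub Γ Δ) (φ : fm Γ) : fm Δ :=
  match φ with
  | Eq t u => Eq (sub_tm s t) (sub_tm s u)
  | Lt t u => Lt (sub_tm s t) (sub_tm s u)
  | Bot => Bot
  | And φ ψ => And (sub_fm s φ) (sub_fm s ψ)
  | Or φ ψ => Or (sub_fm s φ) (sub_fm s ψ)
  | Imp φ ψ => Imp (sub_fm s φ) (sub_fm s ψ)
  | All φ => All (sub_fm (up_sub s) φ)
  | Ex φ => Ex (sub_fm (up_sub s) φ)
  end.

Definition wk Γ σ (φ : fm Γ) : fm (σ :: Γ) := ren_fm (@shift Γ σ) φ.

Definition inst Γ σ (φ : fm (σ :: Γ)) (t : tm Γ σ) : fm Γ :=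
  sub_fm (vcons (T := tm Γ) t (fun _ v => Var v)) φ.

(** The formulas of [T Γ] may have free variables (of the types listed in [Γ])
    and are used as axioms in every context, hence stand for their universal
    closures. *)
Inductive proves (T : forall Γ, fm Γ -> Prop) :
  forall Γ, list (fm Γ) -> fm Γ -> Prop :=
| p_ax Γ (H : list (fm Γ)) φ : T Γ φ -> proves T H φ
| p_hyp Γ (H : list (fm Γ)) φ : In φ H -> proves T H φ
| p_botE Γ (H : list (fm Γ)) φ : proves T H Bot -> proves T H φ
| p_dne Γ (H : list (fm Γ)) φ :
    proves T H (Imp (Imp φ Bot) Bot) -> proves T H φ
| p_andI Γ (H : list (fm Γ)) φ ψ :
    proves T H φ -> proves T H ψ -> proves T H (And φ ψ)
| p_andE1 Γ (H : list (fm Γ)) φ ψ : proves T H (And φ ψ) -> proves T H φ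
| p_andE2 Γ (H : list (fm Γ)) φ ψ : proves T H (And φ ψ) -> proves T H ψ
| p_orI1 Γ (H : list (fm Γ)) φ ψ : proves T H φ -> proves T H (Or φ ψ)
| p_orI2 Γ (H : list (fm Γ)) φ ψ : proves T H ψ -> proves T H (Or φ ψ)
| p_orE Γ (H : list (fm Γ)) φ ψ χ :
    proves T H (Or φ ψ) -> proves T (φ :: H) χ -> proves T (ψ :: H) χ ->
    proves T H χ
| p_impI Γ (H : list (fm Γ)) φ ψ :
    proves T (φ :: H) ψ -> proves T H (Imp φ ψ)
| p_impE Γ (H : list (fm Γ)) φ ψ :
    proves T H (Imp φ ψ) -> proves T H φ -> proves T H ψ
| p_allI Γ (H : list (fm Γ)) σ (φ : fm (σ :: Γ)) :
    proves T (map (@wk Γ σ) H) φ -> proves T H (All φ)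
| p_allE Γ (H : list (fm Γ)) σ (φ : fm (σ :: Γ)) (t : tm Γ σ) :
    proves T H (All φ) -> proves T H (inst φ t)
| p_exI Γ (H : list (fm Γ)) σ (φ : fm (σ :: Γ)) (t : tm Γ σ) :
    proves T H (inst φ t) -> proves T H (Ex φ)
| p_exE Γ (H : list (fm Γ)) σ (φ : fm (σ :: Γ)) χ :
    proves T H (Ex φ) -> proves T (φ :: map (@wk Γ σ) H) (wk σ χ) ->
    proves T H χ.

(** [ext Γ Δ] holds when [Δ] extends [Γ] by further, more recently bound
    variables.  A named binder below gives [x] the type [tm (σ :: Γ) σ];
    [↑x] transports [x] to the context of its point of use. *)
Class ext (Γ Δ : ctx) := emb : ren Γ Δ.
#[export] Hint Mode ext ! ! : typeclass_instances.
#[export] Instance ext_refl Γ : ext Γ Γ | 0 := fun _ v => v.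
#[export] Instance ext_cons Γ Δ σ (e : ext Γ Δ) : ext Γ (σ :: Δ) | 1 :=
  fun _ v => vs (e _ v).
Definition lift Γ Δ {e : ext Γ Δ} τ (t : tm Γ τ) : tm Δ τ := ren_tm e t.

(** Bracket abstraction, from the combinators Π and Σ. *)
Fixpoint lam Γ σ τ (t : tm (σ :: Γ) τ) : tm Γ (σ → τ) :=
  match t in tm _ τ return tm Γ (σ → τ) with
  | Var v =>
      vcons (T := fun τ => tm Γ (σ → τ))
        (App (App (Cst (CSigma σ (σ → σ) σ)) (Cst (CPi σ (σ → σ))))
             (Cst (CPi σ σ)))
        (fun τ w => App (Cst (CPi τ σ)) (Var w)) v
  | Cst c => App (Cst (CPi _ σ)) (Cst c)
  | App f a => App (App (Cst (CSigma _ _ _)) (lam f)) (lam a)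
  end.

Definition lam_ Γ σ τ (f : tm (σ :: Γ) σ -> tm (σ :: Γ) τ) : tm Γ (σ → τ) :=
  lam (f (Var vz)).
Definition all_ Γ σ (f : tm (σ :: Γ) σ -> fm (σ :: Γ)) : fm Γ :=
  All (f (Var vz)).
Definition ex_ Γ σ (f : tm (σ :: Γ) σ -> fm (σ :: Γ)) : fm Γ :=
  Ex (f (Var vz)).
Arguments lam_ {Γ} σ {τ} f.
Arguments all_ {Γ} σ f.
Arguments ex_ {Γ} σ f.

Definition Not Γ (φ : fm Γ) : fm Γ := Imp φ Bot.

Declare Scope tm_scope.
Delimit Scope tm_scope with tm.
Bind Scope tm_scope with tm.
Declare Scope fm_scope.
Delimit Scope fm_scope with fm.
Bind Scope fm_scope with fm.

Notation "↑ x" := (lift x) (at level 5, x at level 4, format "↑ x") : tm_scope.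
Notation "f · a" := (App f a) (at level 40, left associativity) : tm_scope.
Notation "0" := (Cst CZero) : tm_scope.
Notation "1" := (Cst COne) : tm_scope.
Notation "2" := (Cst CPlus · Cst COne · Cst COne)%tm : tm_scope.
Notation "s + t" := (Cst CPlus · s · t)%tm : tm_scope.
Notation "s * t" := (Cst CTimes · s · t)%tm : tm_scope.
Notation "'λ' x : σ , t" := (lam_ σ%ty (fun x => t%tm))
  (at level 200, x name, σ at level 60, right associativity) : tm_scope.

Notation "s ≡ t" := (Eq s%tm t%tm) (at level 70) : fm_scope.
Notation "s ≺ t" := (Lt s%tm t%tm) (at level 70) : fm_scope.
Notation "¬ φ" := (Not φ%fm) (at level 75, right associativity) : fm_scope.
Notation "φ ∧ ψ" := (And φ%fm ψ%fm) (at level 80, right associativity) : fm_scope.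
Notation "φ ∨ ψ" := (Or φ%fm ψ%fm) (at level 85, right associativity) : fm_scope.
Notation "φ ⇒ ψ" := (Imp φ%fm ψ%fm) (at level 90, right associativity) : fm_scope.
Notation "'∀' x : σ , φ" := (all_ σ%ty (fun x => φ%fm))
  (at level 200, x name, σ at level 60, right associativity) : fm_scope.
Notation "'∃' x : σ , φ" := (ex_ σ%ty (fun x => φ%fm))
  (at level 200, x name, σ at level 60, right associativity) : fm_scope.

Fixpoint eqt Γ (τ : ty) : tm Γ τ -> tm Γ τ -> fm Γ :=
  match τ with
  | N => fun s t => s ≡ t
  | Arr σ τ => fun s t => ∀ z : σ, eqt (↑s · ↑z) (↑t · ↑z)
  end%fm.

(** [φ (n+1)], in the same context as [φ n]. *)
Definition at_succ Γ (φ : fm (N :: Γ)) : fm (N :: Γ) :=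
  sub_fm (vcons (T := tm (N :: Γ)) (Var vz + 1)%tm (fun _ v => Var (vs v))) φ.

(** In [A], index 0 is [y] and index 1 is [x]; [qfac_matrix A] is [A(x, Y x)],
    where index 0 is [x] and index 1 is [Y]. *)
Definition qfac_matrix Γ σ τ (A : fm (τ :: σ :: Γ)) : fm (σ :: (σ → τ)%ty :: Γ) :=
  let Δ := σ :: (σ → τ)%ty :: Γ in
  sub_fm (vcons (T := tm Δ) (Var (vs vz) · Var vz)%tm
           (vcons (T := tm Δ) (Var vz) (fun _ v => Var (vs (vs v))))) A.

Definition QF_AC Γ σ τ (A : fm (τ :: σ :: Γ)) : fm Γ :=
  Imp (All (Ex A)) (Ex (All (qfac_matrix A))).

Inductive RCA0ω : forall Γ, fm Γ -> Prop :=
| ax_eq_refl Γ : @RCA0ω Γ (∀ x : 0, ↑x ≡ ↑x)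
| ax_eq_sym Γ : @RCA0ω Γ (∀ x : 0, ∀ y : 0, ↑x ≡ ↑y ⇒ ↑y ≡ ↑x)
| ax_eq_trans Γ :
    @RCA0ω Γ (∀ x : 0, ∀ y : 0, ∀ z : 0, ↑x ≡ ↑y ⇒ ↑y ≡ ↑z ⇒ ↑x ≡ ↑z)
| ax_lt_eq Γ :
    @RCA0ω Γ (∀ x : 0, ∀ y : 0, ∀ u : 0, ∀ v : 0,
                ↑x ≡ ↑u ⇒ ↑y ≡ ↑v ⇒ ↑x ≺ ↑y ⇒ ↑u ≺ ↑v)
| ax_add_assoc Γ :
    @RCA0ω Γ (∀ x : 0, ∀ y : 0, ∀ z : 0, (↑x + ↑y) + ↑z ≡ ↑x + (↑y + ↑z))
| ax_add_comm Γ : @RCA0ω Γ (∀ x : 0, ∀ y : 0, ↑x + ↑y ≡ ↑y + ↑x)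
| ax_add_0 Γ : @RCA0ω Γ (∀ x : 0, ↑x + 0 ≡ ↑x)
| ax_mul_assoc Γ :
    @RCA0ω Γ (∀ x : 0, ∀ y : 0, ∀ z : 0, (↑x * ↑y) * ↑z ≡ ↑x * (↑y * ↑z))
| ax_mul_comm Γ : @RCA0ω Γ (∀ x : 0, ∀ y : 0, ↑x * ↑y ≡ ↑y * ↑x)
| ax_mul_1 Γ : @RCA0ω Γ (∀ x : 0, ↑x * 1 ≡ ↑x)
| ax_mul_0 Γ : @RCA0ω Γ (∀ x : 0, ↑x * 0 ≡ 0)
| ax_distr Γ :
    @RCA0ω Γ (∀ x : 0, ∀ y : 0, ∀ z : 0, ↑x * (↑y + ↑z) ≡ ↑x * ↑y + ↑x * ↑z)
| ax_lt_irrefl Γ : @RCA0ω Γ (∀ x : 0, ¬ ↑x ≺ ↑x)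
| ax_lt_trans Γ :
    @RCA0ω Γ (∀ x : 0, ∀ y : 0, ∀ z : 0, ↑x ≺ ↑y ⇒ ↑y ≺ ↑z ⇒ ↑x ≺ ↑z)
| ax_lt_total Γ :
    @RCA0ω Γ (∀ x : 0, ∀ y : 0, ↑x ≺ ↑y ∨ ↑x ≡ ↑y ∨ ↑y ≺ ↑x)
| ax_lt_0_1 Γ : @RCA0ω Γ (0 ≺ 1)
| ax_lt_add Γ :
    @RCA0ω Γ (∀ x : 0, ∀ y : 0, ∀ z : 0, ↑x ≺ ↑y ⇒ ↑x + ↑z ≺ ↑y + ↑z)
| ax_lt_mul Γ :
    @RCA0ω Γ (∀ x : 0, ∀ y : 0, ∀ z : 0,
                0 ≺ ↑z ⇒ ↑x ≺ ↑y ⇒ ↑x * ↑z ≺ ↑y * ↑z)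
| ax_Pi Γ σ τ :
    @RCA0ω Γ (∀ x : σ, ∀ y : τ, eqt (Cst (CPi σ τ) · ↑x · ↑y) ↑x)
| ax_Sigma Γ δ ρ τ :
    @RCA0ω Γ (∀ x : δ → ρ → τ, ∀ y : δ → ρ, ∀ z : δ,
                eqt (Cst (CSigma δ ρ τ) · ↑x · ↑y · ↑z)
                    (↑x · ↑z · (↑y · ↑z)))
(* [CRec σ] has no axioms for σ other than 0 *)
| ax_R0_0 Γ :
    @RCA0ω Γ (∀ f : 0 → 0 → 0, ∀ m : 0, Cst (CRec 0) · ↑f · ↑m · 0 ≡ ↑m)
| ax_R0_S Γ :
    @RCA0ω Γ (∀ f : 0 → 0 → 0, ∀ m : 0, ∀ n : 0,
                Cst (CRec 0) · ↑f · ↑m · (↑n + 1)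
                ≡ ↑f · ↑n · (Cst (CRec 0) · ↑f · ↑m · ↑n))
| ax_ext Γ ρ τ :
    @RCA0ω Γ (∀ x : ρ, ∀ y : ρ, ∀ φ : ρ → τ,
                eqt ↑x ↑y ⇒ eqt (↑φ · ↑x) (↑φ · ↑y))
| ax_ind Γ (φ : fm (N :: Γ)) :
    qf φ -> RCA0ω (inst φ 0 ∧ All (φ ⇒ at_succ φ) ⇒ All φ)
| ax_qfac Γ (A : fm (N :: (N → N)%ty :: Γ)) : qf A -> RCA0ω (QF_AC A).

Definition RCA0ω_proves (φ : fm []) : Prop := proves RCA0ω [] φ.

Section Coding.
Context (Γ : ctx).
Implicit Types x y c n w m p d s t k : tm Γ 0.
Local Open Scope tm_scope.

Definition Rec0 (f : tm Γ (0 → 0 → 0)) m n : tm Γ 0 := Cst (CRec 0) · f · m · n.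

Definition pow2 n := Rec0 (λ k : 0, λ m : 0, ↑m + ↑m) 1 n.
Definition tpred x := Rec0 (λ k : 0, λ m : 0, ↑k) 0 x.
End Coding.

Section Coding2.
Context (Γ : ctx).
Implicit Types x y c n w m p d s t k : tm Γ 0.
Local Open Scope tm_scope.

Definition monus x y := Rec0 (λ k : 0, λ m : 0, tpred ↑m) x y.
(** [x] if [c = 0], else [y]. *)
Definition if0 c x y := Rec0 (λ k : 0, λ m : 0, ↑y) x c.
(** [x * (x + 1) / 2]. *)
Definition tri x := Rec0 (λ k : 0, λ m : 0, ↑m + (↑k + 1)) 0 x.
Definition cpair x y := tri (x + y) + y.
End Coding2.

Section Coding3.
Context (Γ : ctx).
Implicit Types x y c n w m p d s t k : tm Γ 0.
Local Open Scope tm_scope.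

(** The largest [w] with [tri w <= c]. *)
Definition cdiag c :=
  Rec0 (λ k : 0, λ w : 0, if0 (monus (tri (↑w + 1)) (↑k + 1)) (↑w + 1) ↑w) 0 c.
Definition csnd c := monus c (tri (cdiag c)).
Definition cfst c := monus (cdiag c) (csnd c).

(** [cpair], [cfst] and [csnd] are Cantor's pairing and its projections.
    The number [cpair (cpair p m) d] codes the rational [(p - m) / (d + 1)];
    every number codes a rational. *)
Definition rat p m d := cpair (cpair p m) d.
Definition pos c := cfst (cfst c).
Definition neg c := csnd (cfst c).
Definition den c := csnd c + 1.

(** [s - t < k * 2^-n] and [k * 2^-n < s - t], for codes [s] and [t] of
    rationals, with denominators cleared. *)
Definition diff_lt s t k n : fm Γ :=
  pow2 n * (pos s * den t + neg t * den s)
  ≺ k * (den s * den t) + pow2 n * (neg s * den t + pos t * den s).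
Definition lt_diff k n s t : fm Γ :=
  k * (den s * den t) + pow2 n * (neg s * den t + pos t * den s)
  ≺ pow2 n * (pos s * den t + neg t * den s).
End Coding3.

Section Reals.
Context (Γ : ctx).
Implicit Types x y a b : tm Γ 1.
Local Open Scope fm_scope.

(** [|q n - q (n + i)| < 2^-n]. *)
Definition is_real x : fm Γ :=
  ∀ n : 0, ∀ i : 0,
    diff_lt (↑x · ↑n) (↑x · (↑n + ↑i)) 1 ↑n ∧
    diff_lt (↑x · (↑n + ↑i)) (↑x · ↑n) 1 ↑n.

(** [|q n - r n| <= 2 * 2^-n]. *)
Definition eqR x y : fm Γ :=
  ∀ n : 0,
    ¬ lt_diff 2 ↑n (↑x · ↑n) (↑y · ↑n) ∧
    ¬ lt_diff 2 ↑n (↑y · ↑n) (↑x · ↑n).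

(** [r n - q n > 2 * 2^-n] for some [n]. *)
Definition ltR x y : fm Γ := ∃ n : 0, lt_diff 2 ↑n (↑y · ↑n) (↑x · ↑n).

Definition leR x y : fm Γ := ¬ ltR y x.

Definition zeroR : tm Γ 1 := (λ n : 0, rat 0 0 0)%tm.
Definition oneR : tm Γ 1 := (λ n : 0, rat 1 0 0)%tm.

Definition in_I x : fm Γ := is_real x ∧ leR zeroR x ∧ leR x oneR.

Definition in_interval x a b : fm Γ := ltR a x ∧ ltR x b.
End Reals.

(** Functions need only respect [eqR] on codes of reals in their domain. *)
Section Functions.
Context (Γ : ctx).
Local Open Scope fm_scope.

Definition is_fun_I (Y : tm Γ (1 → 0)) : fm Γ :=
  ∀ x : 1, ∀ y : 1,
    in_I ↑x ⇒ in_I ↑y ⇒ eqR ↑x ↑y ⇒ ↑Y · ↑x ≡ ↑Y · ↑y.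

Definition is_fun_R2 (Y : tm Γ (1 → 1 → 0)) : fm Γ :=
  ∀ a : 1, ∀ b : 1, ∀ c : 1, ∀ d : 1,
    is_real ↑a ⇒ is_real ↑b ⇒ is_real ↑c ⇒ is_real ↑d ⇒
    eqR ↑a ↑c ⇒ eqR ↑b ↑d ⇒ ↑Y · ↑a · ↑b ≡ ↑Y · ↑c · ↑d.

(** [A] is a characteristic function; membership is [A a b = 1]. *)
Definition is_set_R2 (A : tm Γ (1 → 1 → 0)) : fm Γ :=
  is_fun_R2 A ∧
  ∀ a : 1, ∀ b : 1,
    is_real ↑a ⇒ is_real ↑b ⇒ ↑A · ↑a · ↑b ≡ 0 ∨ ↑A · ↑a · ↑b ≡ 1.

Definition in_R2 (a b : tm Γ 1) (A : tm Γ (1 → 1 → 0)) : fm Γ :=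
  is_real a ∧ is_real b ∧ A · a · b ≡ 1.
End Functions.

Definition countable_R2 Γ (A : tm Γ (1 → 1 → 0)) : fm Γ :=
  (∃ Y : 1 → 1 → 0, is_fun_R2 ↑Y ∧
    ∀ a : 1, ∀ b : 1, ∀ c : 1, ∀ d : 1,
      in_R2 ↑a ↑b ↑A ⇒ in_R2 ↑c ↑d ↑A ⇒
      ↑Y · ↑a · ↑b ≡ ↑Y · ↑c · ↑d ⇒ eqR ↑a ↑c ∧ eqR ↑b ↑d)%fm.

(** The finite sequence [(a_0,b_0), ..., (a_k,b_k)] is given by [k] and two
    objects [a], [b] of type [0 → 1]. *)
Definition HBC0 : fm [] :=
  (∀ A : 1 → 1 → 0,
    is_set_R2 ↑A ⇒ countable_R2 ↑A ⇒
    (∀ x : 1, in_I ↑x ⇒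
       ∃ a : 1, ∃ b : 1, in_R2 ↑a ↑b ↑A ∧ in_interval ↑x ↑a ↑b) ⇒
    ∃ k : 0, ∃ a : 0 → 1, ∃ b : 0 → 1,
      (∀ i : 0, ↑i ≺ ↑k + 1 ⇒ in_R2 (↑a · ↑i) (↑b · ↑i) ↑A) ∧
      (∀ x : 1, in_I ↑x ⇒
         ∃ i : 0, ↑i ≺ ↑k + 1 ∧ in_interval ↑x (↑a · ↑i) (↑b · ↑i)))%fm.

Definition NIN : fm [] :=
  (∀ Y : 1 → 0, is_fun_I ↑Y ⇒
    ∃ x : 1, ∃ y : 1,
      in_I ↑x ∧ in_I ↑y ∧ ¬ eqR ↑x ↑y ∧ ↑Y · ↑x ≡ ↑Y · ↑y)%fm.

(* Main.v *)
(** By the completeness theorem, proved here by a Henkin construction over the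
    calculus of Defs, it suffices to argue in an extensional model of RCA0ω, whose
    possibly nonstandard rationals form an ordered field.

    Suppose [Y] is injective on [0,1].  Sending [f] to the real [2^-k], [k] the
    least zero of [f], or to [0] if there is none, and comparing values of [Y]
    decides whether [f] has a zero; so number quantifiers are decidable.  Hence the
    family of the intervals with centre [x] in [0,1] and length [4^-Y(x) / 16] has
    a characteristic function: recover [x] from the endpoints.  It is countable via
    [Y] and covers [0,1].  No finite subfamily does: at step [m] keep the first or
    the last quarter of the current interval of length [4^-m], whichever misses
    the only member of the subfamily whose centre [x] has [Y(x) = m]. *)
From HB Require Import structures.
From mathcomp Require Import all_boot all_order all_algebra.
From mathcomp Require Import boolp.
From Stdlib Require Import PeanoNat Cantor Eqdep_dec Ring.
Require Import Defs.

Set Implicit Arguments.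
Unset Strict Implicit.
Unset Printing Implicit Defensive.

(** The obstacle is that membership in the cover asks whether a centre lies in [0,1] and whether
    [b - a] equals a prescribed length. Both are statements about all precisions, so a
    characteristic function to hand to [HBC0] requires deciding number quantifiers, and the failure
    of [NIN] supplies exactly this. Induction is limited to predicates that are zero sets of
    elements of the model, and the size [k] of the subfamily and the step [m] may be nonstandard.
    Hence the diagonal real must itself be defined by [CRec 0] from decidable data. The constants
    leave room for rational approximations. The first and last quarter of an interval of length L
    are L/2 apart. The points of a member of length L/16, all errors included, stay within 3L/16 of
    the rational that is tested against the midpoint. As this is below L/4, the side on which that
    rational falls tells which quarter is safe, and no comparison of reals is decided.
    Extensionality of the models turns equality at every type into identity, so combinator terms can
    be replaced by functions of the metalanguage that are shown to be definable. *)

Lemma var_cons_ind Γ σ (P : forall τ, var (σ :: Γ) τ -> Prop) :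
  P σ vz -> (forall τ (v : var Γ τ), P τ (vs v)) -> forall τ v, P τ v.
Proof.
move=> P0 PS τ v.
exact: (match v as v0 in var G τ0 return
  match G return var G τ0 -> Prop with
  | nil => fun _ => True
  | s :: D => fun v => forall P : (forall τ, var (s :: D) τ -> Prop),
      P s vz -> (forall τ w, P τ (vs w)) -> P τ0 v
  end v0 with
  | vz _ _ => fun P P0 PS => P0
  | vs _ _ _ w => fun P P0 PS => PS _ w end P P0 PS).
Qed.

Lemma var_nil_False τ (v : var [::] τ) : False.
Proof.
exact: (match v in var G _ return
  match G with nil => False | _ => True end with vz _ _ => I | vs _ _ _ _ => I end).
Qed.

Lemma vcons_ext Γ σ (T : ty -> Type) (s1 s2 : forall τ, var (σ :: Γ) τ -> T τ) :
  s1 σ vz = s2 σ vz -> (forall τ (v : var Γ τ), s1 τ (vs v) = s2 τ (vs v)) ->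
  s1 = s2.
Proof.
move=> e0 eS; apply: functional_extensionality_dep => τ.
apply: functional_extensionality_dep => v.
by move: τ v; apply: var_cons_ind.
Qed.

(** * Renaming and substitution *)

Section Composition.
Variables (Γ Δ Θ : ctx).

Lemma up_ren_comp σ (r1 : ren Γ Δ) (r2 : ren Δ Θ) :
  (fun τ v => up_ren (σ := σ) r2 (up_ren r1 v)) =
  up_ren (fun τ v => r2 τ (r1 τ v)).
Proof. exact: vcons_ext. Qed.

Lemma ren_ren_tm (r1 : ren Γ Δ) (r2 : ren Δ Θ) τ (t : tm Γ τ) :
  ren_tm r2 (ren_tm r1 t) = ren_tm (fun τ v => r2 τ (r1 τ v)) t.
Proof. by elim: t => //= σ {}τ f -> a ->. Qed.

Lemma sub_ren_tm (r : ren Γ Δ) (s : sub Δ Θ) τ (t : tm Γ τ) :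
  sub_tm s (ren_tm r t) = sub_tm (fun τ v => s τ (r τ v)) t.
Proof. by elim: t => //= σ {}τ f -> a ->. Qed.

Lemma ren_sub_tm (s : sub Γ Δ) (r : ren Δ Θ) τ (t : tm Γ τ) :
  ren_tm r (sub_tm s t) = sub_tm (fun τ v => ren_tm r (s τ v)) t.
Proof. by elim: t => //= σ {}τ f -> a ->. Qed.

Lemma sub_sub_tm (s1 : sub Γ Δ) (s2 : sub Δ Θ) τ (t : tm Γ τ) :
  sub_tm s2 (sub_tm s1 t) = sub_tm (fun τ v => sub_tm s2 (s1 τ v)) t.
Proof. by elim: t => //= σ {}τ f -> a ->. Qed.

Lemma up_sub_ren σ (r : ren Γ Δ) (s : sub Δ Θ) :
  (fun τ v => up_sub (σ := σ) s (up_ren r v)) =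
  up_sub (fun τ v => s τ (r τ v)).
Proof. exact: vcons_ext. Qed.
End Composition.

Lemma up_ren_sub Γ Δ Θ σ (s : sub Γ Δ) (r : ren Δ Θ) :
  (fun τ v => ren_tm (up_ren r) (up_sub (σ := σ) s v)) =
  up_sub (fun τ v => ren_tm r (s τ v)).
Proof. by apply: vcons_ext => //= τ v; rewrite /= !ren_ren_tm. Qed.

Lemma up_sub_sub Γ Δ Θ σ (s1 : sub Γ Δ) (s2 : sub Δ Θ) :
  (fun τ v => sub_tm (up_sub s2) (up_sub (σ := σ) s1 v)) =
  up_sub (fun τ v => sub_tm s2 (s1 τ v)).
Proof. by apply: vcons_ext => //= τ v; rewrite /= sub_ren_tm ren_sub_tm. Qed.

Lemma ren_ren_fm Γ Δ Θ (r1 : ren Γ Δ) (r2 : ren Δ Θ) (φ : fm Γ) :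
  ren_fm r2 (ren_fm r1 φ) = ren_fm (fun τ v => r2 τ (r1 τ v)) φ.
Proof.
elim: φ Δ Θ r1 r2 => //= {Γ}.
- by move=> Γ t u Δ Θ r1 r2; rewrite !ren_ren_tm.
- by move=> Γ t u Δ Θ r1 r2; rewrite !ren_ren_tm.
- by move=> Γ φ IH1 ψ IH2 Δ Θ r1 r2; rewrite IH1 IH2.
- by move=> Γ φ IH1 ψ IH2 Δ Θ r1 r2; rewrite IH1 IH2.
- by move=> Γ φ IH1 ψ IH2 Δ Θ r1 r2; rewrite IH1 IH2.
- by move=> Γ σ φ IH Δ Θ r1 r2; rewrite IH up_ren_comp.
- by move=> Γ σ φ IH Δ Θ r1 r2; rewrite IH up_ren_comp.
Qed.

Lemma sub_ren_fm Γ Δ Θ (r : ren Γ Δ) (s : sub Δ Θ) (φ : fm Γ) :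
  sub_fm s (ren_fm r φ) = sub_fm (fun τ v => s τ (r τ v)) φ.
Proof.
elim: φ Δ Θ r s => //= {Γ}.
- by move=> Γ t u Δ Θ r s; rewrite !sub_ren_tm.
- by move=> Γ t u Δ Θ r s; rewrite !sub_ren_tm.
- by move=> Γ φ IH1 ψ IH2 Δ Θ r s; rewrite IH1 IH2.
- by move=> Γ φ IH1 ψ IH2 Δ Θ r s; rewrite IH1 IH2.
- by move=> Γ φ IH1 ψ IH2 Δ Θ r s; rewrite IH1 IH2.
- by move=> Γ σ φ IH Δ Θ r s; rewrite IH up_sub_ren.
- by move=> Γ σ φ IH Δ Θ r s; rewrite IH up_sub_ren.
Qed.

Lemma ren_sub_fm Γ Δ Θ (s : sub Γ Δ) (r : ren Δ Θ) (φ : fm Γ) :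
  ren_fm r (sub_fm s φ) = sub_fm (fun τ v => ren_tm r (s τ v)) φ.
Proof.
elim: φ Δ Θ s r => //= {Γ}.
- by move=> Γ t u Δ Θ r s; rewrite !ren_sub_tm.
- by move=> Γ t u Δ Θ r s; rewrite !ren_sub_tm.
- by move=> Γ φ IH1 ψ IH2 Δ Θ r s; rewrite IH1 IH2.
- by move=> Γ φ IH1 ψ IH2 Δ Θ r s; rewrite IH1 IH2.
- by move=> Γ φ IH1 ψ IH2 Δ Θ r s; rewrite IH1 IH2.
- by move=> Γ σ φ IH Δ Θ r s; rewrite IH up_ren_sub.
- by move=> Γ σ φ IH Δ Θ r s; rewrite IH up_ren_sub.
Qed.

Lemma sub_sub_fm Γ Δ Θ (s1 : sub Γ Δ) (s2 : sub Δ Θ) (φ : fm Γ) :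
  sub_fm s2 (sub_fm s1 φ) = sub_fm (fun τ v => sub_tm s2 (s1 τ v)) φ.
Proof.
elim: φ Δ Θ s1 s2 => //= {Γ}.
- by move=> Γ t u Δ Θ r s; rewrite !sub_sub_tm.
- by move=> Γ t u Δ Θ r s; rewrite !sub_sub_tm.
- by move=> Γ φ IH1 ψ IH2 Δ Θ r s; rewrite IH1 IH2.
- by move=> Γ φ IH1 ψ IH2 Δ Θ r s; rewrite IH1 IH2.
- by move=> Γ φ IH1 ψ IH2 Δ Θ r s; rewrite IH1 IH2.
- by move=> Γ σ φ IH Δ Θ r s; rewrite IH up_sub_sub.
- by move=> Γ σ φ IH Δ Θ r s; rewrite IH up_sub_sub.
Qed.

Lemma sub_tm_Var Γ τ (t : tm Γ τ) : sub_tm (fun _ v => Var v) t = t.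
Proof. by elim: t => //= σ {}τ f -> a ->. Qed.

Lemma up_sub_Var Γ σ : up_sub (σ := σ) (fun τ (v : var Γ τ) => Var v) = (fun _ v => Var v).
Proof. exact: vcons_ext. Qed.

Lemma sub_fm_Var Γ (φ : fm Γ) : sub_fm (fun _ v => Var v) φ = φ.
Proof.
elim: φ => //= {Γ}.
- by move=> Γ t u; rewrite !sub_tm_Var.
- by move=> Γ t u; rewrite !sub_tm_Var.
- by move=> Γ φ -> ψ ->.
- by move=> Γ φ -> ψ ->.
- by move=> Γ φ -> ψ ->.
- by move=> Γ σ φ IH; rewrite up_sub_Var IH.
- by move=> Γ σ φ IH; rewrite up_sub_Var IH.
Qed.

Lemma ren_wk Γ Δ σ (r : ren Γ Δ) (φ : fm Γ) :
  ren_fm (up_ren r) (wk σ φ) = wk σ (ren_fm r φ).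
Proof. by rewrite /wk !ren_ren_fm. Qed.

Lemma ren_inst Γ Δ σ (r : ren Γ Δ) (φ : fm (σ :: Γ)) t :
  ren_fm r (inst φ t) = inst (ren_fm (up_ren r) φ) (ren_tm r t).
Proof.
rewrite /inst ren_sub_fm sub_ren_fm; congr (sub_fm _ _).
exact: vcons_ext.
Qed.

Lemma inst_up_sub Γ Δ σ (s : sub Γ Δ) (φ : fm (σ :: Γ)) t :
  inst (sub_fm (up_sub s) φ) t = sub_fm (vcons (T := tm Δ) t s) φ.
Proof.
rewrite /inst sub_sub_fm; congr (sub_fm _ _).
by apply: vcons_ext => //= τ v; rewrite sub_ren_tm sub_tm_Var.
Qed.

Lemma inst_wk_vz Γ σ (φ : fm (σ :: Γ)) :
  inst (ren_fm (up_ren (@shift Γ σ)) φ) (Var vz) = φ.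
Proof.
rewrite /inst sub_ren_fm -[RHS]sub_fm_Var; congr (sub_fm _ _).
exact: vcons_ext.
Qed.

Lemma ren_eqt Γ Δ (r : ren Γ Δ) τ (t u : tm Γ τ) :
  ren_fm r (eqt t u) = eqt (ren_tm r t) (ren_tm r u).
Proof.
elim: τ Γ Δ r t u => //= σ _ τ IH Γ Δ r t u.
by rewrite /all_ /= IH /= /Defs.lift !ren_ren_tm.
Qed.

(** * Weakening *)

Section Weakening.
Variable T : forall Γ, fm Γ -> Prop.
Hypothesis T_ren : forall Γ Δ (r : ren Γ Δ) (φ : fm Γ), T φ -> T (ren_fm r φ).

(** One induction covers renaming and enlarging the hypotheses: the quantifier rules rename under a
    binder and the discharging rules extend the list, so [H'] is any list containing the renamed
    hypotheses. *)
Lemma proves_ren Γ (H : list (fm Γ)) (φ : fm Γ) : proves T H φ ->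
  forall Δ (r : ren Γ Δ) (H' : list (fm Δ)),
  List.incl (List.map (ren_fm r) H) H' -> proves T H' (ren_fm r φ).
Proof.
have incl_cons A (x : A) l l' : List.incl l l' -> List.incl (x :: l) (x :: l').
  by move=> h y [->|/h]; [left | right].
have incl_up G D s (r : ren G D) (K : list (fm G)) K' :
    List.incl (List.map (ren_fm r) K) K' ->
    List.incl (List.map (ren_fm (up_ren r)) (List.map (@wk G s) K))
              (List.map (@wk D s) K').
  move=> h y; rewrite List.map_map => /List.in_map_iff [x [<- xK]].
  rewrite ren_wk; apply: List.in_map; apply: h.
  exact: List.in_map.
elim=> {Γ H φ}.
- by move=> Γ H φ Tφ Δ r H' _; apply: p_ax; apply: T_ren.
- by move=> Γ H φ Hφ Δ r H' h; apply: p_hyp; apply: h; apply: List.in_map.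
- by move=> Γ H φ _ IH Δ r H' h; apply: p_botE; apply: IH h.
- by move=> Γ H φ _ IH Δ r H' h; apply: p_dne; apply: IH h.
- by move=> Γ H φ ψ _ IH1 _ IH2 Δ r H' h; apply: p_andI; [apply: IH1|apply: IH2].
- by move=> Γ H φ ψ _ IH Δ r H' h; apply: p_andE1; apply: IH h.
- by move=> Γ H φ ψ _ IH Δ r H' h; apply: p_andE2; apply: IH h.
- by move=> Γ H φ ψ _ IH Δ r H' h; apply: p_orI1; apply: IH h.
- by move=> Γ H φ ψ _ IH Δ r H' h; apply: p_orI2; apply: IH h.
- move=> Γ H φ ψ χ _ IH _ IH1 _ IH2 Δ r H' h; apply: p_orE; first exact: IH h.
    by apply: IH1; apply: incl_cons.
  by apply: IH2; apply: incl_cons.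
- by move=> Γ H φ ψ _ IH Δ r H' h; apply: p_impI; apply: IH; apply: incl_cons.
- move=> Γ H φ ψ _ IH1 _ IH2 Δ r H' h; apply: p_impE; first exact: IH1 h.
  exact: IH2.
- by move=> Γ H σ φ _ IH Δ r H' h; apply: p_allI; apply: IH; apply: incl_up.
- move=> Γ H σ φ t _ IH Δ r H' h; rewrite ren_inst.
  by apply: p_allE; apply: IH h.
- move=> Γ H σ φ t _ IH Δ r H' h; apply: (p_exI (t := ren_tm r t)).
  by rewrite -ren_inst; apply: IH.
- move=> Γ H σ φ χ _ IH1 _ IH2 Δ r H' h; apply: p_exE; first exact: IH1 h.
  by rewrite -ren_wk; apply: IH2; apply: incl_cons; apply: incl_up.
Qed.

Lemma proves_wk Γ σ (H : list (fm Γ)) (φ : fm Γ) :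
  proves T H φ -> proves T (List.map (@wk Γ σ) H) (wk σ φ).
Proof. by move=> h; apply: proves_ren h _ _ _ _ => y. Qed.

Lemma ren_fm_id Γ (φ : fm Γ) : ren_fm (fun _ v => v) φ = φ.
Proof.
rewrite -[ren_fm _ φ]sub_fm_Var sub_ren_fm; exact: sub_fm_Var.
Qed.

Lemma proves_incl Γ (H H' : list (fm Γ)) (φ : fm Γ) :
  proves T H φ -> List.incl H H' -> proves T H' φ.
Proof.
move=> h i; rewrite -(ren_fm_id φ); apply: proves_ren h _ _ _ _ => y.
by move=> /List.in_map_iff [x [<- /i]]; rewrite ren_fm_id.
Qed.

(** If [Not φ] had no witness, [p_dne] would give [φ] for a fresh variable. This feeds the [All]
    case of [truth], where a counterexample has to come from an existential formula. *)
Lemma proves_not_all Γ (H : list (fm Γ)) σ (φ : fm (σ :: Γ)) :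
  proves T H (Not (All φ)) -> proves T H (Ex (Not φ)).
Proof.
move=> h; apply: p_dne; apply: p_impI.
apply: (p_impE (φ := All φ)).
  by apply: proves_incl h _ => y; right.
apply: p_allI => /=; apply: p_dne; apply: p_impI.
apply: p_impE; first by apply: p_hyp; right; left.
apply: (p_exI (t := Var vz)).
rewrite -[X in inst X _]/(ren_fm (up_ren (@shift Γ σ)) (Not φ)).
rewrite inst_wk_vz; apply: p_hyp; by left.
Qed.
End Weakening.

Lemma qf_ren Γ Δ (r : ren Γ Δ) (φ : fm Γ) : qf φ -> qf (ren_fm r φ).
Proof.
by elim: φ Δ r => //= {}Γ φ IH1 ψ IH2 Δ r [/IH1 h1 /IH2 h2]; split.
Qed.

Lemma RCA0ω_ren Γ Δ (r : ren Γ Δ) (φ : fm Γ) : RCA0ω φ -> RCA0ω (ren_fm r φ).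
Proof.
move=> h; move: Δ r; case: h => {Γ φ}.
(* Closed axioms are renamed into themselves by computation; the remaining ones mention [eqt] at an
   arbitrary type or a formula parameter. *)
all: try by move=> Γ Δ r; constructor.
- by move=> Γ σ τ Δ r; rewrite /all_ /= ren_eqt; exact: ax_Pi.
- by move=> Γ δ ρ τ Δ r; rewrite /all_ /= ren_eqt; exact: ax_Sigma.
- by move=> Γ ρ τ Δ r; rewrite /all_ /= !ren_eqt; exact: ax_ext.
- move=> Γ φ qφ Δ r /=; rewrite ren_inst /=.
  have -> : ren_fm (up_ren r) (at_succ φ) = at_succ (ren_fm (up_ren r) φ).
    rewrite /at_succ ren_sub_fm sub_ren_fm; congr (sub_fm _ _).
    exact: vcons_ext.
  exact/ax_ind/qf_ren.
- move=> Γ A qA Δ r.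
  have -> : ren_fm r (QF_AC A) = QF_AC (ren_fm (up_ren (up_ren r)) A).
    rewrite /QF_AC /= /qfac_matrix ren_sub_fm sub_ren_fm.
    congr (Imp _ (Ex (All (sub_fm _ _)))).
    by apply: vcons_ext => //; apply: var_cons_ind.
  exact/ax_qfac/qf_ren.
Qed.

Definition nil_ren Δ : ren [::] Δ := fun τ v => match var_nil_False v with end.

Lemma nil_var_ext (T : ty -> Type) (s1 s2 : forall τ, var [::] τ -> T τ) : s1 = s2.
Proof.
apply: functional_extensionality_dep => τ.
by apply: functional_extensionality_dep => v; case: (var_nil_False v).
Qed.

(** * Countability of the syntax *)

Lemma ty_eq_dec (σ τ : ty) : {σ = τ} + {σ <> τ}.
Proof. by decide equality. Qed.

Definition existT_inj (P : ty -> Type) σ (x y : P σ) :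
  existT P σ x = existT P σ y -> x = y := inj_pair2_eq_dec _ ty_eq_dec _ _ _ _.

Local Notation tree := (GenTree.tree nat).
Local Notation Node n l := (@GenTree.Node nat n l).
Local Notation Leaf n := (@GenTree.Leaf nat n).

(** Generic trees over [nat] form a [countType], so injections into them make types and formulas
    enumerable through [pickle]. *)
Fixpoint code_ty (τ : ty) : tree :=
  match τ with
  | N => Leaf 0
  | Arr σ τ => Node 0 [:: code_ty σ; code_ty τ]
  end.

Lemma code_ty_inj : injective code_ty.
Proof. by elim=> [|σ IHσ τ IHτ] [|σ' τ'] //= [] /IHσ -> /IHτ ->. Qed.

Fixpoint code_var Γ τ (v : var Γ τ) : nat :=
  match v with vz _ _ => 0 | vs _ _ _ w => (code_var w).+1 end.

Lemma code_var_inj Γ τ (v : var Γ τ) τ' (v' : var Γ τ') :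
  code_var v = code_var v' -> existT (var Γ) τ v = existT (var Γ) τ' v'.
Proof.
elim: v τ' v' => {Γ τ} [Γ σ|Γ σ τ v IH]; apply: var_cons_ind => //= τ' w [] /IH e.
exact: (f_equal (fun p => existT (var (σ :: Γ)) (projT1 p) (vs (projT2 p))) e).
Qed.

Definition code_const τ (c : const τ) : tree :=
  match c with
  | CZero => Leaf 0
  | COne => Leaf 1
  | CPlus => Leaf 2
  | CTimes => Leaf 3
  | CPi σ τ => Node 0 [:: code_ty σ; code_ty τ]
  | CSigma δ ρ τ => Node 1 [:: code_ty δ; code_ty ρ; code_ty τ]
  | CRec σ => Node 2 [:: code_ty σ]
  end.

Lemma code_const_inj τ (c : const τ) τ' (c' : const τ') :
  code_const c = code_const c' -> existT const τ c = existT const τ' c'.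
Proof.
case: c => [||||σ τ1|δ ρ τ1|σ]; case: c' => [||||σ' τ1'|δ' ρ' τ1'|σ'] //= [].
- by move=> /code_ty_inj -> /code_ty_inj ->.
- by move=> /code_ty_inj -> /code_ty_inj -> /code_ty_inj ->.
- by move=> /code_ty_inj ->.
Qed.

Fixpoint code_tm Γ τ (t : tm Γ τ) : tree :=
  match t with
  | Var _ v => Node 0 [:: Leaf (code_var v)]
  | Cst _ c => Node 1 [:: code_const c]
  | App _ _ f a => Node 2 [:: code_tm f; code_tm a]
  end.

(** The code of an application does not record the argument type; it is recovered from the type of
    the function part. This is why the equality is between dependent pairs. *)
Lemma code_tm_inj Γ τ (t : tm Γ τ) τ' (t' : tm Γ τ') :
  code_tm t = code_tm t' -> existT (tm Γ) τ t = existT (tm Γ) τ' t'.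
Proof.
elim: t τ' t' => {τ} [τ v|τ c|σ τ f IHf a IHa] τ' [{}τ' v'|{}τ' c'|σ' {}τ' f' a'] //= [].
- move=> /code_var_inj e.
  exact: (f_equal (fun p => existT (tm Γ) (projT1 p) (Var (projT2 p))) e).
- move=> /code_const_inj e.
  exact: (f_equal (fun p => existT (tm Γ) (projT1 p) (Cst (projT2 p))) e).
- move=> /IHf ef /IHa ea.
  have [eσ eτ] := f_equal (@projT1 _ _) ef.
  move: ef ea; subst σ' τ' => /(@existT_inj (tm Γ)) -> /(@existT_inj (tm Γ)) ->.
  by [].
Qed.

Fixpoint code_fm Γ (φ : fm Γ) : tree :=
  match φ with
  | Eq t u => Node 0 [:: code_tm t; code_tm u]
  | Lt t u => Node 1 [:: code_tm t; code_tm u]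
  | Bot => Leaf 0
  | And φ ψ => Node 2 [:: code_fm φ; code_fm ψ]
  | Or φ ψ => Node 3 [:: code_fm φ; code_fm ψ]
  | Imp φ ψ => Node 4 [:: code_fm φ; code_fm ψ]
  | All σ φ => Node 5 [:: code_ty σ; code_fm φ]
  | Ex σ φ => Node 6 [:: code_ty σ; code_fm φ]
  end.

Lemma code_fm_inj Γ : injective (@code_fm Γ).
Proof.
elim=> {Γ} [Γ t u|Γ t u|Γ|Γ φ IH1 ψ IH2|Γ φ IH1 ψ IH2|Γ φ IH1 ψ IH2|Γ σ φ IH|Γ σ φ IH];
  case=> [t' u'|t' u'||φ' ψ'|φ' ψ'|φ' ψ'|σ' φ'|σ' φ'] //= [].
- by move=> /code_tm_inj /(@existT_inj (tm Γ)) -> /code_tm_inj /(@existT_inj (tm Γ)) ->.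
- by move=> /code_tm_inj /(@existT_inj (tm Γ)) -> /code_tm_inj /(@existT_inj (tm Γ)) ->.
- by move=> /IH1 -> /IH2 ->.
- by move=> /IH1 -> /IH2 ->.
- by move=> /IH1 -> /IH2 ->.
- by move=> /code_ty_inj e; subst σ' => /IH ->.
- by move=> /code_ty_inj e; subst σ' => /IH ->.
Qed.

Lemma Ex_inj Γ σ : injective (@Ex Γ σ).
Proof.
move=> φ ψ [] e; exact: (inj_pair2_eq_dec _ ty_eq_dec (fun τ => fm (τ :: Γ))).
Qed.

Section Choice.
Variables (A : Type) (a0 : A).

Definition pick_or (P : A -> Prop) : A :=
  if pselect (exists x, P x) is left e then proj1_sig (cid e) else a0.

Lemma pick_orP (P : A -> Prop) x : P x -> P (pick_or P).
Proof.
move=> Px; rewrite /pick_or; case: pselect => [e|[]]; last by exists x.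
by case: (cid e).
Qed.

Lemma pick_or_inv (f : A -> nat) x : injective f -> pick_or (fun y => f y = f x) = x.
Proof. by move=> fI; apply: fI; apply: (pick_orP (P := fun y => f y = f x)). Qed.
End Choice.

(** * Tarskian semantics *)

(** Higher types are arbitrary sets with an application map, not full function spaces, and [eq0] is
    an arbitrary relation: this generality is what a term model needs. *)
Record structure := Structure {
  dom : ty -> Type;
  cst : forall τ, const τ -> dom τ;
  app : forall σ τ, dom (Arr σ τ) -> dom σ -> dom τ;
  eq0 : dom N -> dom N -> Prop;
  lt0 : dom N -> dom N -> Prop }.
Arguments cst : clear implicits.
Arguments app s [σ τ] _ _.

Section Semantics.
Variable S : structure.

Definition env Γ := forall τ, var Γ τ -> dom S τ.

Fixpoint eval Γ (ρ : env Γ) τ (t : tm Γ τ) : dom S τ :=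
  match t with
  | Var _ v => ρ _ v
  | Cst _ c => cst S _ c
  | App _ _ f a => app S (eval ρ f) (eval ρ a)
  end.

Fixpoint sat Γ (ρ : env Γ) (φ : fm Γ) : Prop :=
  match φ with
  | Eq t u => eq0 (eval ρ t) (eval ρ u)
  | Lt t u => lt0 (eval ρ t) (eval ρ u)
  | Bot => False
  | And φ ψ => sat ρ φ /\ sat ρ ψ
  | Or φ ψ => sat ρ φ \/ sat ρ ψ
  | Imp φ ψ => sat ρ φ -> sat ρ ψ
  | All _ φ => forall d, sat (vcons (T := dom S) d ρ) φ
  | Ex _ φ => exists d, sat (vcons (T := dom S) d ρ) φ
  end.

Lemma eval_ren Γ Δ (r : ren Γ Δ) (ρ : env Δ) τ (t : tm Γ τ) :
  eval ρ (ren_tm r t) = eval (fun τ v => ρ τ (r τ v)) t.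
Proof. by elim: t => //= σ {}τ f -> a ->. Qed.

End Semantics.

(** * The Henkin construction *)

Section Thread.
Variables (F : nat -> Type) (next : forall n, F n -> F n.+1) (junk : forall n, F n).

(** From stage [k] on this is [x] pushed forward; earlier values are junk. The equality test only
    serves to cast [x] into [F n]. *)
Fixpoint thread k (x : F k) n : F n :=
  match Nat.eq_dec k n with
  | left e => eq_rect k F x n e
  | right _ => match n with 0 => junk 0 | n'.+1 => next (thread x n') end
  end.

Lemma threadE k (x : F k) n : thread x n =
  match Nat.eq_dec k n with
  | left e => eq_rect k F x n e
  | right _ => match n with 0 => junk 0 | n'.+1 => next (thread x n') end
  end.
Proof. by case: n. Qed.

Lemma thread_refl k (x : F k) : thread x k = x.
Proof. by rewrite threadE; case: Nat.eq_dec => // e; rewrite (eq_irrelevance e erefl). Qed.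

Lemma threadS k (x : F k) n : k <= n -> thread x n.+1 = next (thread x n).
Proof. by move=> kn /=; case: Nat.eq_dec => // e; exfalso; move: kn; rewrite e ltnn. Qed.

Lemma thread_ext (y : forall n, F n) k :
  (forall n, k <= n -> y n.+1 = next (y n)) ->
  forall n, k <= n -> thread (y k) n = y n.
Proof.
move=> ey; elim=> [|n IH].
  by rewrite leqn0 => /eqP e; subst k; rewrite thread_refl.
rewrite leq_eqVlt => /orP[/eqP e|kn]; first by subst k; rewrite thread_refl.
by rewrite threadS // IH // ey.
Qed.
End Thread.

(** The contexts of the Henkin construction are fixed in advance: stage [n] adds
    a variable of type [styp n], which serves as a witness only if the formula
    treated there is existential at that very type.  Every pair of a formula and
    a type recurs at arbitrarily late stages ([stage_hit]). *)
Definition styp (n : nat) : ty :=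
  pick_or N (fun τ => pickle (code_ty τ) = (of_nat (of_nat n).1).2).

Fixpoint hctx n : ctx := if n is n'.+1 then styp n' :: hctx n' else [::].

Definition code_item (p : {k & fm (hctx k)}) : nat :=
  to_nat (projT1 p, pickle (code_fm (projT2 p))).

Lemma pickle_inj (A : countType) : injective (@pickle A).
Proof. exact: (pcan_inj (@pickleK A)). Qed.

Lemma code_item_inj : injective code_item.
Proof.
move=> [k φ] [l ψ] /(f_equal of_nat); rewrite !cancel_of_to /= => -[e].
by subst l => /pickle_inj /code_fm_inj ->.
Qed.

Definition fm_thread k (φ : fm (hctx k)) : forall n, fm (hctx n) :=
  thread (F := fun n => fm (hctx n)) (fun n => @wk (hctx n) (styp n)) (fun n => Bot) φ.

Definition stage (n : nat) : fm (hctx n) :=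
  let p := pick_or (existT (fun k => fm (hctx k)) 0 Bot)
             (fun p => code_item p = (of_nat (of_nat n).1).1) in
  fm_thread (projT2 p) n.

(** A stage number codes a triple of a formula, a type and a padding number. Cantor pairing
    dominates its arguments, so padding with [m] yields a stage beyond [m]. *)
Lemma stage_hit k (φ : fm (hctx k)) σ m :
  exists n, [/\ m <= n, styp n = σ & stage n = fm_thread φ n].
Proof.
pose p := existT (fun k => fm (hctx k)) k φ.
exists (to_nat (to_nat (code_item p, pickle (code_ty σ)), m)); split.
- set x := to_nat (code_item _, _).
  have /leP h := to_nat_non_decreasing x m.
  exact: leq_trans (leq_addr _ _) h.
- rewrite /styp !cancel_of_to /=.
  by rewrite (@pick_or_inv _ _ (fun τ => pickle (code_ty τ))) // => a b /pickle_inj /code_ty_inj.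
- rewrite /stage !cancel_of_to /=.
  by rewrite (@pick_or_inv _ _ code_item p code_item_inj).
Qed.

Fixpoint closed_tm Γ (τ : ty) : tm Γ τ :=
  match τ with
  | N => Cst CZero
  | Arr σ τ => App (Cst (CPi τ σ)) (closed_tm Γ τ)
  end.

Section Henkin.
Variable T : forall Γ, fm Γ -> Prop.
Hypothesis T_ren : forall Γ Δ (r : ren Γ Δ) (φ : fm Γ), T φ -> T (ren_fm r φ).

Definition consistent Γ (H : list (fm Γ)) := ~ proves T H Bot.

Variable φ0 : fm [::].
Hypothesis φ0_consistent : consistent [:: φ0].

(** The variable added by the stage is itself the Henkin witness: the body [ψ] already lives in the
    extended context and is adopted without substitution. *)
Definition next_spec n (H : list (fm (hctx n))) (H' : list (fm (hctx n.+1))) :=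
  [/\ consistent H', List.incl (List.map (@wk _ (styp n)) H) H',
      consistent (stage n :: H) -> List.In (wk (styp n) (stage n)) H' &
      consistent (stage n :: H) ->
        forall ψ : fm (styp n :: hctx n), stage n = Ex ψ -> List.In ψ H'].

Fixpoint hyps n : list (fm (hctx n)) :=
  match n with
  | 0 => [:: φ0]
  | n'.+1 => pick_or [::] (next_spec (hyps n'))
  end.

(** A contradiction that uses a fresh variable generalises to [All Bot], which a closed term
    instantiates; every type has one. *)
Lemma consistent_wk Γ σ (H : list (fm Γ)) :
  consistent H -> consistent (List.map (@wk Γ σ) H).
Proof.
move=> cH /p_allI h; apply: cH.
exact: (p_allE (closed_tm Γ σ) h).
Qed.

Lemma next_specP n (H : list (fm (hctx n))) :
  consistent H -> exists H', next_spec H H'.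
Proof.
move=> cH; case: (pselect (consistent (stage n :: H))) => [cf|ncf]; last first.
  exists (List.map (@wk _ (styp n)) H); split=> //; first exact: consistent_wk.
case: (pselect (exists ψ : fm (styp n :: hctx n), stage n = Ex ψ)) => [[ψ e]|nex].
  exists (ψ :: List.map (@wk _ (styp n)) (stage n :: H)); split=> //.
  (* The new variable does not occur in the weakened hypotheses, so a contradiction from the witness
     is one from the existential formula. *)
  - move=> h; apply: cf; apply: (p_exE (φ := ψ)); last exact: h.
    by rewrite -e; apply: p_hyp; left.
  - by move=> x hx; right; right.
  - by move=> _; right; left.
  - by move=> _ ψ'; rewrite e => /Ex_inj <-; left.
exists (List.map (@wk _ (styp n)) (stage n :: H)); split=> //.
- exact: consistent_wk.
- by move=> x hx; right.
- by move=> _; left.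
- by move=> _ ψ e; case: nex; exists ψ.
Qed.

Lemma hyps_consistent n : consistent (hyps n).
Proof.
elim: n => [//|n /next_specP [H' hH']].
by case: (pick_orP [::] hH').
Qed.

Lemma hypsP n : next_spec (hyps n) (hyps n.+1).
Proof. by have [H' hH'] := next_specP (@hyps_consistent n); exact: (pick_orP _ hH'). Qed.

(** The theory in the limit: [φ] holds at stage [n] if one of its weakenings is
    derivable at a later stage. *)
Inductive Th : forall n, fm (hctx n) -> Prop :=
| Th_here n φ : proves T (hyps n) φ -> @Th n φ
| Th_wk n φ : @Th n.+1 (wk (styp n) φ) -> @Th n φ.

Lemma Th_consistent n φ : @Th n φ -> φ <> Bot.
Proof.
elim=> {n φ} [n φ h e|n φ _ IH e]; last by apply: IH; rewrite e.
by apply: (@hyps_consistent n); rewrite -e.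
Qed.

Lemma Th_S n φ : @Th n φ -> @Th n.+1 (wk (styp n) φ).
Proof.
case=> {n φ} [n φ h|//].
apply: Th_here; apply: (proves_incl T_ren); first exact: proves_wk h.
by case: (hypsP n).
Qed.

(** The two premises may become derivable at different stages. The outer induction moves [φ] forward
    until the implication is derivable, the inner one then moves the implication forward to meet
    [φ]. *)
Lemma Th_mp n (φ ψ : fm (hctx n)) : Th (Imp φ ψ) -> Th φ -> Th ψ.
Proof.
move e: (Imp φ ψ) => χ h; elim: h φ ψ e => {n χ} [n χ h|n χ _ IH] φ ψ e.
  move=> hφ; subst χ; elim: hφ ψ h => {n φ} [n φ h' ψ h|n φ _ IH ψ h].
    by apply: Th_here; apply: p_impE h h'.
  apply: Th_wk; apply: IH.
  apply: (proves_incl T_ren); first exact: (proves_wk T_ren (styp n) h).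
  by case: (hypsP n).
by move=> /Th_S hφ; apply: Th_wk; apply: IH hφ; rewrite -e.
Qed.

Lemma Th_proves n (φ : fm (hctx n)) : proves T [::] φ -> Th φ.
Proof. by move=> h; apply: Th_here; apply: (proves_incl T_ren h). Qed.

Lemma Th_ded n (φ ψ : fm (hctx n)) : proves T [:: φ] ψ -> Th φ -> Th ψ.
Proof. by move=> /p_impI /Th_proves; exact: Th_mp. Qed.

Lemma Th_ded2 n (φ ψ χ : fm (hctx n)) :
  proves T [:: φ; ψ] χ -> Th φ -> Th ψ -> Th χ.
Proof.
by move=> /p_impI /p_impI /Th_proves h hφ hψ; apply: Th_mp hφ; apply: Th_mp hψ.
Qed.

Lemma Th_back (χ : forall n, fm (hctx n)) k :
  (forall n, k <= n -> χ n.+1 = wk (styp n) (χ n)) ->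
  forall n, k <= n -> Th (χ n) -> Th (χ k).
Proof.
move=> eχ; elim=> [|n IH]; first by rewrite leqn0 => /eqP ->.
rewrite leq_eqVlt => /orP[/eqP -> //|kn]; rewrite eχ // => /Th_wk.
exact: IH.
Qed.

Lemma Th_forth (χ : forall n, fm (hctx n)) k :
  (forall n, k <= n -> χ n.+1 = wk (styp n) (χ n)) ->
  forall n, k <= n -> Th (χ k) -> Th (χ n).
Proof.
move=> eχ; elim=> [|n IH]; first by rewrite leqn0 => /eqP ->.
rewrite leq_eqVlt => /orP[/eqP -> //|kn]; rewrite eχ // => /(IH kn).
exact: Th_S.
Qed.

Lemma Th_not n (φ : fm (hctx n)) : Th φ -> Th (Not φ) -> False.
Proof. by move=> h1 h2; apply: (Th_consistent (Th_mp h2 h1)). Qed.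

Lemma Th_stage n : Th (stage n) -> consistent (stage n :: hyps n).
Proof. by move=> h /p_impI /Th_here; apply: Th_not. Qed.

(** The formula is treated at some stage [m] beyond [n]: either it was consistent there and was
    adopted, or the hypotheses of that stage refute it. The verdict is then carried back to [n]; the
    type requested of the stage is arbitrary. *)
Lemma Th_complete n (φ : fm (hctx n)) : Th φ \/ Th (Not φ).
Proof.
have [m [nm _ em]] := stage_hit φ N n.
have eφ k : n <= k -> fm_thread φ k.+1 = wk (styp k) (fm_thread φ k).
  by move=> nk; rewrite /fm_thread threadS.
have e0 : fm_thread φ n = φ by rewrite /fm_thread thread_refl.
case: (hypsP m) => _ _; rewrite em => hm _.
case: (pselect (consistent (fm_thread φ m :: hyps m))) => [c|nc].
  left; rewrite -e0; apply: (Th_back eφ nm); apply: Th_wk; apply: Th_here.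
  by apply: p_hyp; apply: hm.
right; rewrite -e0; apply: (Th_back (χ := fun k => Not (fm_thread φ k)) _ nm).
  by move=> k nk; rewrite eφ.
by apply: Th_here; apply: p_impI; apply: contrapT.
Qed.

(** The direct limit of the terms over [hctx n], with elements presented as
    sequences that are eventually constant up to weakening. *)
Definition raw τ :=
  {s : forall n, tm (hctx n) τ |
    exists k, forall n, k <= n -> s n.+1 = ren_tm (@shift _ (styp n)) (s n)}.

Definition raw_at n τ (s : raw τ) : tm (hctx n) τ := proj1_sig s n.

Program Definition raw_cst τ (c : const τ) : raw τ := exist _ (fun n => Cst c) _.
Next Obligation. by exists 0. Qed.

Program Definition raw_app σ τ (f : raw (Arr σ τ)) (a : raw σ) : raw τ :=
  exist _ (fun n => App (raw_at n f) (raw_at n a)) _.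
Next Obligation.
case: f a => [f [k fk]] [a [l al]]; exists (maxn k l) => n.
by rewrite geq_max => /andP[/fk ef /al ea]; rewrite /raw_at /= ef ea.
Qed.

Definition tm_thread k τ (t : tm (hctx k) τ) : forall n, tm (hctx n) τ :=
  thread (F := fun n => tm (hctx n) τ)
    (fun n t => ren_tm (@shift _ (styp n)) t) (fun n => closed_tm _ τ) t.

Lemma tm_threadS k τ (t : tm (hctx k) τ) n :
  k <= n -> tm_thread t n.+1 = ren_tm (@shift _ (styp n)) (tm_thread t n).
Proof. exact: threadS. Qed.

Definition raw_of k τ (t : tm (hctx k) τ) : raw τ :=
  exist _ (tm_thread t) (ex_intro _ k (@tm_threadS k τ t)).

Lemma raw_at_of k τ (t : tm (hctx k) τ) : raw_at k (raw_of t) = t.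
Proof. exact: (thread_refl (F := fun n => tm (hctx n) τ)). Qed.

Definition henkin : structure := {|
  dom := raw;
  cst := raw_cst;
  app := raw_app;
  eq0 := fun a b => exists k, forall n, k <= n -> Th (Eq (raw_at n a) (raw_at n b));
  lt0 := fun a b => exists k, forall n, k <= n -> Th (Lt (raw_at n a) (raw_at n b)) |}.

Definition env_at n Γ (ρ : env henkin Γ) : sub Γ (hctx n) := fun τ v => raw_at n (ρ τ v).

Lemma raw_at_eval n Γ (ρ : env henkin Γ) τ (t : tm Γ τ) :
  raw_at n (eval ρ t) = sub_tm (env_at n ρ) t.
Proof. by elim: t => //= σ {}τ f <- a <-. Qed.

Lemma env_at_vcons n Γ (ρ : env henkin Γ) σ (d : raw σ) :
  env_at n (vcons (T := dom henkin) d ρ) =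
  vcons (T := tm (hctx n)) (raw_at n d) (env_at n ρ).
Proof. exact: vcons_ext. Qed.

(** A context has finitely many variables, so the stages from which their values stabilise have a
    maximum. *)
Lemma env_at_S Γ (ρ : env henkin Γ) :
  exists k, forall n, k <= n -> forall τ (v : var Γ τ),
    env_at n.+1 ρ v = ren_tm (@shift _ (styp n)) (env_at n ρ v).
Proof.
elim: Γ ρ => [|σ Γ IH] ρ; first by exists 0 => n _ τ v; case: (var_nil_False v).
have [k hk] := IH (fun τ v => ρ τ (vs v)).
case E: (ρ σ vz) => [s [l hl]]; exists (maxn k l) => n.
rewrite geq_max => /andP[kn ln]; apply: var_cons_ind; last exact: hk.
by rewrite /env_at E /raw_at /= hl.
Qed.

Lemma sub_env_at_S Γ (ρ : env henkin Γ) :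
  exists k, forall n, k <= n -> forall φ : fm Γ,
    sub_fm (env_at n.+1 ρ) φ = wk (styp n) (sub_fm (env_at n ρ) φ).
Proof.
have [k hk] := env_at_S ρ; exists k => n kn φ.
rewrite /wk ren_sub_fm; congr (sub_fm _ _).
apply: functional_extensionality_dep => τ; apply: functional_extensionality_dep => v.
exact: hk.
Qed.

Definition eventually_Th Γ (ρ : env henkin Γ) (φ : fm Γ) :=
  exists k, forall n, k <= n -> Th (sub_fm (env_at n ρ) φ).

Lemma eTh_ded Γ (ρ : env henkin Γ) (φ ψ : fm Γ) :
  (forall n, proves T [:: sub_fm (env_at n ρ) φ] (sub_fm (env_at n ρ) ψ)) ->
  eventually_Th ρ φ -> eventually_Th ρ ψ.
Proof. by move=> h [k hk]; exists k => n /hk; apply: Th_ded. Qed.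

Lemma eTh_ded2 Γ (ρ : env henkin Γ) (φ ψ χ : fm Γ) :
  (forall n, proves T [:: sub_fm (env_at n ρ) φ; sub_fm (env_at n ρ) ψ]
                      (sub_fm (env_at n ρ) χ)) ->
  eventually_Th ρ φ -> eventually_Th ρ ψ -> eventually_Th ρ χ.
Proof.
move=> h [k hk] [l hl]; exists (maxn k l) => n.
by rewrite geq_max => /andP[/hk h1 /hl h2]; apply: Th_ded2 h1 h2.
Qed.

Lemma eTh_proves Γ (ρ : env henkin Γ) (φ : fm Γ) :
  (forall n, proves T [::] (sub_fm (env_at n ρ) φ)) -> eventually_Th ρ φ.
Proof. by move=> h; exists 0 => n _; apply: Th_proves. Qed.

(** Once the environment changes only by weakening, completeness at that single stage decides the
    formula, and [Th_forth] carries the verdict to all later stages. *)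
Lemma eTh_not Γ (ρ : env henkin Γ) (φ : fm Γ) :
  eventually_Th ρ (Not φ) <-> ~ eventually_Th ρ φ.
Proof.
split.
  move=> [k hk] [l hl]; apply: (@Th_not (maxn k l)).
    by apply: hl; rewrite leq_maxr.
  by apply: hk; rewrite leq_maxl.
have [k hk] := sub_env_at_S ρ.
have [h|h] := @Th_complete k (sub_fm (env_at k ρ) φ).
  case; exists k => n kn.
  by apply: (Th_forth (χ := fun n => sub_fm (env_at n ρ) φ) _ kn h) => m /hk.
move=> _; exists k => n kn.
by apply: (Th_forth (χ := fun n => sub_fm (env_at n ρ) (Not φ)) _ kn h) => m /hk.
Qed.

Lemma eTh_ex Γ (ρ : env henkin Γ) σ (φ : fm (σ :: Γ)) :
  eventually_Th ρ (Ex φ) <->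
  exists d : raw σ, eventually_Th (vcons (T := dom henkin) d ρ) φ.
Proof.
split; last first.
  move=> [d [k hk]]; exists k => n kn /=.
  apply: Th_ded (hk n kn); apply: (p_exI (t := raw_at n d)).
  by rewrite inst_up_sub -env_at_vcons; apply: p_hyp; left.
move=> [l hl]; have [k0 hk0] := sub_env_at_S ρ; have [k1 hk1] := env_at_S ρ.
(* Beyond [k] the existential formula belongs to the theory, and both the environment and the
   formulas under it change only by weakening. *)
pose k := maxn l (maxn k0 k1).
pose χ n := sub_fm (env_at n ρ) (Ex φ).
have [n [kn eσ en]] := stage_hit (χ k) σ k; subst σ.
have /and3P[ln k0n k1n] : [&& l <= n, k0 <= n & k1 <= n].
  by move: kn; rewrite !geq_max.
have {}en : stage n = χ n.
  rewrite en; apply: (thread_ext (next := fun n => @wk (hctx n) (styp n))) => // m km.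
  by apply: hk0; apply: leq_trans km; rewrite !leq_max leqnn orbT.
have cn : consistent (stage n :: hyps n).
  by apply: Th_stage; rewrite en; apply: hl.
have [_ _ _ /(_ cn _ en) hψ] := hypsP n.
(* The witness is the variable introduced by stage [n], which treats the existential formula at type
   [σ]. *)
exists (@raw_of n.+1 _ (Var vz)).
have hS p : n < p ->
    sub_fm (env_at p.+1 (vcons (T := dom henkin) (@raw_of n.+1 (styp n) (Var vz)) ρ)) φ =
    wk (styp p) (sub_fm (env_at p (vcons (T := dom henkin) (@raw_of n.+1 _ (Var vz)) ρ)) φ).
  move=> np; rewrite /wk ren_sub_fm; congr (sub_fm _ _); apply: vcons_ext => /=.
    by rewrite /env_at /raw_at [LHS]tm_threadS.
  move=> τ v; rewrite -hk1 //.
  exact: leq_trans k1n (ltnW np).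
exists n.+1 => p np.
apply: (Th_forth (χ := fun p => sub_fm (env_at p (vcons (T := dom henkin) (@raw_of n.+1 (styp n) (Var vz)) ρ)) φ) hS np).
apply: Th_here; apply: p_hyp; move: hψ; congr List.In; congr (sub_fm _ _).
apply: vcons_ext; first by symmetry; exact: (@raw_at_of n.+1).
by move=> τ v; rewrite -[RHS]/(env_at n.+1 ρ v) hk1.
Qed.

(** Disjunctions and universal formulas need a disjunct or a counterexample, which is obtained by
    contradiction from [eTh_not]; the existential case rests on the witnesses of [eTh_ex]. *)
Lemma truth Γ (φ : fm Γ) (ρ : env henkin Γ) : sat ρ φ <-> eventually_Th ρ φ.
Proof.
elim: φ ρ => {Γ}.
- move=> Γ t u ρ /=; split=> -[k hk]; exists k => n /hk; by rewrite !raw_at_eval.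
- move=> Γ t u ρ /=; split=> -[k hk]; exists k => n /hk; by rewrite !raw_at_eval.
- move=> Γ ρ; split=> // -[k hk]; exact: (Th_consistent (hk k (leqnn _))).
- move=> Γ φ IH1 ψ IH2 ρ /=; rewrite IH1 IH2; split=> [[]|h].
    apply: eTh_ded2 => n; apply: p_andI; apply: p_hyp; [by left|by right; left].
  split; apply: eTh_ded h => n.
    by apply: p_andE1; apply: p_hyp; left.
  by apply: p_andE2; apply: p_hyp; left.
- move=> Γ φ IH1 ψ IH2 ρ /=; rewrite IH1 IH2; split=> [[]|h].
  + apply: eTh_ded => n; apply: p_orI1; apply: p_hyp; by left.
  + apply: eTh_ded => n; apply: p_orI2; apply: p_hyp; by left.
  + apply: contrapT => /not_orP [/eTh_not h1 /eTh_not h2].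
    have : eventually_Th ρ (And (Not φ) (Not ψ)).
      apply: eTh_ded2 h1 h2 => n.
      by apply: p_andI; apply: p_hyp; [left | right; left].
    suff : eventually_Th ρ (Not (And (Not φ) (Not ψ))) by move=> /eTh_not.
    apply: eTh_ded h => n; apply: p_impI.
    apply: p_orE; first by apply: p_hyp; right; left.
      apply: (p_impE (φ := sub_fm (env_at n ρ) φ)); last by apply: p_hyp; left.
      by apply: p_andE1; apply: p_hyp; right; left.
    apply: (p_impE (φ := sub_fm (env_at n ρ) ψ)); last by apply: p_hyp; left.
    by apply: p_andE2; apply: p_hyp; right; left.
- move=> Γ φ IH1 ψ IH2 ρ /=; rewrite IH1 IH2; split=> [h|].
    case: (pselect (eventually_Th ρ φ)) => [/h|/eTh_not] {h}.
      apply: eTh_ded => n; apply: p_impI; apply: p_hyp; by right; left.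
    apply: eTh_ded => n; apply: p_impI; apply: p_botE.
    apply: p_impE; last by apply: p_hyp; left.
    by apply: p_hyp; right; left.
  apply: eTh_ded2 => n; apply: p_impE; apply: p_hyp; by [left|right; left].
- move=> Γ σ φ IH ρ /=; split=> [h|h d]; last first.
    rewrite IH; case: h => k hk; exists k => n /hk.
    apply: Th_ded; rewrite env_at_vcons -inst_up_sub.
    by apply: p_allE; apply: p_hyp; left.
  apply: contrapT => /eTh_not h1.
  have /eTh_ex [d /eTh_not] : eventually_Th ρ (Ex (Not φ)).
    apply: eTh_ded h1 => n; apply: proves_not_all => //.
    by apply: p_hyp; left.
  by rewrite -IH.
- move=> Γ σ φ IH ρ /=; rewrite eTh_ex; split=> -[d]; rewrite -?IH => h; exists d => //.
  exact/IH.
Qed.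

(** Without hypotheses, the free variables can be generalised and instantiated one at a time; from
    the empty context only a renaming remains. *)
Lemma proves_sub Γ Δ (s : sub Γ Δ) (φ : fm Γ) :
  proves T [::] φ -> proves T [::] (sub_fm s φ).
Proof.
elim: Γ s φ => [|σ Γ IH] s φ h.
  have := proves_ren T_ren h (r := nil_ren Δ) (H' := [::]) (fun _ h => h).
  rewrite -(sub_fm_Var (ren_fm _ _)) sub_ren_fm.
  by rewrite (nil_var_ext (fun τ v => Var (nil_ren Δ v)) s).
have := p_allI (H := [::]) h; move=> /(IH (fun τ v => s τ (vs v))) /=.
move=> /(p_allE (s σ vz)); rewrite inst_up_sub.
by congr (proves T [::] (sub_fm _ _)); apply: vcons_ext.
Qed.

Lemma henkin_proves Γ (ρ : env henkin Γ) (φ : fm Γ) : proves T [::] φ -> sat ρ φ.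
Proof. by move=> h; apply/truth/eTh_proves => n; apply: proves_sub. Qed.

Lemma henkin_hyp (ρ : env henkin [::]) : sat ρ φ0.
Proof.
apply/truth.
have h : Th (sub_fm (env_at 0 ρ) φ0).
  apply: Th_here; apply: p_hyp; left.
  by rewrite -[LHS]sub_fm_Var; congr sub_fm; apply: nil_var_ext.
have hS n : 0 <= n -> sub_fm (env_at n.+1 ρ) φ0 = wk (styp n) (sub_fm (env_at n ρ) φ0).
  by move=> _; rewrite /wk ren_sub_fm; congr (sub_fm _ _); apply: nil_var_ext.
by exists 0 => n n0; exact: (Th_forth (χ := fun n => sub_fm (env_at n ρ) φ0) hS n0 h).
Qed.

End Henkin.

Lemma sig_eq (A : Type) (P : A -> Prop) (s t : {x | P x}) :
  proj1_sig s = proj1_sig t -> s = t.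
Proof.
by case: s t => [x px] [y py] /= e; subst y; rewrite (Prop_irrelevance px py).
Qed.

(** * Extensional models *)

Record extensional_model (S : structure) : Prop := {
  eq0E : forall a b : dom S N, eq0 a b <-> a = b;
  app_ext : forall σ τ (f g : dom S (Arr σ τ)),
    (forall x, app S f x = app S g x) -> f = g;
  axioms_hold : forall Γ (ρ : env S Γ) φ, RCA0ω φ -> sat ρ φ }.

Section Quotient.
Variable S : structure.
Hypothesis S_ax : forall Γ (ρ : env S Γ) φ, RCA0ω φ -> sat ρ φ.

Fixpoint eqS τ : dom S τ -> dom S τ -> Prop :=
  match τ with
  | N => fun a b => eq0 a b
  | Arr σ τ => fun f g => forall x, eqS (app S f x) (app S g x)
  end.

Definition nil_env : env S [::] := fun τ v => match var_nil_False v with end.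

Lemma sat_eqt Γ (ρ : env S Γ) τ (t u : tm Γ τ) :
  sat ρ (eqt t u) <-> eqS (eval ρ t) (eval ρ u).
Proof.
elim: τ Γ ρ t u => //= σ _ τ IH Γ ρ t u.
by split=> h d; move: (h d); rewrite IH /= !eval_ren.
Qed.

Lemma eqS_refl τ (a : dom S τ) : eqS a a.
Proof.
elim: τ a => [|σ _ τ IH] /= a; last by move=> x.
exact: (S_ax nil_env (ax_eq_refl _)).
Qed.

Lemma eqS_sym τ (a b : dom S τ) : eqS a b -> eqS b a.
Proof.
elim: τ a b => [|σ _ τ IH] /= a b; last by move=> h x; apply: IH.
exact: (S_ax nil_env (ax_eq_sym _)).
Qed.

Lemma eqS_trans τ (a b c : dom S τ) : eqS a b -> eqS b c -> eqS a c.
Proof.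
elim: τ a b c => [|σ _ τ IH] /= a b c; last by move=> h1 h2 x; apply: IH (h1 x) (h2 x).
exact: (S_ax nil_env (ax_eq_trans _)).
Qed.

(** Congruence in the function is what [eqS] means at an arrow type; congruence in the argument is
    the extensionality axiom. *)
Lemma eqS_app σ τ (f g : dom S (Arr σ τ)) a b :
  eqS f g -> eqS a b -> eqS (app S f a) (app S g b).
Proof.
move=> fg ab; apply: (eqS_trans (b := app S f b)); last exact: fg.
(* The axiom instance is restated without liftings, since [eqt] does not compute at a variable
   type. *)
have h : sat (vcons (T := dom S) f (vcons (T := dom S) b (vcons (T := dom S) a nil_env)))
    (Imp (eqt (Var (vs (vs vz))) (Var (vs vz)))
      (eqt (App (Var vz) (Var (vs (vs vz)))) (App (Var vz) (Var (vs vz))))).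
  exact: (S_ax nil_env (ax_ext [::] σ τ)).
by move: h => /= /[!sat_eqt]; exact.
Qed.

(** Classes are represented by predicates, so that functional and propositional extensionality
    identify the classes of [eqS]-equal elements. *)
Definition qdom τ := {c : dom S τ -> Prop | exists a, c = eqS a}.

Definition cls τ (a : dom S τ) : qdom τ := exist _ (eqS a) (ex_intro _ a erefl).

Definition rep τ (c : qdom τ) : dom S τ := proj1_sig (cid (proj2_sig c)).

Lemma cls_eq τ (a b : dom S τ) : cls a = cls b <-> eqS a b.
Proof.
split=> [[e]|e]; first by rewrite e; apply: eqS_refl.
apply: sig_eq => /=; apply: funext => c; apply: propext; split.
  exact: eqS_trans (eqS_sym e).
exact: eqS_trans e.
Qed.

Lemma rep_cls τ (c : qdom τ) : cls (rep c) = c.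
Proof. by rewrite /rep; case: cid => a e; apply: sig_eq. Qed.

Definition quotient : structure := {|
  dom := qdom;
  cst := fun τ c => cls (cst S τ c);
  app := fun σ τ f a => cls (app S (rep f) (rep a));
  eq0 := eq;
  lt0 := fun a b => lt0 (rep a) (rep b) |}.

Lemma app_cls σ τ (f : dom S (Arr σ τ)) a :
  app quotient (cls f) (cls a) = cls (app S f a).
Proof. by apply/cls_eq; apply: eqS_app; apply/cls_eq; rewrite rep_cls. Qed.

Definition env_cls Γ (ρ : env S Γ) : env quotient Γ := fun τ v => cls (ρ τ v).

Lemma eval_cls Γ (ρ : env S Γ) τ (t : tm Γ τ) : eval (env_cls ρ) t = cls (eval ρ t).
Proof. by elim: t => // σ {}τ f IHf a IHa; rewrite [eval ρ _]/= -app_cls -IHf -IHa. Qed.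

Lemma env_cls_vcons Γ (ρ : env S Γ) σ (d : dom S σ) :
  vcons (T := dom quotient) (cls d) (env_cls ρ) = env_cls (vcons (T := dom S) d ρ).
Proof. exact: vcons_ext. Qed.

Lemma lt0_congr (a b a' b' : dom S N) : eqS a a' -> eqS b b' -> lt0 a b -> lt0 a' b'.
Proof. exact: (S_ax nil_env (ax_lt_eq _)). Qed.

Lemma sat_cls Γ (ρ : env S Γ) φ : sat (env_cls ρ) φ <-> sat ρ φ.
Proof.
elim: φ ρ => {Γ} //=.
- by move=> Γ t u ρ; rewrite !eval_cls cls_eq.
- move=> Γ t u ρ; rewrite !eval_cls; split; apply: lt0_congr; apply/cls_eq;
  by rewrite ?rep_cls.
- by move=> Γ φ IH1 ψ IH2 ρ; rewrite IH1 IH2.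
- by move=> Γ φ IH1 ψ IH2 ρ; rewrite IH1 IH2.
- by move=> Γ φ IH1 ψ IH2 ρ; rewrite IH1 IH2.
- move=> Γ σ φ IH ρ; split=> h d; first by apply/IH; rewrite -env_cls_vcons.
  by rewrite -(rep_cls d) env_cls_vcons; apply/IH.
- move=> Γ σ φ IH ρ; split=> -[d]; last first.
    by move=> /IH h; exists (cls d); rewrite env_cls_vcons.
  by rewrite -(rep_cls d) env_cls_vcons => /IH h; exists (rep d).
Qed.

Lemma quotient_model : extensional_model quotient.
Proof.
split=> //.
- move=> σ τ f g; rewrite -(rep_cls f) -(rep_cls g) => h.
  apply/cls_eq => x; apply/cls_eq; rewrite -!app_cls; exact: h.
- move=> Γ ρ φ hφ.
  have -> : ρ = env_cls (fun τ v => rep (ρ τ v)).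
    apply: functional_extensionality_dep => τ; apply: functional_extensionality_dep => v.
    by rewrite /env_cls rep_cls.
  by apply/sat_cls; apply: S_ax.
Qed.

End Quotient.

Theorem completeness (φ : fm [::]) :
  (forall S, extensional_model S -> forall ρ : env S [::], sat ρ φ) -> RCA0ω_proves φ.
Proof.
move=> h; apply: contrapT => nφ.
have c : consistent RCA0ω [:: Not φ].
  by move=> hb; apply: nφ; apply: p_dne; apply: p_impI.
have ax Γ (ρ : env (henkin RCA0ω (Not φ)) Γ) ψ : RCA0ω ψ -> sat ρ ψ.
  by move=> hψ; apply: (henkin_proves RCA0ω_ren c); apply: p_ax.
pose ρ := nil_env (henkin RCA0ω (Not φ)).
have := henkin_hyp RCA0ω_ren c ρ; apply => /=.
have := h _ (quotient_model ax) (env_cls ρ).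
by move=> /(sat_cls ax).
Qed.

(** * Combinatory and arithmetical calculus in a model *)

Record model := Model { str :> structure; strP : extensional_model str }.

Declare Scope model_scope.
Delimit Scope model_scope with M.
Notation "f '@' a" := (app _ f a) (at level 38, left associativity) : model_scope.
Notation "0" := (cst _ _ CZero) : model_scope.
Notation "1" := (cst _ _ COne) : model_scope.
Notation "x + y" := (cst _ _ CPlus @ x @ y)%M : model_scope.
Notation "x * y" := (cst _ _ CTimes @ x @ y)%M : model_scope.
Notation "x < y" := (lt0 x y) : model_scope.
Local Open Scope model_scope.

Lemma eval_sub (S : structure) Γ Δ (s : sub Γ Δ) (ρ : env S Δ) τ (t : tm Γ τ) :
  eval ρ (sub_tm s t) = eval (fun τ v => eval ρ (s τ v)) t.
Proof. by elim: t => //= σ {}τ f -> a ->. Qed.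

Lemma sat_sub (S : structure) Γ Δ (s : sub Γ Δ) (ρ : env S Δ) (φ : fm Γ) :
  sat ρ (sub_fm s φ) <-> sat (fun τ v => eval ρ (s τ v)) φ.
Proof.
have up G D (s' : sub G D) (ρ' : env S D) σ d :
    (fun τ (v : var (σ :: G) τ) => eval (vcons (T := dom S) d ρ') (up_sub s' v)) =
    vcons (T := dom S) d (fun τ v => eval ρ' (s' τ v)).
  by apply: vcons_ext => // τ v; rewrite /= eval_ren.
elim: φ Δ s ρ => {Γ} /=.
- by move=> Γ t u Δ s ρ; rewrite !eval_sub.
- by move=> Γ t u Δ s ρ; rewrite !eval_sub.
- by [].
- by move=> Γ φ IH1 ψ IH2 Δ s ρ; rewrite IH1 IH2.
- by move=> Γ φ IH1 ψ IH2 Δ s ρ; rewrite IH1 IH2.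
- by move=> Γ φ IH1 ψ IH2 Δ s ρ; rewrite IH1 IH2.
- by move=> Γ σ φ IH Δ s ρ; split=> h d; move: (h d); rewrite IH up.
- by move=> Γ σ φ IH Δ s ρ; split=> -[d h]; exists d; move: h; rewrite IH up.
Qed.

Section Calculus.
Variable M : model.
Local Notation dom := (dom M).
Local Notation "'ω'" := (dom N).
Local Notation env := (env M).
Local Notation nil_env := (nil_env M).
Local Notation succ x := (x + 1).

Let ax Γ (ρ : env Γ) φ : RCA0ω φ -> sat ρ φ := axioms_hold (strP M) ρ (φ := φ).
Let ext σ τ (f g : dom (Arr σ τ)) : (forall x, f @ x = g @ x) -> f = g :=
  @app_ext _ (strP M) σ τ f g.
Let e0 (a b : ω) : eq0 a b -> a = b := proj1 (eq0E (strP M) a b).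

Lemma madd0 (x : ω) : x + 0 = x.
Proof. by apply: e0; apply: (ax nil_env (ax_add_0 _)). Qed.
Lemma maddC (x y : ω) : x + y = y + x.
Proof. by apply: e0; apply: (ax nil_env (ax_add_comm _)). Qed.
Lemma maddA (x y z : ω) : x + y + z = x + (y + z).
Proof. by apply: e0; apply: (ax nil_env (ax_add_assoc _)). Qed.
Lemma mmul0 (x : ω) : x * 0 = 0.
Proof. by apply: e0; apply: (ax nil_env (ax_mul_0 _)). Qed.
Lemma mmul1 (x : ω) : x * 1 = x.
Proof. by apply: e0; apply: (ax nil_env (ax_mul_1 _)). Qed.
Lemma mmulC (x y : ω) : x * y = y * x.
Proof. by apply: e0; apply: (ax nil_env (ax_mul_comm _)). Qed.
Lemma mmulA (x y z : ω) : x * y * z = x * (y * z).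
Proof. by apply: e0; apply: (ax nil_env (ax_mul_assoc _)). Qed.
Lemma mmulDr (x y z : ω) : x * (y + z) = x * y + x * z.
Proof. by apply: e0; apply: (ax nil_env (ax_distr _)). Qed.
Lemma mltnn (x : ω) : ~ x < x.
Proof. exact: (ax nil_env (ax_lt_irrefl _)). Qed.
Lemma mlt_trans (x y z : ω) : x < y -> y < z -> x < z.
Proof. exact: (ax nil_env (ax_lt_trans _)). Qed.
Lemma mlt_total (x y : ω) : x < y \/ x = y \/ y < x.
Proof.
by case: (ax nil_env (ax_lt_total _) x y) => [|[/e0|]]; [left|right; left|right; right].
Qed.
Lemma mlt01 : (0 : ω) < 1.
Proof. exact: (ax nil_env (ax_lt_0_1 _)). Qed.
Lemma mltD2r (z x y : ω) : x < y -> x + z < y + z.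
Proof. exact: (ax nil_env (ax_lt_add _)). Qed.
Lemma mltM2r (z x y : ω) : 0 < z -> x < y -> x * z < y * z.
Proof. exact: (ax nil_env (ax_lt_mul _)). Qed.

Lemma sat_eqtE Γ (ρ : env Γ) τ (t u : tm Γ τ) :
  sat ρ (eqt t u) <-> eval ρ t = eval ρ u.
Proof.
rewrite sat_eqt; move: (eval ρ t) (eval ρ u) => {t u}.
elim: τ => [|σ _ τ IH] a b /=; first exact: (eq0E (strP M)).
by split=> [h|-> x]; [apply: ext => x; apply/IH | apply/IH].
Qed.

Lemma PiE σ τ (x : dom σ) (y : dom τ) : cst M _ (CPi σ τ) @ x @ y = x.
Proof.
have h : sat (vcons (T := dom) y (vcons (T := dom) x nil_env))
   (eqt (App (App (Cst (CPi σ τ)) (Var (vs vz))) (Var vz)) (Var (vs vz))).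
  exact: (ax nil_env (ax_Pi _ σ τ)).
by move: h; rewrite sat_eqtE.
Qed.

Lemma SigmaE δ ρ τ x y (z : dom δ) :
  cst M _ (CSigma δ ρ τ) @ x @ y @ z = x @ z @ (y @ z).
Proof.
have h : sat (vcons (T := dom) z (vcons (T := dom) y (vcons (T := dom) x nil_env)))
   (eqt (App (App (App (Cst (CSigma δ ρ τ)) (Var (vs (vs vz)))) (Var (vs vz))) (Var vz))
     (App (App (Var (vs (vs vz))) (Var vz)) (App (Var (vs vz)) (Var vz)))).
  exact: (ax nil_env (ax_Sigma _ δ ρ τ)).
by move: h; rewrite sat_eqtE.
Qed.

(** Junk unless some element of the model represents [F]; by extensionality there is at most one.
    Terms can thus be evaluated before definability is checked. *)
Definition abs σ τ (F : dom σ -> dom τ) : dom (Arr σ τ) :=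
  pick_or (eval nil_env (closed_tm _ _)) (fun f => forall x, f @ x = F x).

Lemma abs_eq σ τ (F : dom σ -> dom τ) f : (forall x, f @ x = F x) -> f = abs F.
Proof.
move=> h; apply: ext => x; rewrite h.
by symmetry; apply: (pick_orP _ (P := fun f => forall x, f @ x = F x) h).
Qed.

Lemma eval_lam Γ (ρ : env Γ) σ τ (t : tm (σ :: Γ) τ) :
  eval ρ (lam t) = abs (fun d => eval (vcons (T := dom) d ρ) t).
Proof.
apply: abs_eq => d; elim: t => {τ} /= [|τ c|τ1 τ2 f IHf a IHa].
- apply: var_cons_ind => [|τ v] /=; first by rewrite SigmaE !PiE.
  by rewrite PiE.
- by rewrite PiE.
- by rewrite SigmaE IHf IHa.
Qed.

(** Functions of finitely many arguments (innermost variable first) that are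
    given by an element of the model. *)
Fixpoint args Γ : Type := if Γ is σ :: Γ' then (dom σ * args Γ')%type else unit.

Fixpoint definable Γ τ : (args Γ -> dom τ) -> Prop :=
  match Γ return (args Γ -> dom τ) -> Prop with
  | [::] => fun _ => True
  | σ :: Γ' => fun F => exists2 G : args Γ' -> dom (Arr σ τ),
      definable G & forall x ρ, G ρ @ x = F (x, ρ)
  end.

Lemma def_const Γ τ (c : dom τ) : definable (fun _ : args Γ => c).
Proof.
elim: Γ τ c => //= σ Γ IH τ c.
by exists (fun _ => cst M _ (CPi τ σ) @ c) => // x ρ; rewrite PiE.
Qed.

(** Combinatory completeness: Σ distributes the innermost variable over the application, and
    induction on the context treats the others. *)
Lemma def_app Γ σ τ (F : args Γ -> dom (Arr σ τ)) (A : args Γ -> dom σ) :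
  definable F -> definable A -> definable (fun ρ => F ρ @ A ρ).
Proof.
elim: Γ σ τ F A => //= δ Γ IH σ τ F A [F' dF eF] [A' dA eA].
exists (fun ρ => cst M _ (CSigma δ σ τ) @ F' ρ @ A' ρ).
  by apply: (IH) => //; apply: IH => //; apply: def_const.
by move=> x ρ; rewrite SigmaE eF eA.
Qed.

Lemma def_v0 Γ σ : definable (fun ρ : args (σ :: Γ) => ρ.1).
Proof.
exists (fun _ => cst M _ (CSigma σ (Arr σ σ) σ) @ cst M _ (CPi σ (Arr σ σ)) @ cst M _ (CPi σ σ)).
  exact: def_const.
by move=> x ρ; rewrite SigmaE !PiE.
Qed.

Lemma def_vs Γ σ τ (F : args Γ -> dom τ) :
  definable F -> definable (fun ρ : args (σ :: Γ) => F ρ.2).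
Proof.
move=> dF; exists (fun ρ => cst M _ (CPi τ σ) @ F ρ); last by move=> x ρ; rewrite PiE.
by apply: def_app => //; apply: def_const.
Qed.

Lemma def_v1 Γ σ0 σ1 : definable (fun ρ : args (σ0 :: σ1 :: Γ) => ρ.2.1).
Proof. exact: (def_vs σ0 (def_v0 Γ σ1)). Qed.
Lemma def_v2 Γ σ0 σ1 σ2 : definable (fun ρ : args (σ0 :: σ1 :: σ2 :: Γ) => ρ.2.2.1).
Proof. exact: (def_vs σ0 (def_v1 Γ σ1 σ2)). Qed.
Lemma def_v3 Γ σ0 σ1 σ2 σ3 :
  definable (fun ρ : args (σ0 :: σ1 :: σ2 :: σ3 :: Γ) => ρ.2.2.2.1).
Proof. exact: (def_vs σ0 (def_v2 Γ σ1 σ2 σ3)). Qed.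
Lemma def_v4 Γ σ0 σ1 σ2 σ3 σ4 :
  definable (fun ρ : args (σ0 :: σ1 :: σ2 :: σ3 :: σ4 :: Γ) => ρ.2.2.2.2.1).
Proof. exact: (def_vs σ0 (def_v3 Γ σ1 σ2 σ3 σ4)). Qed.

Lemma abs_beta Γ σ τ (F : dom σ -> args Γ -> dom τ) ρ x :
  definable (fun p : args (σ :: Γ) => F p.1 p.2) -> abs (fun x => F x ρ) @ x = F x ρ.
Proof. by move=> [G _ eG]; rewrite -(abs_eq (f := G ρ)) // eG. Qed.

Lemma def_abs Γ σ τ (F : dom σ -> args Γ -> dom τ) :
  definable (fun p : args (σ :: Γ) => F p.1 p.2) ->
  definable (fun ρ => abs (fun x => F x ρ)).
Proof.
move=> [G dG eG]; congr definable: dG; apply: funext => ρ.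
by apply: abs_eq => x; rewrite eG.
Qed.

Lemma abs1E σ τ (F : dom σ -> dom τ) x :
  definable (fun p : args [:: σ] => F p.1) -> abs F @ x = F x.
Proof. exact: (@abs_beta [::] σ τ (fun x _ => F x) tt). Qed.

Lemma abs2E σ1 σ2 τ (F : dom σ1 -> dom σ2 -> dom τ) x y :
  definable (fun p : args [:: σ2; σ1] => F p.2.1 p.1) ->
  abs (fun x => abs (F x)) @ x @ y = F x y.
Proof.
move=> h; rewrite abs1E; last first.
  exact: (@def_abs [:: σ1] σ2 τ (fun y p => F p.1 y)).
exact: (@abs_beta [:: σ1] σ2 τ (fun y p => F p.1 y) (x, tt)).
Qed.

Lemma abs3E σ1 σ2 σ3 τ (F : dom σ1 -> dom σ2 -> dom σ3 -> dom τ) x y z :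
  definable (fun p : args [:: σ3; σ2; σ1] => F p.2.2.1 p.2.1 p.1) ->
  abs (fun x => abs (fun y => abs (F x y))) @ x @ y @ z = F x y z.
Proof.
move=> h; have h' : definable (fun p : args [:: σ2; σ1] => abs (F p.2.1 p.1)).
  exact: (@def_abs [:: σ2; σ1] σ3 τ (fun z p => F p.2.1 p.1 z)).
rewrite abs2E //.
exact: (@abs_beta [:: σ2; σ1] σ3 τ (fun z p => F p.2.1 p.1 z) (y, (x, tt))).
Qed.

Definition recE (F : ω -> ω -> ω) : dom (Arr N (Arr N N)) :=
  cst M _ (CRec N) @ abs (fun k => abs (F k)).

Lemma rec0E F m : recE F @ m @ 0 = m.
Proof. by apply: e0; apply: (ax nil_env (ax_R0_0 _)). Qed.

Lemma recSE F m n : definable (fun p : args [:: N; N] => F p.2.1 p.1) ->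
  recE F @ m @ succ n = F n (recE F @ m @ n).
Proof.
move=> dF; rewrite -(@abs2E N N N F) //.
by apply: e0; apply: (ax nil_env (ax_R0_S _)).
Qed.
End Calculus.
Arguments recE : simpl never.

Ltac def := lazymatch goal with
  | |- definable (fun _ => ?c) => apply: def_const
  | |- definable (fun ρ => app _ (@?F ρ) (@?A ρ)) => apply: (def_app (F := F) (A := A)); def
  | |- definable (fun ρ => abs (fun x => @?F x ρ)) => apply: (def_abs (F := F)); cbn beta; def
  | |- _ => first [ exact: def_v0 | exact: def_v1 | exact: def_v2 | exact: def_v3 | exact: def_v4 ]
  end.

Definition madd (M : model) (x y : dom M N) := x + y.
Definition mmul (M : model) (x y : dom M N) := x * y.
Ltac mring :=
  repeat change (cst _ _ CPlus @ ?x @ ?y) with (madd x y);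
  repeat change (cst _ _ CTimes @ ?x @ ?y) with (mmul x y); ring.

Section Arithmetic.
Variable M : model.
Local Notation dom := (dom M).
Local Notation "'ω'" := (dom N).
Local Notation env := (env M).
Local Notation nil_env := (nil_env M).
Local Notation args := (args M).

Lemma mring : semi_ring_theory (0 : ω) (1 : ω) (@madd M) (@mmul M) eq.
Proof.
rewrite /madd /mmul; split=> [x|x y|x y z|x|x|x y|x y z|x y z].
- by rewrite maddC madd0.
- exact: maddC.
- by rewrite maddA.
- by rewrite mmulC mmul1.
- by rewrite mmulC mmul0.
- exact: mmulC.
- by rewrite mmulA.
- by rewrite mmulC mmulDr !(mmulC z).
Qed.
Add Ring mring : mring.
Definition lt_or_eq (x y : ω) := x < y \/ x = y.
Local Notation "x <= y" := (lt_or_eq x y).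

Lemma qf_ind Γ (ρ : env Γ) (φ : fm (N :: Γ)) : qf φ ->
  sat (vcons (T := dom) (0 : ω) ρ) φ ->
  (forall n : ω, sat (vcons (T := dom) n ρ) φ -> sat (vcons (T := dom) (n + 1) ρ) φ) ->
  forall n : ω, sat (vcons (T := dom) n ρ) φ.
Proof.
move=> qφ h0 hS; apply: (axioms_hold (strP M) ρ (ax_ind qφ)); split.
  apply/sat_sub; move: h0; congr sat.
  exact: vcons_ext.
move=> n /hS h; apply/sat_sub; move: h; congr sat.
exact: vcons_ext.
Qed.

Lemma mltS (n : ω) : n < n + 1.
Proof. by have := mltD2r n (mlt01 M); rewrite maddC madd0 maddC. Qed.

Lemma m0_or_pos (n : ω) : n = 0 \/ 0 < n.
Proof.
have h := qf_ind (ρ := nil_env) (φ := Or (Eq (Var vz) (Cst CZero)) (Lt (Cst CZero) (Var vz))).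
case: (h _ _ _ n) => //=.
- by left; apply/(eq0E (strP M)).
- move=> m [/(eq0E (strP M)) ->|h0]; right; first exact: mltS.
  exact: mlt_trans h0 (mltS m).
- by move=> /(eq0E (strP M)); left.
- by right.
Qed.

Lemma mle0 (n : ω) : 0 <= n.
Proof. by case: (m0_or_pos n); [right|left]. Qed.

Lemma mnlt0 (n : ω) : ~ n < 0.
Proof.
by case: (mle0 n) => [h1 h2|-> /mltnn //]; apply: (mltnn (mlt_trans h1 h2)).
Qed.

Lemma msucc_neq0 (n : ω) : n + 1 <> 0.
Proof. by move=> e; apply: (@mnlt0 n); rewrite -e; apply: mltS. Qed.

Lemma madd_inj (z x y : ω) : x + z = y + z -> x = y.
Proof.
by case: (mlt_total x y) => [/(mltD2r z)|[//|/(mltD2r z)]] + e; rewrite e => /mltnn.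
Qed.

Lemma mle_lt_trans (y x z : ω) : x <= y -> y < z -> x < z.
Proof. by move=> [/mlt_trans h /h|->]. Qed.
Lemma mlt_le_trans (y x z : ω) : x < y -> y <= z -> x < z.
Proof. by move=> h [|<- //]; apply: mlt_trans. Qed.
Lemma mle_trans (y x z : ω) : x <= y -> y <= z -> x <= z.
Proof. by move=> [h1|-> //] h2; left; apply: mlt_le_trans h1 h2. Qed.
Lemma mnlt (x y : ω) : ~ x < y <-> y <= x.
Proof.
split=> [h|h1 h2]; last by apply: (mltnn (mle_lt_trans h1 h2)).
by case: (mlt_total x y) => [//|[->|]]; [right|left].
Qed.
Lemma mnle (x y : ω) : ~ x <= y <-> y < x.
Proof.
split=> [h|h1 /mnlt //].
by case: (mlt_total y x) => [//|[e|h']]; case: h; [right|left].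
Qed.
Lemma mle_anti (x y : ω) : x <= y -> y <= x -> x = y.
Proof. by move=> [h1|//] /mnlt. Qed.

(** Names ending in [E] denote elements of the model, to be applied with [@]. *)
Definition predE : dom (Arr N N) := abs (fun x : ω => recE (fun k m => k) @ 0 @ x).

Lemma pred0 : predE @ 0 = 0.
Proof. by rewrite /predE abs1E ?rec0E //; rewrite /recE; def. Qed.
Lemma predS (n : ω) : predE @ (n + 1) = n.
Proof. by rewrite /predE abs1E ?recSE //; rewrite /recE; def. Qed.

(** Naming the predecessor by [predE] removes the existential quantifier, so that quantifier-free
    induction applies. *)
Lemma m0_or_succ (n : ω) : n = 0 \/ exists m, n = m + 1.
Proof.
have h := qf_ind (ρ := vcons (T := dom) predE nil_env)
  (φ := Or (Eq (Var vz) (Cst CZero))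
           (Eq (Var vz) (App (App (Cst CPlus) (App (Var (vs vz)) (Var vz))) (Cst COne)))).
case: (h _ _ _ n) => //= [|m _|/(eq0E (strP M))|/(eq0E (strP M)) ->].
- by left; apply/(eq0E (strP M)).
- by right; apply/(eq0E (strP M)); rewrite predS.
- by left.
- by right; exists (predE @ n).
Qed.

Definition subE : dom (Arr N (Arr N N)) :=
  abs (fun x : ω => abs (fun y : ω => recE (fun k m => predE @ m) @ x @ y)).
Local Notation "x - y" := (subE @ x @ y).

Lemma sub0 (x : ω) : x - 0 = x.
Proof. by rewrite /subE abs2E ?rec0E //; rewrite /recE; def. Qed.
Lemma subS (x n : ω) : x - (n + 1) = predE @ (x - n).
Proof. by rewrite /subE !abs2E ?recSE //; rewrite /recE; def. Qed.

Lemma sub_addK (x y : ω) : x <= y -> x + (y - x) = y.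
Proof.
have h := qf_ind (ρ := vcons (T := dom) subE (vcons (T := dom) (y : ω) nil_env))
  (φ := Imp (Or (Lt (Var vz) (Var (vs (vs vz)))) (Eq (Var vz) (Var (vs (vs vz)))))
     (Eq (App (App (Cst CPlus) (Var vz)) (App (App (Var (vs vz)) (Var (vs (vs vz)))) (Var vz)))
         (Var (vs (vs vz))))).
have {}h : forall n : ω, (n < y \/ eq0 n y) -> eq0 (n + (y - n)) y.
  apply: h => //= [_|n IH hn]; first by apply/(eq0E (strP M)); rewrite sub0; mring.
  have nSy : n + 1 <= y by case: hn => [|/(eq0E (strP M))]; [left|right].
  have ny : n < y := mlt_le_trans (mltS n) nSy.
  move: (IH (or_introl ny)) => /(eq0E (strP M)) e; apply/(eq0E (strP M)).
  rewrite subS; case: (m0_or_succ (y - n)) => [e'|[d e']].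
    have e2 : n = y by rewrite -[RHS]e e' madd0.
    by move: ny; rewrite e2 => /mltnn.
  by rewrite e' predS -[in RHS]e e'; mring.
by move=> [|/(eq0E (strP M))] xy; apply/(eq0E (strP M))/h; [left|right].
Qed.

Lemma mleP (x y : ω) : x <= y <-> exists z, y = x + z.
Proof.
split=> [/sub_addK <-|[z ->]]; first by exists (y - x).
by case: (mle0 z) => [/(mltD2r x)|<-]; [rewrite maddC madd0 maddC; left|right; mring].
Qed.

Lemma mltP (x y : ω) : x < y <-> exists z, y = x + z + 1.
Proof.
split=> [h|[z ->]].
  have [z e] := proj1 (mleP x y) (or_introl h).
  case: (m0_or_succ z) => [e'|[d e']]; last by exists d; rewrite e e'; mring.
  by move: h; rewrite e e' madd0 => /mltnn.
apply: (@mle_lt_trans (x + z)); last exact: mltS.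
by apply/mleP; exists z.
Qed.

Lemma mltS_le (x y : ω) : x < y + 1 <-> x <= y.
Proof.
split=> [/mltP [z]|h]; last exact: mle_lt_trans h (mltS y).
by move=> /madd_inj ->; apply/mleP; exists z.
Qed.

Lemma mleS_lt (x y : ω) : x + 1 <= y <-> x < y.
Proof.
split=> [h|/mltP [z ->]]; first exact: mlt_le_trans (mltS x) h.
by apply/mleP; exists z; mring.
Qed.

Lemma sub_eq0 (x y : ω) : x - y = 0 <-> x <= y.
Proof.
split=> [e|].
  case: (mlt_total x y) => [|[->|h]]; [by left|by right|].
  have := sub_addK (or_introl h); rewrite e madd0 => ->; by right.
have h := qf_ind (ρ := vcons (T := dom) subE (vcons (T := dom) (x : ω) nil_env))
  (φ := Imp (Or (Lt (Var (vs (vs vz))) (Var vz)) (Eq (Var (vs (vs vz))) (Var vz)))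
     (Eq (App (App (Var (vs vz)) (Var (vs (vs vz)))) (Var vz)) (Cst CZero))).
have {}h : forall n : ω, (x < n \/ eq0 x n) -> eq0 (x - n) 0.
  apply: h => //= [h|n IH hn]; apply/(eq0E (strP M)).
    rewrite sub0; case: h => [/mnlt0 //|/(eq0E (strP M)) //].
  have : x <= n + 1 by case: hn => [|/(eq0E (strP M))]; [left|right].
  rewrite subS; case=> [/mltS_le [xn|xn]|->].
  - by have /(eq0E (strP M)) -> := IH (or_introl xn); rewrite pred0.
  - by have /(eq0E (strP M)) -> := IH (or_intror (proj2 (eq0E (strP M) _ _) xn)); rewrite pred0.
  - have /sub_addK e : n <= n + 1 by left; apply: mltS.
    have -> : (n + 1) - n = 0 + 1.
      by apply: (@madd_inj n); rewrite maddC e; mring.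
    exact: predS.
by move=> [|/(eq0E (strP M))] xy; apply/(eq0E (strP M))/h; [left|right].
Qed.

Lemma madd_eq0 (x y : ω) : x + y = 0 <-> x = 0 /\ y = 0.
Proof.
split=> [e|[-> ->]]; last by rewrite madd0.
have h (a b : ω) : a + b = 0 -> a = 0.
  case: (m0_or_succ a) => [//|[c ->]] h.
  by case: (@msucc_neq0 (c + b)); rewrite -h; mring.
by split; [apply: h e | apply: (h y x); rewrite maddC].
Qed.

(** * Decidable predicates *)

Definition decidable Γ (P : args Γ -> Prop) :=
  exists2 F : args Γ -> ω, definable F & forall ρ, P ρ <-> F ρ = 0.

Lemma dec_lt Γ (F G : args Γ -> ω) : definable F -> definable G ->
  decidable (fun ρ => F ρ < G ρ).
Proof.
move=> dF dG; exists (fun ρ => (F ρ + 1) - G ρ).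
  by apply: def_app => //; apply: def_app; [def|apply: def_app; [apply: def_app|]] => //; def.
by move=> ρ; rewrite sub_eq0 mleS_lt.
Qed.

Lemma dec_eq Γ (F G : args Γ -> ω) : definable F -> definable G ->
  decidable (fun ρ => F ρ = G ρ).
Proof.
move=> dF dG; exists (fun ρ => (F ρ - G ρ) + (G ρ - F ρ)).
  by do !apply: def_app => //; def.
move=> ρ; rewrite madd_eq0 !sub_eq0; split=> [->|[h1 h2]]; last exact: mle_anti.
by split; right.
Qed.

Lemma dec_not Γ (P : args Γ -> Prop) : decidable P -> decidable (fun ρ => ~ P ρ).
Proof.
move=> [F dF eF]; exists (fun ρ => 1 - F ρ); first by do !apply: def_app => //; def.
move=> ρ; rewrite sub_eq0 eF; split=> [h|[h|h] e].
- case: (m0_or_succ (F ρ)) => [//|[d ->]]; apply/mleP; exists d; mring.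
- by move: h; rewrite e => /mnlt0.
- by have := mlt01 M; rewrite h e => /mltnn.
Qed.

Lemma dec_and Γ (P Q : args Γ -> Prop) : decidable P -> decidable Q ->
  decidable (fun ρ => P ρ /\ Q ρ).
Proof.
move=> [F dF eF] [G dG eG]; exists (fun ρ => F ρ + G ρ).
  by do !apply: def_app => //; def.
by move=> ρ; rewrite eF eG madd_eq0.
Qed.

Lemma dec_iff Γ (P Q : args Γ -> Prop) : (forall ρ, P ρ <-> Q ρ) -> decidable P -> decidable Q.
Proof. by move=> PQ [F dF eF]; exists F => // ρ; rewrite -PQ. Qed.

Lemma dec_imp Γ (P Q : args Γ -> Prop) : decidable P -> decidable Q ->
  decidable (fun ρ => P ρ -> Q ρ).
Proof.
move=> dP dQ; apply: (dec_iff (P := fun ρ => ~ (P ρ /\ ~ Q ρ))).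
  move=> ρ; split=> [h p|h [p]]; last by apply; apply: h.
  by apply: contrapT => q; apply: h.
by apply: dec_not; apply: dec_and => //; apply: dec_not.
Qed.

Lemma dec_or Γ (P Q : args Γ -> Prop) : decidable P -> decidable Q ->
  decidable (fun ρ => P ρ \/ Q ρ).
Proof.
move=> dP dQ; apply: (dec_iff (P := fun ρ => ~ P ρ -> Q ρ)); last first.
  by apply: dec_imp => //; apply: dec_not.
move=> ρ; split=> [h|[p np|q _]] //.
by case: (pselect (P ρ)) => [p|/h q]; [left|right].
Qed.

Lemma dec_le Γ (F G : args Γ -> ω) : definable F -> definable G ->
  decidable (fun ρ => F ρ <= G ρ).
Proof. by move=> dF dG; apply: dec_or; [apply: dec_lt|apply: dec_eq]. Qed.

(** A decidable predicate is the zero set of an element [G tt] of the model, so the quantifier-free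
    formula stating that this element vanishes, with [G tt] as parameter, expresses it. *)
Lemma dec_ind (P : ω -> Prop) : decidable (fun p : args [:: N] => P p.1) ->
  P 0 -> (forall n, P n -> P (n + 1)) -> forall n, P n.
Proof.
move=> [F [G _ eG] eF] h0 hS n.
have {eF} eF m : P m <-> G tt @ m = 0 by rewrite eG -eF.
have h := qf_ind (ρ := vcons (T := dom) (G tt) nil_env)
  (φ := Eq (App (Var (vs vz)) (Var vz)) (Cst CZero)).
apply/eF/(eq0E (strP M)); apply: h => //= [|m]; rewrite !(eq0E (strP M)) -!eF //.
exact: hS.
Qed.

Definition ifE : dom (Arr N (Arr N (Arr N N))) :=
  abs (fun c : ω => abs (fun x : ω => abs (fun y : ω => recE (fun _ _ => y) @ x @ c))).

Lemma ifE_spec (c x y : ω) :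
  ifE @ c @ x @ y = if `[< c = 0 >] then x else y.
Proof.
rewrite /ifE abs3E; last by rewrite /recE; def.
case: asboolP => [->|]; first by rewrite rec0E.
by case: (m0_or_succ c) => [//|[d ->]] _; rewrite recSE //; def.
Qed.

Definition cond (P : Prop) (x y : ω) : ω := if `[< P >] then x else y.

Lemma def_if Γ (P : args Γ -> Prop) (F G : args Γ -> ω) :
  decidable P -> definable F -> definable G ->
  definable (fun ρ => cond (P ρ) (F ρ) (G ρ)).
Proof.
move=> [H dH eH] dF dG; have : definable (fun ρ => ifE @ H ρ @ F ρ @ G ρ).
  by do !apply: def_app => //; def.
congr definable; apply: funext => ρ; rewrite ifE_spec /cond.
by congr (if _ then _ else _); apply: asbool_equiv_eq; rewrite eH.
Qed.
End Arithmetic.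

(** * The ordered field of rationals of a model *)

Section Rationals.
Variable M : model.
Local Notation "'ω'" := (dom M N).

Add Ring mring' : (mring M).

(** The triple [(p, m, d)] stands for [(p - m) / (d + 1)]. *)
Definition frac : Type := ω * ω * ω.

Definition frac_eq (a b : frac) : Prop :=
  let '(p, m, d) := a in let '(r, s, f) := b in
  p * (f + 1) + s * (d + 1) = r * (d + 1) + m * (f + 1).

Lemma frac_eq_refl a : frac_eq a a.
Proof. by case: a => [[p m] d]. Qed.

Lemma frac_eq_sym a b : frac_eq a b -> frac_eq b a.
Proof. by case: a => [[p m] d]; case: b => [[r s] f] /= ->. Qed.

Lemma mmulS_inj (d x y : ω) : x * (d + 1) = y * (d + 1) -> x = y.
Proof.
have d0 : 0 < d + 1 := mle_lt_trans (mle0 d) (mltS d).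
by case: (mlt_total x y) => [/(mltM2r d0)|[//|/(mltM2r d0)]] + e; rewrite e => /mltnn.
Qed.

(** Without subtraction, the goal is multiplied by the middle denominator and both sides are padded
    with the same sum; the hypotheses then apply and everything added cancels. *)
Lemma frac_eq_trans a b c : frac_eq a b -> frac_eq b c -> frac_eq a c.
Proof.
case: a => [[p m] d]; case: b => [[r s] f]; case: c => [[t u] g] /= e1 e2.
apply: (@mmulS_inj f).
apply: (@madd_inj _ ((s * (d + 1)) * (g + 1) + (r * (d + 1)) * (g + 1))).
transitivity ((p * (f + 1) + s * (d + 1)) * (g + 1) + (r * (g + 1) + u * (f + 1)) * (d + 1)).
  by mring.
by rewrite e1 e2; mring.
Qed.

Definition rational : Type := {c : frac -> Prop | exists a, c = frac_eq a}.

Definition frac_cls (a : frac) : rational := exist _ (frac_eq a) (ex_intro _ a erefl).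

Definition frac_rep (c : rational) : frac := proj1_sig (cid (proj2_sig c)).

Lemma frac_cls_eq a b : frac_cls a = frac_cls b <-> frac_eq a b.
Proof.
split=> [[e]|e]; first by rewrite e; apply: frac_eq_refl.
apply: sig_eq => /=; apply: funext => c; apply: propext; split.
  exact: frac_eq_trans (frac_eq_sym e).
exact: frac_eq_trans e.
Qed.

Lemma frac_rep_cls (c : rational) : frac_cls (frac_rep c) = c.
Proof. by rewrite /frac_rep; case: cid => a e; apply: sig_eq. Qed.

Lemma frac_clsP (x : rational) : exists p m d, x = frac_cls (p, m, d).
Proof.
by rewrite -(frac_rep_cls x); case: frac_rep => [[p m] d]; exists p, m, d.
Qed.

(** Denominators are stored less one, and (d+1)(f+1) = (df + d + f) + 1. *)
Definition frac_add (a b : frac) : frac :=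
  let '(p, m, d) := a in let '(r, s, f) := b in
  (p * (f + 1) + r * (d + 1), m * (f + 1) + s * (d + 1), d * f + d + f).
Definition frac_mul (a b : frac) : frac :=
  let '(p, m, d) := a in let '(r, s, f) := b in
  (p * r + m * s, p * s + m * r, d * f + d + f).
Definition frac_opp (a : frac) : frac := let '(p, m, d) := a in (m, p, d).
Definition frac_pos (a : frac) : Prop := let '(p, m, d) := a in m < p.

Lemma frac_add_eq a a' b : frac_eq a a' -> frac_eq (frac_add a b) (frac_add a' b).
Proof.
case: a => [[p m] d]; case: a' => [[p' m'] d']; case: b => [[r s] f] /= e.
transitivity ((p * (d' + 1) + m' * (d + 1)) * ((f + 1) * (f + 1)) +
  (r + s) * ((d + 1) * (d' + 1) * (f + 1))); first by mring.
by rewrite e; mring.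
Qed.

Lemma frac_mul_eq a a' b : frac_eq a a' -> frac_eq (frac_mul a b) (frac_mul a' b).
Proof.
case: a => [[p m] d]; case: a' => [[p' m'] d']; case: b => [[r s] f] /= e.
transitivity ((p * (d' + 1) + m' * (d + 1)) * (r * (f + 1)) +
  (p' * (d + 1) + m * (d' + 1)) * (s * (f + 1))); first by mring.
by rewrite e -{2}e; mring.
Qed.

Lemma frac_opp_eq a a' : frac_eq a a' -> frac_eq (frac_opp a) (frac_opp a').
Proof.
by case: a => [[p m] d]; case: a' => [[p' m'] d'] /= e; rewrite maddC -e; mring.
Qed.

Lemma frac_pos_eq a a' : frac_eq a a' -> frac_pos a -> frac_pos a'.
Proof.
case: a => [[p m] d]; case: a' => [[p' m'] d'] /= e /mltP [z ez].
case: (mlt_total m' p') => [//|h]; exfalso.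
have /mleP [w ew] : lt_or_eq p' m' by case: h; [right|left].
move: e; rewrite ez ew => e.
have := @madd_inj _ (p' * (d + 1) + m * (d' + 1)) (z * (d' + 1) + d' + w * (d + 1) + 1) 0.
move=> h1; apply: (@msucc_neq0 _ (z * (d' + 1) + d' + w * (d + 1))); apply: h1.
by rewrite (maddC 0) madd0 -[RHS]e; mring.
Qed.

Definition rat_add (x y : rational) := frac_cls (frac_add (frac_rep x) (frac_rep y)).
Definition rat_mul (x y : rational) := frac_cls (frac_mul (frac_rep x) (frac_rep y)).
Definition rat_opp (x : rational) := frac_cls (frac_opp (frac_rep x)).
Definition rat_pos (x : rational) := `[< frac_pos (frac_rep x) >].
Definition rat_zero := frac_cls (0, 0, 0).
Definition rat_one := frac_cls (1, 0, 0).

Let rep_eq a : frac_eq (frac_rep (frac_cls a)) a.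
Proof. by apply/frac_cls_eq; rewrite frac_rep_cls. Qed.

Lemma frac_addC a b : frac_add a b = frac_add b a.
Proof.
case: a b => [[p m] d] [[r s] f] /=; congr (_, _, _); mring.
Qed.

Lemma frac_mulC a b : frac_mul a b = frac_mul b a.
Proof.
case: a b => [[p m] d] [[r s] f] /=; congr (_, _, _); mring.
Qed.

Lemma rat_addE a b : rat_add (frac_cls a) (frac_cls b) = frac_cls (frac_add a b).
Proof.
apply/frac_cls_eq; apply: frac_eq_trans (frac_add_eq _ (rep_eq a)) _.
by rewrite !(frac_addC a); apply: frac_add_eq.
Qed.

Lemma rat_mulE a b : rat_mul (frac_cls a) (frac_cls b) = frac_cls (frac_mul a b).
Proof.
apply/frac_cls_eq; apply: frac_eq_trans (frac_mul_eq _ (rep_eq a)) _.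
by rewrite !(frac_mulC a); apply: frac_mul_eq.
Qed.

Lemma rat_oppE a : rat_opp (frac_cls a) = frac_cls (frac_opp a).
Proof. by apply/frac_cls_eq; apply: frac_opp_eq. Qed.

Lemma rat_posE a : rat_pos (frac_cls a) <-> frac_pos a.
Proof.
split=> [/asboolP|h]; first exact: frac_pos_eq.
by apply/asboolP; apply: frac_pos_eq h; apply: frac_eq_sym.
Qed.

Lemma rat_addA : associative rat_add.
Proof.
move=> x y z; have [p [m [d ->]]] := frac_clsP x; have [r [s [f ->]]] := frac_clsP y.
have [t [u [g ->]]] := frac_clsP z; rewrite !rat_addE; apply/frac_cls_eq => /=.
by mring.
Qed.

Lemma rat_addC : commutative rat_add.
Proof.
move=> x y; have [p [m [d ->]]] := frac_clsP x; have [r [s [f ->]]] := frac_clsP y.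
by rewrite !rat_addE frac_addC.
Qed.

Lemma rat_add0 : left_id rat_zero rat_add.
Proof.
move=> x; have [p [m [d ->]]] := frac_clsP x; rewrite rat_addE; apply/frac_cls_eq => /=.
by mring.
Qed.

Lemma rat_addN : left_inverse rat_zero rat_opp rat_add.
Proof.
move=> x; have [p [m [d ->]]] := frac_clsP x; rewrite rat_oppE rat_addE.
by apply/frac_cls_eq => /=; mring.
Qed.

Lemma rat_mulA : associative rat_mul.
Proof.
move=> x y z; have [p [m [d ->]]] := frac_clsP x; have [r [s [f ->]]] := frac_clsP y.
have [t [u [g ->]]] := frac_clsP z; rewrite !rat_mulE; apply/frac_cls_eq => /=.
by mring.
Qed.

Lemma rat_mulC : commutative rat_mul.
Proof.
move=> x y; have [p [m [d ->]]] := frac_clsP x; have [r [s [f ->]]] := frac_clsP y.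
by rewrite !rat_mulE frac_mulC.
Qed.

Lemma rat_mul1 : left_id rat_one rat_mul.
Proof.
move=> x; have [p [m [d ->]]] := frac_clsP x; rewrite rat_mulE; apply/frac_cls_eq => /=.
by mring.
Qed.

Lemma rat_mulDl : left_distributive rat_mul rat_add.
Proof.
move=> x y z; have [p [m [d ->]]] := frac_clsP x; have [r [s [f ->]]] := frac_clsP y.
have [t [u [g ->]]] := frac_clsP z; rewrite rat_addE !rat_mulE rat_addE.
by apply/frac_cls_eq => /=; mring.
Qed.

Lemma frac_eq0 p m d : frac_cls (p, m, d) = rat_zero <-> p = m.
Proof.
rewrite frac_cls_eq /=; split=> e; last by rewrite e; mring.
have : p * (0 + 1) + 0 * (d + 1) = p by mring.
by rewrite e => <-; mring.
Qed.

Lemma rat_pos_total x : x <> rat_zero -> rat_pos x \/ rat_pos (rat_opp x).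
Proof.
have [p [m [d ->]]] := frac_clsP x; rewrite frac_eq0 rat_oppE !rat_posE /= => h.
by case: (mlt_total p m) => [|[|]] //; [right|left].
Qed.

Definition rat_inv (x : rational) : rational :=
  if `[< x = rat_zero >] then rat_zero
  else pick_or rat_zero (fun y => rat_mul y x = rat_one).

Lemma rat_mulVx x : x <> rat_zero -> rat_mul (rat_inv x) x = rat_one.
Proof.
move=> x0; rewrite /rat_inv; case: asboolP => // _.
suff [y hy] : exists y, rat_mul y x = rat_one.
  exact: (pick_orP _ (P := fun y => rat_mul y x = rat_one) hy).
have [p [m [d e]]] := frac_clsP x; move: x0; rewrite e frac_eq0 => pm.
have [|[//|]] := mlt_total p m; move=> /mltP [z ->].
  (* Here the number is -(z+1)/(d+1), so its inverse -(d+1)/(z+1) has stored denominator [z]; the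
     other case only changes the sign. *)
  exists (frac_cls (0, d + 1, z)); rewrite rat_mulE; apply/frac_cls_eq => /=; mring.
exists (frac_cls (d + 1, 0, z)); rewrite rat_mulE; apply/frac_cls_eq => /=; mring.
Qed.

HB.instance Definition _ := gen_eqMixin rational.
HB.instance Definition _ := gen_choiceMixin rational.
HB.instance Definition _ := GRing.isZmodule.Build rational rat_addA rat_addC rat_add0 rat_addN.

Lemma rat_one_neq0 : rat_one != rat_zero.
Proof.
by apply/eqP => /frac_eq0 e; have := mlt01 M; rewrite e => /mltnn.
Qed.

HB.instance Definition _ := GRing.Zmodule_isComNzRing.Build rational
  rat_mulA rat_mulC rat_mul1 rat_mulDl rat_one_neq0.

Lemma rat_mulVf x : x != 0%R :> rational -> (rat_inv x * x = 1)%R.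
Proof. by move=> /eqP; exact: rat_mulVx. Qed.

Lemma rat_inv0 : rat_inv 0%R = 0%R.
Proof. by rewrite /rat_inv; case: asboolP => // -[]. Qed.

HB.instance Definition _ := GRing.ComNzRing_isField.Build rational rat_mulVf rat_inv0.

Definition rat_lt (x y : rational) : bool := rat_pos (y - x)%R.
Definition rat_le (x y : rational) : bool := (x == y) || rat_lt x y.
Definition rat_norm (x : rational) : rational := if rat_lt x 0%R then (- x)%R else x.

Lemma rat_lt0 x : rat_lt 0%R x = rat_pos x.
Proof. by rewrite /rat_lt GRing.subr0. Qed.

Lemma rat_lt0_add x y : rat_lt 0%R x -> rat_lt 0%R y -> rat_lt 0%R (x + y)%R.
Proof.
have [p [m [d ->]]] := frac_clsP x; have [r [s [f ->]]] := frac_clsP y.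
rewrite !rat_lt0 [(_ + _)%R]rat_addE !rat_posE /= => /mltP [z ->] /mltP [w ->].
by apply/mltP; exists (z * f + z + f + w * d + w + d + 1); mring.
Qed.

Lemma rat_lt0_mul x y : rat_lt 0%R x -> rat_lt 0%R y -> rat_lt 0%R (x * y)%R.
Proof.
have [p [m [d ->]]] := frac_clsP x; have [r [s [f ->]]] := frac_clsP y.
rewrite !rat_lt0 [(_ * _)%R]rat_mulE !rat_posE /= => /mltP [z ->] /mltP [w ->].
by apply/mltP; exists (z * w + z + w); mring.
Qed.

Lemma rat_lt0_ngt0 x : rat_lt 0%R x -> ~~ rat_lt x 0%R.
Proof.
have [p [m [d ->]]] := frac_clsP x; rewrite rat_lt0 /rat_lt GRing.sub0r.
rewrite rat_posE => /= h; apply/negP; rewrite [(- _)%R]rat_oppE rat_posE /= => h'.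
exact: (mltnn (mlt_trans h h')).
Qed.

Lemma rat_subr_gt0 x y : rat_lt 0%R (y - x)%R = rat_lt x y.
Proof. exact: rat_lt0. Qed.

Lemma rat_lt0_total x : x != 0%R -> rat_lt 0%R x || rat_lt x 0%R.
Proof.
move=> /eqP /rat_pos_total; rewrite rat_lt0 /rat_lt GRing.sub0r.
by case=> ->; rewrite ?orbT.
Qed.

Lemma rat_normN x : rat_norm (- x)%R = rat_norm x.
Proof.
rewrite /rat_norm {1}/rat_lt GRing.sub0r GRing.opprK -rat_lt0.
case: (eqVneq x 0%R) => [->|/rat_lt0_total]; first by rewrite GRing.oppr0 if_same.
by case: (boolP (rat_lt 0%R x)) => /= [/rat_lt0_ngt0 /negPf ->|_ ->].
Qed.

Lemma rat_ge0_norm x : rat_le 0%R x -> rat_norm x = x.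
Proof.
rewrite /rat_le /rat_norm => /orP[/eqP <-|/rat_lt0_ngt0 /negPf -> //].
by rewrite GRing.oppr0; case: ifP.
Qed.

HB.instance Definition _ := Num.IntegralDomain_isLtReal.Build rational
  rat_lt0_add rat_lt0_mul rat_lt0_ngt0 rat_subr_gt0 rat_lt0_total
  rat_normN rat_ge0_norm (fun _ _ => erefl).

Definition inj (n : ω) : rational := frac_cls (n, 0, 0).

Lemma injD (x y : ω) : inj (x + y) = (inj x + inj y)%R.
Proof. by rewrite /inj [RHS]rat_addE /=; congr (frac_cls (_, _, _)); mring. Qed.

Lemma injM (x y : ω) : inj (x * y) = (inj x * inj y)%R.
Proof. by rewrite /inj [RHS]rat_mulE /=; congr (frac_cls (_, _, _)); mring. Qed.

Lemma inj0 : inj 0 = 0%R. Proof. by []. Qed.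
Lemma inj1 : inj 1 = 1%R. Proof. by []. Qed.

Lemma inj_lt (x y : ω) : x < y <-> (inj x < inj y)%R.
Proof.
rewrite -[(inj x < inj y)%R]/(rat_pos (rat_add _ (rat_opp _))) rat_oppE rat_addE rat_posE /=.
have -> : 0 * (0 + 1) + x * (0 + 1) = x by mring.
by have -> : y * (0 + 1) + 0 * (0 + 1) = y by mring.
Qed.

(** Turns a code into a field expression, after which questions about codes can be left to [lra] and
    [field]. *)
Lemma frac_clsE p m d : frac_cls (p, m, d) = ((inj p - inj m) / inj (d + 1)%M)%R.
Proof.
have d0 : inj (d + 1) != 0%R.
  by apply/eqP => /frac_eq0; exact: msucc_neq0.
apply: (GRing.mulIf d0); rewrite GRing.divfK //.
rewrite [(- _)%R]rat_oppE [LHS]rat_mulE [RHS]rat_addE; apply/frac_cls_eq => /=.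
by mring.
Qed.

End Rationals.

From mathcomp Require Import ring lra.
Import Order.TTheory GRing.Theory Num.Theory.

Notation "x <= y" := (lt_or_eq x y) : model_scope.
Notation "x - y" := (subE _ @ x @ y) : model_scope.

(** [def] and [dec] are mutually recursive; [dec_atom] is completed once rational
    comparisons and number quantifiers are known to be decidable. *)
Ltac dec_atom := fail.
Ltac dec := fail.
Ltac def ::= lazymatch goal with
  | |- definable (fun _ => ?c) => apply: def_const
  | |- definable (fun ρ => app _ (@?F ρ) (@?A ρ)) => apply: (def_app (F := F) (A := A)); def
  | |- definable (fun ρ => abs (fun x => @?F x ρ)) => apply: (def_abs (F := F)); cbn beta; def
  | |- definable (fun ρ => cond (@?P ρ) (@?F ρ) (@?G ρ)) =>
      apply: (def_if (P := P) (F := F) (G := G)); [dec | def | def]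
  | |- _ => first [ exact: def_v0 | exact: def_v1 | exact: def_v2 | exact: def_v3 | exact: def_v4 ]
  end.
Ltac dec ::= lazymatch goal with
  | |- decidable (fun ρ => @?P ρ /\ @?Q ρ) => apply: (dec_and (P := P) (Q := Q)); dec
  | |- decidable (fun ρ => @?P ρ \/ @?Q ρ) => apply: (dec_or (P := P) (Q := Q)); dec
  | |- decidable (fun ρ => ~ (@?P ρ)) => apply: (dec_not (P := P)); dec
  | |- decidable (fun ρ => @?P ρ -> @?Q ρ) => apply: (dec_imp (P := P) (Q := Q)); dec
  | |- decidable (fun ρ => lt0 (@?F ρ) (@?G ρ)) => apply: (dec_lt (F := F) (G := G)); def
  | |- decidable (fun ρ => lt_or_eq (@?F ρ) (@?G ρ)) => apply: (dec_le (F := F) (G := G)); def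
  | |- decidable (fun ρ => @?F ρ = @?G ρ) => apply: (dec_eq (F := F) (G := G)); def
  | |- _ => dec_atom
  end.

(** * Numbers of the model inside its ordered field *)

Section Coding.
Variable M : model.
Local Notation "'ω'" := (dom M N).
Local Notation Q := (rational M).

Lemma inj_eq (x y : ω) : x = y <-> inj x = inj y.
Proof.
split=> [-> //|exy].
by case: (mlt_total x y) => [/inj_lt|[//|/inj_lt]]; rewrite exy ltxx.
Qed.

Lemma inj_le (x y : ω) : x <= y <-> (inj x <= inj y)%R.
Proof.
rewrite le_eqVlt /lt_or_eq inj_lt inj_eq; split=> [[->|->]|/orP[/eqP|]]; rewrite ?orbT ?eqxx //.
  by right.
by left.
Qed.

Lemma inj_ge0 (x : ω) : (0 <= inj x)%R.
Proof. by rewrite -inj0; apply/inj_le/mle0. Qed.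

Lemma injB (x y : ω) : y <= x -> inj (x - y) = (inj x - inj y)%R.
Proof. by move=> /sub_addK h; rewrite -[in RHS]h injD; ring. Qed.

Definition injE := (injD, injM, inj0, inj1).
End Coding.

Ltac mlra := rewrite ?inj_lt ?inj_le ?inj_eq ?injE; lra.
Ltac mlra_in H := move: H; rewrite ?inj_lt ?inj_le ?inj_eq ?injE => H.

(** * Cantor pairing and powers of two in the model *)

Section Coding2.
Variable M : model.
Local Notation "'ω'" := (dom M N).
Local Notation Q := (rational M).
Local Notation "x - y" := (subE M @ x @ y) : model_scope.

Definition triE : dom M (Arr N N) :=
  abs (fun x : ω => recE (fun k m => m + (k + 1)) @ 0 @ x).
Definition cpairE : dom M (Arr N (Arr N N)) :=
  abs (fun x : ω => abs (fun y : ω => triE @ (x + y) + y)).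
Definition cdiagE : dom M (Arr N N) :=
  abs (fun c : ω => recE (fun k w =>
    ifE M @ (triE @ (w + 1) - (k + 1)) @ (w + 1) @ w) @ 0 @ c).
Definition csndE : dom M (Arr N N) := abs (fun c : ω => c - triE @ (cdiagE @ c)).
Definition cfstE : dom M (Arr N N) := abs (fun c : ω => cdiagE @ c - csndE @ c).
Definition pow2E : dom M (Arr N N) :=
  abs (fun n : ω => recE (fun k m => m + m) @ 1 @ n).

Lemma tri0 : triE @ 0 = 0.
Proof. by rewrite /triE abs1E ?rec0E //; rewrite /recE; def. Qed.
Lemma triS n : triE @ (n + 1) = triE @ n + (n + 1).
Proof. by rewrite /triE !abs1E ?recSE //; rewrite /recE; def. Qed.
Lemma pow2_0 : pow2E @ 0 = 1.
Proof. by rewrite /pow2E abs1E ?rec0E //; rewrite /recE; def. Qed.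
Lemma pow2S n : pow2E @ (n + 1) = pow2E @ n + pow2E @ n.
Proof. by rewrite /pow2E !abs1E ?recSE //; rewrite /recE; def. Qed.
Lemma cpairEE x y : cpairE @ x @ y = triE @ (x + y) + y.
Proof. by rewrite /cpairE abs2E //; def. Qed.
Lemma csndEE c : csndE @ c = c - triE @ (cdiagE @ c).
Proof. by rewrite /csndE abs1E //; def. Qed.
Lemma cfstEE c : cfstE @ c = cdiagE @ c - csndE @ c.
Proof. by rewrite /cfstE abs1E //; def. Qed.
Lemma cdiag0 : cdiagE @ 0 = 0.
Proof. by rewrite /cdiagE abs1E ?rec0E //; rewrite /recE; def. Qed.
Lemma cdiagS c : cdiagE @ (c + 1) =
  if `[< triE @ (cdiagE @ c + 1) <= c + 1 >] then cdiagE @ c + 1 else cdiagE @ c.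
Proof.
rewrite [in LHS]/cdiagE abs1E; last by rewrite /recE; def.
rewrite recSE; last by def.
rewrite -[recE _ @ 0 @ c](abs1E (F := fun c : ω => recE _ @ 0 @ c)); last by rewrite /recE; def.
rewrite -/cdiagE ifE_spec; congr (if _ then _ else _).
by apply: asbool_equiv_eq; rewrite sub_eq0.
Qed.

Lemma tri_mono (x y : ω) : x <= y -> triE @ x <= triE @ y.
Proof.
move=> /mleP [d ->].
apply: (dec_ind (P := fun d => triE @ x <= triE @ (x + d))) d.
- by dec.
- by rewrite madd0; right.
- move=> n; rewrite -maddA triS !inj_le !injE => h.
  by have := inj_ge0 x; have := inj_ge0 n; lra.
Qed.

Lemma cdiag_spec (c : ω) : triE @ (cdiagE @ c) <= c /\ c < triE @ (cdiagE @ c + 1).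
Proof.
apply: (dec_ind (P := fun c => triE @ (cdiagE @ c) <= c /\ c < triE @ (cdiagE @ c + 1))) c.
- by dec.
- by rewrite cdiag0 triS tri0; split; [right|mlra].
- move=> c; rewrite cdiagS; case: asboolP => [h1|/mnle h1] [h2 h3]; split=> //.
  (* After an increment from w to w+1, the bound c < tri(w+1) gives c+1 < tri(w+2), as the
     triangular numbers differ by w+2. *)
  + by rewrite triS; mlra_in h3; mlra_in h1; have := inj_ge0 (cdiagE @ c); mlra.
  + by mlra_in h2; mlra.
Qed.

Lemma cdiag_unique (w c : ω) :
  triE @ w <= c -> c < triE @ (w + 1) -> cdiagE @ c = w.
Proof.
have [h1 h2] := cdiag_spec c => h3 h4.
have h (v u : ω) : triE @ u <= c -> c < triE @ (v + 1) -> u <= v.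
  move=> hu hv; apply/mnlt => /mleS_lt /tri_mono h.
  exact: (mltnn (mlt_le_trans hv (mle_trans h hu))).
by apply: mle_anti; apply: h.
Qed.

Lemma cdiag_pair x y : cdiagE @ (cpairE @ x @ y) = x + y.
Proof.
have := inj_ge0 x; rewrite cpairEE => x0.
by apply: cdiag_unique; rewrite ?triS; [apply/mleP; exists y | mlra].
Qed.

Lemma csnd_pair x y : csndE @ (cpairE @ x @ y) = y.
Proof.
rewrite csndEE cdiag_pair cpairEE inj_eq injB ?injD; first by lra.
by apply/mleP; exists y.
Qed.

Lemma cfst_pair x y : cfstE @ (cpairE @ x @ y) = x.
Proof.
rewrite cfstEE cdiag_pair csnd_pair inj_eq injB ?injD; first by lra.
by have := inj_ge0 x; mlra.
Qed.

(** * Codes of rationals *)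

Definition posE : dom M (Arr N N) := abs (fun s : ω => cfstE @ (cfstE @ s)).
Definition negE : dom M (Arr N N) := abs (fun s : ω => csndE @ (cfstE @ s)).
Definition ratE : dom M (Arr N (Arr N (Arr N N))) :=
  abs (fun p : ω => abs (fun m : ω => abs (fun d : ω => cpairE @ (cpairE @ p @ m) @ d))).

Lemma posEE s : posE @ s = cfstE @ (cfstE @ s).
Proof. by rewrite /posE abs1E //; def. Qed.
Lemma negEE s : negE @ s = csndE @ (cfstE @ s).
Proof. by rewrite /negE abs1E //; def. Qed.
Lemma ratEE p m d : ratE @ p @ m @ d = cpairE @ (cpairE @ p @ m) @ d.
Proof. by rewrite /ratE abs3E //; def. Qed.

Definition val (s : ω) : Q := frac_cls (posE @ s, negE @ s, csndE @ s).

Lemma val_rat p m d : val (ratE @ p @ m @ d) = frac_cls (p, m, d).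
Proof. by rewrite /val posEE negEE ratEE !csnd_pair !cfst_pair csnd_pair. Qed.

Lemma valE s : val s = ((inj (posE @ s) - inj (negE @ s)) / (inj (csndE @ s) + 1))%R.
Proof. by rewrite /val frac_clsE injD. Qed.

Definition qaddE : dom M (Arr N (Arr N N)) := abs (fun s : ω => abs (fun t : ω =>
  ratE @ (posE @ s * (csndE @ t + 1) + posE @ t * (csndE @ s + 1))
       @ (negE @ s * (csndE @ t + 1) + negE @ t * (csndE @ s + 1))
       @ (csndE @ s * csndE @ t + csndE @ s + csndE @ t))).
Definition qmulE : dom M (Arr N (Arr N N)) := abs (fun s : ω => abs (fun t : ω =>
  ratE @ (posE @ s * posE @ t + negE @ s * negE @ t)
       @ (posE @ s * negE @ t + negE @ s * posE @ t)
       @ (csndE @ s * csndE @ t + csndE @ s + csndE @ t))).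
Definition qoppE : dom M (Arr N N) :=
  abs (fun s : ω => ratE @ (negE @ s) @ (posE @ s) @ (csndE @ s)).
Definition qexpE : dom M (Arr N N) :=
  abs (fun n : ω => ratE @ 1 @ 0 @ (pow2E @ n - 1)).

Lemma val_add s t : val (qaddE @ s @ t) = (val s + val t)%R.
Proof. by rewrite /qaddE abs2E ?val_rat ?[RHS]rat_addE //; def. Qed.
Lemma val_mul s t : val (qmulE @ s @ t) = (val s * val t)%R.
Proof. by rewrite /qmulE abs2E ?val_rat ?[RHS]rat_mulE //; def. Qed.
Lemma val_opp s : val (qoppE @ s) = (- val s)%R.
Proof. by rewrite /qoppE abs1E ?val_rat ?[RHS]rat_oppE //; def. Qed.

Definition eps (n : ω) : Q := ((inj (pow2E @ n))^-1)%R.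

Lemma inj_pow2_ge1 n : (1 <= inj (pow2E @ n))%R.
Proof.
rewrite -inj1 -inj_le; apply: (dec_ind (P := fun n => 1 <= pow2E @ n)) n.
- by dec.
- by rewrite pow2_0; right.
- by move=> n h; mlra_in h; rewrite pow2S; mlra.
Qed.

Lemma val_exp n : val (qexpE @ n) = eps n.
Proof.
rewrite /qexpE abs1E; last by def.
rewrite val_rat frac_clsE injD injB ?inj_le ?injE ?inj_pow2_ge1 // /eps.
by rewrite subr0 mul1r subrK.
Qed.

Lemma eps_gt0 n : (0 < eps n)%R.
Proof. by rewrite /eps invr_gt0; have := inj_pow2_ge1 n; lra. Qed.
Lemma eps0 : eps 0 = 1%R. Proof. by rewrite /eps pow2_0 inj1 invr1. Qed.
Lemma epsS n : (eps (n + 1)%M = eps n / 2)%R.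
Proof.
rewrite /eps pow2S injD; have := inj_pow2_ge1 n; move: (inj _) => x x1.
by field; lra.
Qed.

Lemma pow2D n m : pow2E @ (n + m) = pow2E @ n * pow2E @ m.
Proof.
apply: (dec_ind (P := fun m => pow2E @ (n + m) = pow2E @ n * pow2E @ m)) m.
- by dec.
- by rewrite madd0 pow2_0 mmul1.
- by move=> m h; rewrite -maddA !pow2S h mmulDr.
Qed.

Lemma epsD n m : (eps (n + m)%M = eps n * eps m)%R.
Proof. by rewrite /eps pow2D injM invfM. Qed.

Lemma eps_le1 n : (eps n <= 1)%R.
Proof. by rewrite /eps invf_le1; have := inj_pow2_ge1 n; lra. Qed.

Lemma eps_le n m : n <= m -> (eps m <= eps n)%R.
Proof.
by move=> /mleP [d ->]; rewrite epsD ler_piMr ?eps_le1 // ltW // eps_gt0.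
Qed.

Lemma ltn_pow2 n : n < pow2E @ n.
Proof.
apply: (dec_ind (P := fun n => n < pow2E @ n)) n.
- by dec.
- by rewrite pow2_0; apply: mlt01.
- by move=> n h; have := inj_pow2_ge1 n; mlra_in h; rewrite pow2S; mlra.
Qed.

(** The exponent is a number of the model, possibly nonstandard. A positive fraction is some
    (z+1)/(d+1), hence at least 1/(d+1), and d+1 < 2^(d+1). *)
Lemma eps_archimedean (x : Q) : (0 < x)%R -> exists n, (eps n < x)%R.
Proof.
have [p [m [d ->]]] := frac_clsP x; rewrite -[(0 < _)%R]/(rat_lt 0%R _) rat_lt0 rat_posE /=.
move=> /mltP [z ->]; exists (d + 1); rewrite frac_clsE !injE.
have d0 := inj_ge0 d; have z0 := inj_ge0 z; have m0 := inj_ge0 m.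
have h := ltn_pow2 (d + 1); mlra_in h.
apply: (@lt_le_trans _ _ ((inj d + 1)^-1)%R).
  by rewrite /eps ltf_pV2 ?posrE; lra.
rewrite ler_pdivlMr; last by lra.
by rewrite mulVf; lra.
Qed.

Lemma val_ltP s t : (val s < val t)%R <->
  posE @ s * (csndE @ t + 1) + negE @ t * (csndE @ s + 1) <
  posE @ t * (csndE @ s + 1) + negE @ s * (csndE @ t + 1).
Proof.
rewrite !valE inj_lt !injE.
have := inj_ge0 (csndE @ s); have := inj_ge0 (csndE @ t).
move: (inj (csndE @ s)) (inj (csndE @ t)) => x y y0 x0.
rewrite ltr_pdivlMr; last by lra.
rewrite mulrAC ltr_pdivrMr; last by lra.
by split=> h; lra.
Qed.

(** Named so that the tactic [dec] recognises a comparison of coded rationals by its head symbol. *)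
Definition vlt (s t : ω) : Prop := (val s < val t)%R.
Definition vle (s t : ω) : Prop := (val s <= val t)%R.

Lemma dec_vlt Γ (F G : args M Γ -> ω) : definable F -> definable G ->
  decidable (fun ρ => vlt (F ρ) (G ρ)).
Proof.
move=> dF dG; apply: (dec_iff (fun ρ => iff_sym (val_ltP (F ρ) (G ρ)))).
apply: dec_lt; do !(apply: def_app => //); def.
Qed.

Lemma dec_vle Γ (F G : args M Γ -> ω) : definable F -> definable G ->
  decidable (fun ρ => vle (F ρ) (G ρ)).
Proof.
move=> dF dG; apply: (dec_iff (P := fun ρ => ~ vlt (G ρ) (F ρ))).
  by move=> ρ; rewrite /vlt /vle leNgt; split=> /negP.
by apply: dec_not; apply: dec_vlt.
Qed.

End Coding2.

(** * Meaning of the formulas about reals in a model *)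

Section Meaning.
Variable M : model.
Local Notation "'ω'" := (dom M N).
Local Notation Q := (rational M).
Local Notation real := (dom M (Arr N N)).
Local Notation env := (env M).
Local Notation vcons d ρ := (vcons (T := dom M) d ρ).

Lemma eval_lift_refl Γ (ρ : env Γ) τ (t : tm Γ τ) :
  eval ρ (Defs.lift (e := @ext_refl Γ) t) = eval ρ t.
Proof. exact: eval_ren. Qed.

Lemma eval_lift_cons Γ Δ σ (i : ext Γ Δ) (ρ : env Δ) (d : dom M σ) τ (t : tm Γ τ) :
  eval (vcons d ρ) (Defs.lift (e := @ext_cons Γ Δ σ i) t) = eval ρ (Defs.lift (e := i) t).
Proof. by rewrite /Defs.lift !eval_ren. Qed.

Lemma eval_plus Γ (ρ : env Γ) (s t : tm Γ N) : eval ρ (s + t)%tm = eval ρ s + eval ρ t.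
Proof. by []. Qed.

Lemma eval_times Γ (ρ : env Γ) (s t : tm Γ N) : eval ρ (s * t)%tm = eval ρ s * eval ρ t.
Proof. by []. Qed.

Lemma eval_app Γ (ρ : env Γ) σ τ (f : tm Γ (Arr σ τ)) a :
  eval ρ (App f a) = eval ρ f @ eval ρ a.
Proof. by []. Qed.

Lemma sat_Lt Γ (ρ : env Γ) t u : sat ρ (Lt t u) <-> eval ρ t < eval ρ u.
Proof. by []. Qed.

Lemma sat_Eq Γ (ρ : env Γ) t u : sat ρ (Eq t u) <-> eval ρ t = eval ρ u.
Proof. exact: (eq0E (strP M)). Qed.

Lemma sat_And Γ (ρ : env Γ) φ ψ : sat ρ (And φ ψ) <-> sat ρ φ /\ sat ρ ψ.
Proof. by []. Qed.

Lemma sat_Or Γ (ρ : env Γ) φ ψ : sat ρ (Or φ ψ) <-> sat ρ φ \/ sat ρ ψ.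
Proof. by []. Qed.

Lemma sat_Imp Γ (ρ : env Γ) φ ψ : sat ρ (Imp φ ψ) <-> (sat ρ φ -> sat ρ ψ).
Proof. by []. Qed.

Lemma sat_Not Γ (ρ : env Γ) φ : sat ρ (Not φ) <-> ~ sat ρ φ.
Proof. by []. Qed.

Lemma sat_all Γ (ρ : env Γ) σ (f : tm (σ :: Γ) σ -> fm (σ :: Γ)) :
  sat ρ (all_ σ f) <-> forall d, sat (vcons d ρ) (f (Var vz)).
Proof. by []. Qed.

Lemma sat_ex Γ (ρ : env Γ) σ (f : tm (σ :: Γ) σ -> fm (σ :: Γ)) :
  sat ρ (ex_ σ f) <-> exists d, sat (vcons d ρ) (f (Var vz)).
Proof. by []. Qed.

Lemma iff_forall (A : Type) (P R : A -> Prop) :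
  (forall x, P x <-> R x) -> (forall x, P x) <-> (forall x, R x).
Proof. by move=> h; split=> H x; apply/h. Qed.

Lemma iff_exists (A : Type) (P R : A -> Prop) :
  (forall x, P x <-> R x) -> (exists x, P x) <-> (exists x, R x).
Proof. by move=> h; split=> -[x] /h; exists x. Qed.

Lemma eval_rec Γ (ρ : env Γ) f m n :
  eval ρ (Rec0 f m n) = cst M _ (CRec N) @ eval ρ f @ eval ρ m @ eval ρ n.
Proof. by []. Qed.

Lemma eval_lam_ Γ (ρ : env Γ) σ τ (f : tm (σ :: Γ) σ -> tm (σ :: Γ) τ) :
  eval ρ (lam_ σ f) = abs (fun d => eval (vcons d ρ) (f (Var vz))).
Proof. exact: eval_lam. Qed.

Lemma eval_rec_lam Γ (ρ : env Γ) (f : tm (N :: Γ) N -> tm (N :: N :: Γ) N -> tm (N :: N :: Γ) N) m n :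
  eval ρ (Rec0 (lam_ N (fun k => lam_ N (f k))) m n) =
  recE (fun k w : ω => eval (vcons w (vcons k ρ)) (f (Var vz) (Var vz))) @ eval ρ m @ eval ρ n.
Proof.
rewrite eval_rec eval_lam_ /recE; congr (_ @ abs _ @ _ @ _).
by apply: funext => k; rewrite eval_lam_.
Qed.

Lemma recE_ext (F G : ω -> ω -> ω) : (forall k w, F k w = G k w) -> recE F = recE G.
Proof. by move=> h; congr recE; apply: funext => k; apply: funext. Qed.

Lemma eval_tpred Γ (ρ : env Γ) x : eval ρ (tpred x) = predE M @ eval ρ x.
Proof. by rewrite eval_rec_lam /predE abs1E //; rewrite /recE; def. Qed.

Lemma eval_pow2 Γ (ρ : env Γ) x : eval ρ (pow2 x) = pow2E M @ eval ρ x.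
Proof.
rewrite eval_rec_lam /pow2E abs1E //; rewrite /recE; def.
Qed.

Lemma eval_monus Γ (ρ : env Γ) x y : eval ρ (monus x y) = eval ρ x - eval ρ y.
Proof.
rewrite eval_rec_lam /subE abs2E; last by rewrite /recE; def.
by congr (_ @ _ @ _); apply: recE_ext => k w; rewrite eval_tpred.
Qed.

Lemma eval_tri Γ (ρ : env Γ) x : eval ρ (tri x) = triE M @ eval ρ x.
Proof. by rewrite eval_rec_lam /triE abs1E //; rewrite /recE; def. Qed.

Lemma eval_if0 Γ (ρ : env Γ) c x y :
  eval ρ (if0 c x y) = ifE M @ eval ρ c @ eval ρ x @ eval ρ y.
Proof.
rewrite eval_rec_lam /ifE abs3E; last by rewrite /recE; def.
by congr (_ @ _ @ _); apply: recE_ext => k w; rewrite !eval_lift_cons eval_lift_refl.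
Qed.

Lemma eval_cpair Γ (ρ : env Γ) x y :
  eval ρ (cpair x y) = cpairE M @ eval ρ x @ eval ρ y.
Proof. by rewrite cpairEE /cpair eval_plus eval_tri eval_plus. Qed.

Lemma eval_cdiag Γ (ρ : env Γ) c : eval ρ (cdiag c) = cdiagE M @ eval ρ c.
Proof.
rewrite eval_rec_lam /cdiagE abs1E; last by rewrite /recE; def.
congr (_ @ _ @ _); apply: recE_ext => k w.
by rewrite eval_if0 eval_monus eval_tri.
Qed.

Lemma eval_csnd Γ (ρ : env Γ) c : eval ρ (csnd c) = csndE M @ eval ρ c.
Proof. by rewrite csndEE /csnd eval_monus eval_tri eval_cdiag. Qed.

Lemma eval_cfst Γ (ρ : env Γ) c : eval ρ (cfst c) = cfstE M @ eval ρ c.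
Proof. by rewrite cfstEE /cfst eval_monus eval_cdiag eval_csnd. Qed.

Lemma eval_pos Γ (ρ : env Γ) c : eval ρ (pos c) = posE M @ eval ρ c.
Proof. by rewrite posEE /pos !eval_cfst. Qed.

Lemma eval_neg Γ (ρ : env Γ) c : eval ρ (neg c) = negE M @ eval ρ c.
Proof. by rewrite negEE /neg eval_csnd eval_cfst. Qed.

Lemma eval_den Γ (ρ : env Γ) c : eval ρ (den c) = csndE M @ eval ρ c + 1.
Proof. by rewrite /den eval_plus eval_csnd. Qed.

Lemma eval_rat Γ (ρ : env Γ) p m d :
  eval ρ (Defs.rat p m d) = ratE M @ eval ρ p @ eval ρ m @ eval ρ d.
Proof. by rewrite ratEE /Defs.rat !eval_cpair. Qed.

Lemma val_subr (s t : ω) : (val s - val t =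
  ((inj (posE M @ s) * (inj (csndE M @ t) + 1) + inj (negE M @ t) * (inj (csndE M @ s) + 1)) -
   (inj (negE M @ s) * (inj (csndE M @ t) + 1) + inj (posE M @ t) * (inj (csndE M @ s) + 1)))
  / ((inj (csndE M @ s) + 1) * (inj (csndE M @ t) + 1)))%R.
Proof.
rewrite !valE; have := inj_ge0 (csndE M @ s); have := inj_ge0 (csndE M @ t) => *.
by field; rewrite !gt_eqF //; lra.
Qed.

Lemma sat_diff_lt Γ (ρ : env Γ) s t k n : sat ρ (diff_lt s t k n) <->
  (val (eval ρ s) - val (eval ρ t) < inj (eval ρ k) * eps (eval ρ n))%R.
Proof.
rewrite /diff_lt sat_Lt !(eval_plus, eval_times, eval_pow2, eval_pos, eval_neg, eval_den) inj_lt !injE val_subr /eps.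
have := inj_pow2_ge1 (eval ρ n).
have := inj_ge0 (csndE M @ eval ρ s); have := inj_ge0 (csndE M @ eval ρ t).
move: (inj (csndE M @ _)) (inj (csndE M @ _)) (inj (pow2E M @ _)) => x y z y0 x0 z1.
have xy0 : (0 < (x + 1) * (y + 1))%R by apply: mulr_gt0; lra.
rewrite ltr_pdivrMr // mulrAC ltr_pdivlMr; last by lra.
by split=> h; lra.
Qed.

Lemma sat_lt_diff Γ (ρ : env Γ) s t k n : sat ρ (lt_diff k n s t) <->
  (inj (eval ρ k) * eps (eval ρ n) < val (eval ρ s) - val (eval ρ t))%R.
Proof.
rewrite /lt_diff sat_Lt !(eval_plus, eval_times, eval_pow2, eval_pos, eval_neg, eval_den) inj_lt !injE val_subr /eps.
have := inj_pow2_ge1 (eval ρ n).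
have := inj_ge0 (csndE M @ eval ρ s); have := inj_ge0 (csndE M @ eval ρ t).
move: (inj (csndE M @ _)) (inj (csndE M @ _)) (inj (pow2E M @ _)) => x y z y0 x0 z1.
have xy0 : (0 < (x + 1) * (y + 1))%R by apply: mulr_gt0; lra.
rewrite ltr_pdivlMr // mulrAC ltr_pdivrMr; last by lra.
by split=> h; lra.
Qed.

Definition ap (x : real) (n : ω) : Q := val (x @ n).

Definition isrealM (x : real) := forall n i : ω,
  (ap x n - ap x (n + i)%M < eps n)%R /\ (ap x (n + i)%M - ap x n < eps n)%R.
Definition eqRM (x y : real) := forall n : ω,
  (ap x n - ap y n <= 2 * eps n)%R /\ (ap y n - ap x n <= 2 * eps n)%R.
Definition ltRM (x y : real) := exists n : ω, (2 * eps n < ap y n - ap x n)%R.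
Definition unitM (x : real) :=
  isrealM x /\ forall n : ω, (- ap x n <= 2 * eps n)%R /\ (ap x n - 1 <= 2 * eps n)%R.

Lemma inj_eval2 Γ (ρ : env Γ) : inj (eval ρ 2%tm) = 2%R.
Proof. by rewrite eval_plus injD inj1; ring. Qed.

Lemma inj_eval1 Γ (ρ : env Γ) : inj (eval ρ 1%tm) = 1%R.
Proof. by []. Qed.

Definition evalE := (eval_lift_cons, eval_lift_refl, eval_app, inj_eval2, inj_eval1).

Lemma sat_is_real Γ (ρ : env Γ) x : sat ρ (is_real x) <-> isrealM (eval ρ x).
Proof.
rewrite sat_all; apply: iff_forall => n; rewrite sat_all; apply: iff_forall => i.
by rewrite sat_And !sat_diff_lt !evalE !mul1r.
Qed.

Lemma sat_eqR Γ (ρ : env Γ) x y : sat ρ (eqR x y) <-> eqRM (eval ρ x) (eval ρ y).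
Proof.
rewrite sat_all; apply: iff_forall => n.
rewrite sat_And !sat_Not !sat_lt_diff !evalE /ap.
split=> -[h1 h2]; split; first [rewrite leNgt; apply/negP | apply/negP; rewrite -leNgt] => //.
Qed.

Lemma sat_ltR Γ (ρ : env Γ) x y : sat ρ (ltR x y) <-> ltRM (eval ρ x) (eval ρ y).
Proof.
by rewrite sat_ex; apply: iff_exists => n; rewrite !sat_lt_diff !evalE.
Qed.

(** A body whose value ignores the bound variable is represented by Π applied to that value; this
    evaluates [zeroR] and [oneR]. *)
Lemma ap_const Γ (ρ : env Γ) (p : tm (N :: Γ) N) n :
  (forall d, eval (vcons d ρ) p = eval (vcons n ρ) p) ->
  ap (eval ρ (lam_ N (fun _ => p))) n = val (eval (vcons n ρ) p).
Proof.
move=> h; rewrite /ap eval_lam_ -(abs_eq (f := cst M _ (CPi N N) @ eval (vcons n ρ) p)) ?PiE //.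
by move=> x; rewrite PiE h.
Qed.

Lemma sat_in_I Γ (ρ : env Γ) x : sat ρ (in_I x) <-> unitM (eval ρ x).
Proof.
rewrite sat_And sat_is_real /unitM; apply: and_iff_compat_l.
have z n : ap (eval ρ (zeroR Γ)) n = 0%R.
  rewrite ap_const => [|d]; rewrite !eval_rat // val_rat; exact/frac_eq0.
have o n : ap (eval ρ (oneR Γ)) n = 1%R.
  by rewrite ap_const => [|d]; rewrite !eval_rat // val_rat.
rewrite sat_And !sat_Not !sat_ltR /ltRM.
split=> [[h1 h2] n|h]; last first.
  by split=> -[n]; rewrite ?z ?o; have [h1 h2] := h n; lra.
split; rewrite leNgt; apply/negP=> h; [apply: h1|apply: h2]; exists n; rewrite ?z ?o; lra.
Qed.

Definition fun_unitM (Y : dom M (Arr (Arr N N) N)) :=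
  forall x y : real, unitM x -> unitM y -> eqRM x y -> Y @ x = Y @ y.

Lemma sat_is_fun_I Γ (ρ : env Γ) Y : sat ρ (is_fun_I Y) <-> fun_unitM (eval ρ Y).
Proof.
rewrite sat_all; apply: iff_forall => x; rewrite sat_all; apply: iff_forall => y.
by rewrite !sat_Imp !sat_in_I sat_eqR sat_Eq !evalE.
Qed.

Lemma iff_imp (A B C D : Prop) : (A <-> B) -> (C <-> D) -> (A -> C) <-> (B -> D).
Proof. by move=> -> ->. Qed.

Lemma iff_and (A B C D : Prop) : (A <-> B) -> (C <-> D) -> (A /\ C) <-> (B /\ D).
Proof. by move=> -> ->. Qed.

Lemma iff_or (A B C D : Prop) : (A <-> B) -> (C <-> D) -> (A \/ C) <-> (B \/ D).
Proof. by move=> -> ->. Qed.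

Ltac sat_step := lazymatch goal with
  | |- sat _ (is_real _) <-> _ => rewrite sat_is_real
  | |- sat _ (in_I _) <-> _ => rewrite sat_in_I
  | |- sat _ (eqR _ _) <-> _ => rewrite sat_eqR
  | |- sat _ (ltR _ _) <-> _ => rewrite sat_ltR
  | |- sat _ (is_fun_I _) <-> _ => rewrite sat_is_fun_I
  | |- sat _ (Not (eqR _ _)) <-> _ => rewrite sat_Not sat_eqR
  | |- sat _ (Eq _ _) <-> _ => rewrite sat_Eq
  | |- sat _ (Lt _ _) <-> _ => rewrite sat_Lt
  end; rewrite ?evalE.

Ltac sat_iff := lazymatch goal with
  | |- sat _ (all_ _ _) <-> _ => rewrite sat_all; apply: iff_forall => ?; sat_iff
  | |- sat _ (ex_ _ _) <-> _ => rewrite sat_ex; apply: iff_exists => ?; sat_iff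
  | |- sat _ (Imp _ _) <-> _ => rewrite sat_Imp; apply: iff_imp; sat_iff
  | |- sat _ (And _ _) <-> _ => rewrite sat_And; apply: iff_and; sat_iff
  | |- sat _ (Or _ _) <-> _ => rewrite sat_Or; apply: iff_or; sat_iff
  | |- _ => idtac
  end.

Lemma sat_NIN (ρ : env [::]) : sat ρ NIN <->
  forall Y, fun_unitM Y ->
    exists x y : real, unitM x /\ unitM y /\ ~ eqRM x y /\ Y @ x = Y @ y.
Proof. by rewrite /NIN; sat_iff; sat_step. Qed.

Definition fun_R2M (Y : dom M (Arr (Arr N N) (Arr (Arr N N) N))) :=
  forall a b c d : real, isrealM a -> isrealM b -> isrealM c -> isrealM d ->
    eqRM a c -> eqRM b d -> Y @ a @ b = Y @ c @ d.

Definition in_R2M (a b : real) (A : dom M (Arr (Arr N N) (Arr (Arr N N) N))) :=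
  isrealM a /\ isrealM b /\ A @ a @ b = 1.

Lemma sat_is_fun_R2 Γ (ρ : env Γ) Y : sat ρ (is_fun_R2 Y) <-> fun_R2M (eval ρ Y).
Proof. by rewrite /is_fun_R2; sat_iff; sat_step. Qed.

Lemma sat_in_R2 Γ (ρ : env Γ) a b A :
  sat ρ (in_R2 a b A) <-> in_R2M (eval ρ a) (eval ρ b) (eval ρ A).
Proof. by rewrite /in_R2; sat_iff; sat_step. Qed.

Lemma sat_is_set_R2 Γ (ρ : env Γ) A : sat ρ (is_set_R2 A) <->
  fun_R2M (eval ρ A) /\
  (forall a b : real, isrealM a -> isrealM b ->
     eval ρ A @ a @ b = 0 \/ eval ρ A @ a @ b = 1).
Proof.
rewrite /is_set_R2 sat_And sat_is_fun_R2; apply: iff_and => //.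
by sat_iff; sat_step.
Qed.

Lemma sat_countable_R2 Γ (ρ : env Γ) A : sat ρ (countable_R2 A) <->
  exists Y, fun_R2M Y /\ forall a b c d : real,
    in_R2M a b (eval ρ A) -> in_R2M c d (eval ρ A) ->
    Y @ a @ b = Y @ c @ d -> eqRM a c /\ eqRM b d.
Proof.
by rewrite /countable_R2; sat_iff; rewrite ?sat_is_fun_R2 ?sat_in_R2 ?evalE //; sat_step.
Qed.

Lemma sat_in_interval Γ (ρ : env Γ) x a b : sat ρ (in_interval x a b) <->
  ltRM (eval ρ a) (eval ρ x) /\ ltRM (eval ρ x) (eval ρ b).
Proof. by rewrite /in_interval sat_And !sat_ltR. Qed.

Lemma sat_HBC0 (ρ : env [::]) : sat ρ HBC0 <->
  forall A, (fun_R2M A /\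
      (forall a b : real, isrealM a -> isrealM b -> A @ a @ b = 0 \/ A @ a @ b = 1)) ->
    (exists Y, fun_R2M Y /\ forall a b c d : real,
      in_R2M a b A -> in_R2M c d A -> Y @ a @ b = Y @ c @ d -> eqRM a c /\ eqRM b d) ->
    (forall x : real, unitM x -> exists a b : real,
      in_R2M a b A /\ (ltRM a x /\ ltRM x b)) ->
    exists k : ω, exists a b : dom M (Arr N (Arr N N)),
      (forall i : ω, i < k + 1 -> in_R2M (a @ i) (b @ i) A) /\
      (forall x : real, unitM x ->
        exists i : ω, i < k + 1 /\ (ltRM (a @ i) x /\ ltRM x (b @ i))).
Proof.
rewrite /HBC0; sat_iff; rewrite ?sat_is_set_R2 ?sat_countable_R2 ?sat_in_R2
  ?sat_in_interval ?sat_in_I ?evalE //.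
all: by rewrite sat_Lt eval_plus ?evalE.
Qed.

End Meaning.

(** * Passing to the limit, and midpoints of intervals *)

Section Limits.
Variable M : model.
Local Notation "'ω'" := (dom M N).
Local Notation Q := (rational M).
Local Notation real := (dom M (Arr N N)).

(** Otherwise some [eps i] is below (W n - K)/16, which contradicts the two bounds at n+i. This
    sharpens crude bounds of order 2^-m to the exact tolerances in [eqRM] and [good_code]; 16 is
    large enough for every use. *)
Lemma le_of_limit (W : ω -> Q) (K : Q) (n : ω) :
  (forall i, W n <= W (n + i)%M + K)%R -> (forall m, W m <= 16 * eps m)%R -> (W n <= K)%R.
Proof.
move=> h1 h2; rewrite leNgt; apply/negP => h.
have [|i hi] := @eps_archimedean M ((W n - K) / 16)%R; first by lra.
have h3 := h1 i; have h4 := h2 (n + i).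
have h5 : (eps (n + i)%M <= eps i)%R by apply: eps_le; apply/mleP; exists n; exact: maddC.
by lra.
Qed.

(** Both reals are compared through index m+n: the gap 2·2^-m of the witness absorbs the two errors
    at [m], leaving the two errors 2^-n at [n]. *)
Lemma ltRM_lt (x y : real) n : isrealM x -> isrealM y -> ltRM x y -> (ap x n < ap y n + 2 * eps n)%R.
Proof.
move=> rx ry [m h]; have [h1 h2] := rx m n; have [h3 h4] := ry m n.
have [h5 h6] := rx n m; have [h7 h8] := ry n m; move: h1 h2 h3 h4.
by rewrite (maddC m n); lra.
Qed.

(** Averaging at equal indices halves the sum of two errors, so the rate of convergence is kept
    without shifting indices. *)
Definition midE : dom M (Arr (Arr N N) (Arr (Arr N N) (Arr N N))) :=
  abs (fun a : real => abs (fun b : real => abs (fun n : ω =>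
    qmulE M @ (qexpE M @ 1) @ (qaddE M @ (a @ n) @ (b @ n))))).

Lemma eps1 : eps (1 : ω) = (1 / 2)%R.
Proof. by have := epsS (0 : ω); rewrite maddC madd0 eps0. Qed.

Lemma ap_mid a b n : ap (midE @ a @ b) n = ((ap a n + ap b n) / 2)%R.
Proof.
by rewrite /ap /midE abs3E ?val_mul ?val_add ?val_exp ?eps1; [ring | def].
Qed.

Lemma mid_real a b : isrealM a -> isrealM b -> isrealM (midE @ a @ b).
Proof.
by move=> ra rb n i; have := ra n i; have := rb n i; rewrite !ap_mid; lra.
Qed.

Lemma mid_eq a b c d : eqRM a c -> eqRM b d -> eqRM (midE @ a @ b) (midE @ c @ d).
Proof.
by move=> ac bd n; have := ac n; have := bd n; rewrite !ap_mid; lra.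
Qed.

Lemma eqRM_sym (x y : real) : eqRM x y -> eqRM y x.
Proof. by move=> h n; have := h n; lra. Qed.

End Limits.

(** * Consequences of an injective [Y] *)

Section Main.
Variable M : model.
Local Notation "'ω'" := (dom M N).
Local Notation Q := (rational M).
Local Notation real := (dom M (Arr N N)).

Variable Y : dom M (Arr (Arr N N) N).
Hypothesis Y_fun : fun_unitM Y.
Hypothesis Y_inj : forall x y : real, unitM x -> unitM y -> Y @ x = Y @ y -> eqRM x y.

(** Kleene's [E²] from [Y]: [countE @ f @ n] is the least zero of [f] below [n],
    or [n]; the real [2^-(countE @ f)] is zero iff [f] has no zero, which the
    injective [Y] can test. *)
Definition countE : dom M (Arr (Arr N N) (Arr N N)) :=
  abs (fun f : real => abs (fun n : ω =>
    recE (fun _ m => ifE M @ (f @ m) @ m @ (m + 1)) @ 0 @ n)).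

Lemma count0 f : countE @ f @ 0 = 0.
Proof. by rewrite /countE abs2E ?rec0E //; rewrite /recE; def. Qed.

Lemma countS f n : countE @ f @ (n + 1) =
  if `[< f @ (countE @ f @ n) = 0 >] then countE @ f @ n else countE @ f @ n + 1.
Proof.
have E m : countE @ f @ m =
    recE (fun _ m => ifE M @ (f @ m) @ m @ (m + 1)) @ 0 @ m.
  by rewrite /countE abs2E //; rewrite /recE; def.
by rewrite -ifE_spec !E recSE //; def.
Qed.

Lemma count_stop f n : countE @ f @ n = n \/ f @ (countE @ f @ n) = 0.
Proof.
apply: (dec_ind (P := fun n => countE @ f @ n = n \/ f @ (countE @ f @ n) = 0)) n.
- by dec.
- by rewrite count0; left.
- by move=> n; rewrite countS; case: asboolP => [->|h [->|//]]; [right|left].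
Qed.

Lemma count_stay f n i : f @ (countE @ f @ n) = 0 -> countE @ f @ (n + i) = countE @ f @ n.
Proof.
move=> h; apply: (dec_ind (P := fun i => countE @ f @ (n + i) = countE @ f @ n)) i.
- by dec.
- by rewrite madd0.
- by move=> i hi; rewrite -maddA countS hi; case: asboolP.
Qed.

Lemma count_mono f n i : countE @ f @ n <= countE @ f @ (n + i).
Proof.
apply: (dec_ind (P := fun i => countE @ f @ n <= countE @ f @ (n + i))) i.
- by dec.
- by rewrite madd0; right.
- move=> i; rewrite -maddA countS => hi; case: asboolP => // _.
  by mlra_in hi; mlra.
Qed.

Lemma count_le f n k : f @ k = 0 -> countE @ f @ n <= k.
Proof.
move=> fk; apply: (dec_ind (P := fun n => countE @ f @ n <= k)) n.
- by dec.
- by rewrite count0; apply: mle0.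
- move=> n; rewrite countS; case: asboolP => // h [/mleS_lt //|exy].
  by case: h; rewrite exy.
Qed.

Definition testE : dom M (Arr (Arr N N) (Arr N N)) :=
  abs (fun f : real => abs (fun n : ω => qexpE M @ (countE @ f @ n))).

Lemma ap_test f n : ap (testE @ f) n = eps (countE @ f @ n).
Proof. by rewrite /ap /testE abs2E ?val_exp //; def. Qed.

Lemma test_unit f : unitM (testE @ f).
Proof.
split=> [n i|n]; rewrite !ap_test; last first.
  have := eps_gt0 (countE @ f @ n); have := eps_le1 (countE @ f @ n).
  by have := eps_gt0 n; lra.
have h0 := eps_gt0 n; have h1 := eps_gt0 (countE @ f @ (n + i)).
(* While the search still runs, the value at [n] is 2^-n and later ones lie in (0, 2^-n]; once it
   has stopped, the values agree. *)
case: (count_stop f n) => [h|h]; last by rewrite count_stay //; lra.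
by have := eps_le (count_mono f n i); rewrite h; lra.
Qed.

Definition zeroE : real := cst M _ (CPi N N) @ (ratE M @ 0 @ 0 @ 0).

Lemma ap_zero n : ap zeroE n = 0%R.
Proof. by rewrite /ap /zeroE PiE val_rat. Qed.

Lemma zero_unit : unitM zeroE.
Proof. by split=> [n i|n]; rewrite !ap_zero; have := eps_gt0 n; lra. Qed.

Lemma Y_test f : Y @ (testE @ f) = Y @ zeroE <-> forall n, f @ n <> 0.
Proof.
split=> [/(Y_inj (test_unit f) zero_unit) h k fk|h].
  (* A zero at [k] keeps all approximations at or above 2^-k, whereas equality with zero at index
     k+2 allows only 2^-k / 2. *)
  have [] := h (k + 1 + 1); rewrite ap_test ap_zero !epsS.
  by have := eps_le (count_le (k + 1 + 1) fk); have := eps_gt0 k; lra.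
apply: (Y_fun (test_unit f) zero_unit) => n; rewrite ap_test ap_zero.
by case: (count_stop f n) => [->|/h //]; have := eps_gt0 n; lra.
Qed.

(** If [P n] means F n = 0, then 1 - F n vanishes exactly where [P] fails. By [Y_test], the absence
    of such a zero is an equation between two values of [Y]. *)
Lemma dec_forall Γ (P : ω -> args M Γ -> Prop) :
  decidable (fun p : args M (N :: Γ) => P p.1 p.2) -> decidable (fun ρ => forall n, P n ρ).
Proof.
move=> [F dF eF].
have dG : definable (fun p : args M (N :: Γ) => 1 - F p).
  by apply: def_app => //; def.
apply: (dec_iff (P := fun ρ => Y @ (testE @ abs (fun n => 1 - F (n, ρ))) = Y @ zeroE)); last first.
  apply: dec_eq; last by def.
  apply: def_app; [by def|apply: def_app; first by def].
  apply: (def_abs (F := fun n ρ => 1 - F (n, ρ))); move: dG; congr definable.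
  by apply: funext => -[].
move=> ρ; rewrite Y_test; apply: iff_forall => n.
rewrite (abs_beta (F := fun n ρ => 1 - F (n, ρ))); last first.
  by move: dG; congr definable; apply: funext => -[].
rewrite (eF (n, ρ)); split=> [h|-> /sub_eq0 /mnlt []]; last exact: mlt01.
by case: (m0_or_succ (F (n, ρ))) => [//|[d ed]]; case: h; apply/sub_eq0/mleP; exists d; rewrite ed maddC.
Qed.

Ltac dec_atom ::= lazymatch goal with
  | |- decidable (fun ρ => vlt (@?F ρ) (@?G ρ)) => apply: (dec_vlt (F := F) (G := G)); def
  | |- decidable (fun ρ => vle (@?F ρ) (@?G ρ)) => apply: (dec_vle (F := F) (G := G)); def
  | |- decidable (fun ρ => forall n, @?P n ρ) =>
      apply: (dec_forall (P := P)); cbn beta; dec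
  end.

(** * The cover and its enumeration *)

Local Notation "s +q t" := (qaddE M @ s @ t) (at level 50, left associativity).
Local Notation "-q s" := (qoppE M @ s) (at level 35).
Local Notation ε n := (qexpE M @ n).
Local Notation mid a b := (midE M @ a @ b).

(** The interval centred at [x] has length [eps (prec (Y x))], that is
    [4^-m / 16] for [m = Y x]. *)
Local Notation prec m := (m + m + (1 + 1 + 1 + 1)).

(** The clauses are spelled with operations on codes so that [dec] applies. The slack 2·2^-n is that
    of [leR]; 4·2^-n leaves room for the errors of both endpoints. *)
Definition good_code (a b : real) : Prop := forall n : ω,
  vle (-q (mid a b @ n)) (ε n +q ε n) /\
  vle (mid a b @ n) (ε 0 +q (ε n +q ε n)) /\
  vle (b @ n +q -q (a @ n)) (ε (prec (Y @ mid a b)) +q ((ε n +q ε n) +q (ε n +q ε n))) /\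
  vle (ε (prec (Y @ mid a b))) ((b @ n +q -q (a @ n)) +q ((ε n +q ε n) +q (ε n +q ε n))).

Lemma good_codeP a b : isrealM a -> isrealM b -> good_code a b <->
  unitM (mid a b) /\ forall n,
    (ap b n - ap a n <= eps (prec (Y @ mid a b)) + 4 * eps n)%R /\
    (eps (prec (Y @ mid a b)) <= ap b n - ap a n + 4 * eps n)%R.
Proof.
move=> ra rb; rewrite /good_code /vle.
split=> [h|[[_ h1] h2] n].
  split; first (split; first exact: mid_real).
    by move=> n; move: (h n); rewrite !(val_add, val_opp, val_exp) eps0 /ap; lra.
  by move=> n; move: (h n); rewrite !(val_add, val_opp, val_exp) eps0 /ap; lra.
move: (h1 n) (h2 n); rewrite !(val_add, val_opp, val_exp) eps0 /ap.
by move=> [? ?] [? ?]; do !split; lra.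
Qed.

(** Replacing the endpoints adds errors that vanish in the limit, so [le_of_limit] restores the same
    tolerances. The prescribed length is unchanged because the centres are equal reals and [Y]
    respects this. *)
Lemma good_code_ext a b c d : isrealM a -> isrealM b -> isrealM c -> isrealM d ->
  eqRM a c -> eqRM b d -> good_code a b ->
  good_code c d /\ Y @ mid a b = Y @ mid c d.
Proof.
move=> ra rb rc rd ac bd /good_codeP [//|//|[rm um] h].
have eqm := mid_eq ac bd; have rm' := mid_real rc rd.
have um' : unitM (mid c d).
  split=> // n; split.
    have : (- ap (mid c d) n <= 2 * eps n)%R.
      apply: (le_of_limit (W := fun n => - ap (mid c d) n)%R) => [i|m].
        by have := rm' n i; have := eps_gt0 n; lra.
      by have := eqm m; have := um m; have := eps_gt0 m; lra.
    by [].
  apply: (le_of_limit (W := fun n => ap (mid c d) n - 1)%R) => [i|m].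
    by have := rm' n i; have := eps_gt0 n; lra.
  by have := eqm m; have := um m; have := eps_gt0 m; lra.
have eY : Y @ mid a b = Y @ mid c d by apply: Y_fun.
split=> //; apply/good_codeP => //; split=> // n; rewrite -eY; set r := eps _ in h *.
split.
  have : (ap d n - ap c n - r <= 4 * eps n)%R; last by lra.
  apply: (le_of_limit (W := fun n => ap d n - ap c n - r)%R) => [i|m].
    by have := rc n i; have := rd n i; have := eps_gt0 n; lra.
  by have := ac m; have := bd m; have := h m; have := eps_gt0 m; lra.
have : (r - (ap d n - ap c n) <= 4 * eps n)%R; last by lra.
apply: (le_of_limit (W := fun n => r - (ap d n - ap c n))%R) => [i|m].
  by have := rc n i; have := rd n i; have := eps_gt0 n; lra.
by have := ac m; have := bd m; have := h m; have := eps_gt0 m; lra.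
Qed.

Lemma good_code_iff a b c d : isrealM a -> isrealM b -> isrealM c -> isrealM d ->
  eqRM a c -> eqRM b d -> good_code a b <-> good_code c d.
Proof.
move=> ra rb rc rd ac bd; split=> [/(good_code_ext ra rb rc rd ac bd) []//|].
by case/(good_code_ext rc rd ra rb (eqRM_sym ac) (eqRM_sym bd)).
Qed.

Definition coverE : dom M (Arr (Arr N N) (Arr (Arr N N) N)) :=
  abs (fun a : real => abs (fun b : real => cond (good_code a b) 1 0)).

(** The default 0 off the family makes this a function on all pairs of reals, although [Y] respects
    [eqRM] only on [0,1]. *)
Definition indexE : dom M (Arr (Arr N N) (Arr (Arr N N) N)) :=
  abs (fun a : real => abs (fun b : real => cond (good_code a b) (Y @ mid a b) 0)).

Lemma coverEE a b : coverE @ a @ b = cond (good_code a b) 1 0.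
Proof. by rewrite /coverE abs2E // /good_code; def. Qed.

Lemma indexEE a b : indexE @ a @ b = cond (good_code a b) (Y @ mid a b) 0.
Proof. by rewrite /indexE abs2E // /good_code; def. Qed.

Lemma cover_good a b : coverE @ a @ b = 1 -> good_code a b.
Proof.
rewrite coverEE /cond; case: asboolP => // _ e01.
by have := mlt01 M; rewrite -e01 => /mltnn.
Qed.

Lemma cover_fun : fun_R2M coverE.
Proof.
move=> a b c d ra rb rc rd ac bd; rewrite !coverEE /cond.
by rewrite (asbool_equiv_eq (good_code_iff ra rb rc rd ac bd)).
Qed.

Lemma cover_set a b : isrealM a -> isrealM b -> coverE @ a @ b = 0 \/ coverE @ a @ b = 1.
Proof. by move=> _ _; rewrite coverEE /cond; case: ifP; [right|left]. Qed.

Lemma index_fun : fun_R2M indexE.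
Proof.
move=> a b c d ra rb rc rd ac bd; rewrite !indexEE /cond.
rewrite (asbool_equiv_eq (good_code_iff ra rb rc rd ac bd)); case: asboolP => // g.
have /(good_code_ext ra rb rc rd ac bd) [_ //] : good_code a b.
exact/(good_code_iff ra rb rc rd ac bd).
Qed.

(** Equal values of [Y] give equal centres by injectivity and equal lengths by construction, and
    centre and length determine both endpoints. *)
Lemma index_inj a b c d : in_R2M a b coverE -> in_R2M c d coverE ->
  indexE @ a @ b = indexE @ c @ d -> eqRM a c /\ eqRM b d.
Proof.
move=> [ra [rb /cover_good gab]] [rc [rd /cover_good gcd]].
rewrite !indexEE /cond !asboolT // => eY.
have [uab hab] := proj1 (good_codeP ra rb) gab.
have [ucd hcd] := proj1 (good_codeP rc rd) gcd.
have eqm := Y_inj uab ucd eY; rewrite -eY in hcd; move: (eps _) hab hcd => r hab hcd.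
have H m : (ap a m - ap c m <= 16 * eps m)%R /\ (ap c m - ap a m <= 16 * eps m)%R /\
    (ap b m - ap d m <= 16 * eps m)%R /\ (ap d m - ap b m <= 16 * eps m)%R.
  have := eqm m; rewrite !ap_mid; have := hab m; have := hcd m; have := eps_gt0 m.
  by move=> ? [? ?] [? ?] [? ?]; do !split; lra.
split=> n; split.
- apply: (le_of_limit (W := fun n => ap a n - ap c n)%R) => [i|m]; last by have := H m; lra.
  by have := ra n i; have := rc n i; lra.
- apply: (le_of_limit (W := fun n => ap c n - ap a n)%R) => [i|m]; last by have := H m; lra.
  by have := ra n i; have := rc n i; lra.
- apply: (le_of_limit (W := fun n => ap b n - ap d n)%R) => [i|m]; last by have := H m; lra.
  by have := rb n i; have := rd n i; lra.
- apply: (le_of_limit (W := fun n => ap d n - ap b n)%R) => [i|m]; last by have := H m; lra.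
  by have := rb n i; have := rd n i; lra.
Qed.

Lemma cover_covers (x : real) : unitM x -> exists a b : real,
  in_R2M a b coverE /\ (ltRM a x /\ ltRM x b).
Proof.
move=> ux; have [rx _] := ux; pose p := prec (Y @ x).
pose a : real := abs (fun n : ω => x @ n +q -q ε (p + 1)).
pose b : real := abs (fun n : ω => x @ n +q ε (p + 1)).
have apa n : ap a n = (ap x n - eps p / 2)%R.
  by rewrite /ap /a abs1E ?val_add ?val_opp ?val_exp ?epsS //; def.
have apb n : ap b n = (ap x n + eps p / 2)%R.
  by rewrite /ap /b abs1E ?val_add ?val_exp ?epsS //; def.
have apm n : ap (mid a b) n = ap x n by rewrite ap_mid apa apb; lra.
have ra : isrealM a by move=> n i; rewrite !apa; have := rx n i; lra.
have rb : isrealM b by move=> n i; rewrite !apb; have := rx n i; lra.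
have um : unitM (mid a b).
  by split=> n; [move=> i|]; rewrite !apm; [have := rx n i|have := ux.2 n].
have eY : Y @ mid a b = Y @ x.
  by apply: Y_fun => // n; rewrite apm; have := eps_gt0 n; lra.
exists a, b; split; last first.
  (* At index p+3 a strict inequality needs a gap above 2^-p / 4, and the endpoints are 2^-p / 2
     away from [x]. *)
  by split; exists (p + 1 + 1 + 1); rewrite ?apa ?apb !epsS; have := eps_gt0 p; lra.
split=> //; split=> //; rewrite coverEE /cond asboolT //.
apply/good_codeP => //; split=> // n; rewrite eY -/p apa apb; have := eps_gt0 n; lra.
Qed.

(** Diagonalisation: [J_m = [Z m, Z m + 4^-m]] are nested, and [J_(m+1)] is the
    first or last quarter of [J_m], chosen to miss the at most one interval
    of the finite subfamily whose centre [x] has [Y x = m]. *)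
Section Diagonal.
Variables (k : ω) (a b : dom M (Arr N (Arr N N))).
Hypothesis ab_cover : forall i : ω, i < k + 1 -> in_R2M (a @ i) (b @ i) coverE.

Local Notation centre i := (mid (a @ i) (b @ i)).

(** Later matches overwrite earlier ones. The default 0 is a legal index of the subfamily, so the
    result can be used even if no centre has value [m]. *)
Definition searchE : dom M (Arr N (Arr N N)) :=
  abs (fun m : ω => abs (fun j : ω =>
    recE (fun i w => cond (Y @ centre i = m) i w) @ 0 @ j)).

Lemma searchEE m j : searchE @ m @ j = recE (fun i w => cond (Y @ centre i = m) i w) @ 0 @ j.
Proof. by rewrite /searchE abs2E //; rewrite /recE; def. Qed.

Lemma search0 m : searchE @ m @ 0 = 0.
Proof. by rewrite searchEE rec0E. Qed.

Lemma searchS m j : searchE @ m @ (j + 1) = cond (Y @ centre j = m) j (searchE @ m @ j).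
Proof. by rewrite !searchEE recSE //; def. Qed.

Lemma search_lt m j : j <= k + 1 -> searchE @ m @ j < k + 1.
Proof.
apply: (dec_ind (P := fun j => j <= k + 1 -> searchE @ m @ j < k + 1)) j.
- by dec.
- by move=> _; rewrite search0; apply: mle_lt_trans (mle0 k) (mltS k).
- move=> j IH /mleS_lt h; rewrite searchS /cond; case: asboolP => // _.
  by apply: IH; left.
Qed.

(** The index found may differ from [i], but its centre has the same value under [Y] and is
    therefore the same real. *)
Lemma search_found i j : i < j -> Y @ centre (searchE @ (Y @ centre i) @ j) = Y @ centre i.
Proof.
apply: (dec_ind (P := fun j => i < j ->
  Y @ centre (searchE @ (Y @ centre i) @ j) = Y @ centre i)) j.
- by dec.
- by move=> /mnlt0.
- move=> j IH /mltS_le [/IH h|->]; rewrite searchS /cond; by case: asboolP.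
Qed.

Local Notation chosen m := (centre (searchE @ m @ (k + 1))).

(** The approximation of the chosen centre at index [prec m] is compared with the midpoint of J_m.
    If it lies to the left, the left end moves by (1/2 + 1/4)·4^-m to the last quarter; otherwise
    the first quarter is kept. *)
Definition diagE : real := abs (fun n : ω => recE (fun m w =>
  cond (vlt (chosen m @ prec m) (w +q ε (m + m + 1)))
    (w +q (ε (m + m + 1) +q ε (m + m + 1 + 1))) w) @ (ratE M @ 0 @ 0 @ 0) @ n).

Lemma diag0 : ap diagE 0 = 0%R.
Proof. by rewrite /ap /diagE abs1E ?rec0E ?val_rat //; rewrite /recE; def. Qed.

Lemma diagS m : ap diagE (m + 1)%M =
  if (ap (chosen m) (prec m) < ap diagE m + eps (m + m)%M / 2)%R
  then (ap diagE m + 3 / 4 * eps (m + m)%M)%R else ap diagE m.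
Proof.
have E n : diagE @ n = recE (fun m w =>
    cond (vlt (chosen m @ prec m) (w +q ε (m + m + 1)))
      (w +q (ε (m + m + 1) +q ε (m + m + 1 + 1))) w) @ (ratE M @ 0 @ 0 @ 0) @ n.
  by rewrite /diagE abs1E //; rewrite /recE; def.
rewrite /ap E recSE; last by def.
rewrite -!E /cond /vlt val_add val_exp !epsS asboolb; case: ifP => // _; rewrite ?val_add ?val_exp ?epsS.
by lra.
Qed.

Lemma eps_double (m : ω) : (eps (m + 1 + (m + 1))%M = eps (m + m)%M / 4)%R.
Proof. by rewrite !epsD eps1; field. Qed.

Lemma eps_prec (m : ω) : (eps (prec m) = eps (m + m)%M / 16)%R.
Proof. by rewrite epsD !epsS eps1; lra. Qed.

(** A move by 0 or by 3/4 of the length leaves the new quarter inside the old interval. The claim is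
    rephrased with [vle] to make it decidable for [dec_ind]. *)
Lemma diag_nested n i : (ap diagE n <= ap diagE (n + i)%M)%R /\
  (ap diagE (n + i)%M + eps (n + i + (n + i))%M <= ap diagE n + eps (n + n)%M)%R.
Proof.
have h : forall i, vle (diagE @ n) (diagE @ (n + i)) /\
    vle (diagE @ (n + i) +q ε (n + i + (n + i))) (diagE @ n +q ε (n + n)).
  apply: dec_ind; first by dec.
    by rewrite madd0; split; exact: lexx.
  move=> j; rewrite -(maddA n j 1) /vle !val_add !val_exp eps_double.
  have := diagS (n + j); rewrite /ap => ->.
  by have := eps_gt0 (n + j + (n + j)); case: ifP => _; lra.
by move: (h i); rewrite /vle !val_add !val_exp.
Qed.

Lemma diag_unit : unitM diagE.
Proof.
split=> [n i|n].
  have [h1 h2] := diag_nested n i; have := eps_gt0 (n + i + (n + i)); have := eps_gt0 n.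
  (* Two later approximations lie in an interval of length 4^-n, within the rate 2^-n required of a
     real. *)
  have : (eps (n + n)%M <= eps n)%R by apply: eps_le; apply/mleP; exists n.
  by lra.
have [] := diag_nested 0 n; rewrite !(maddC 0) !madd0 diag0 eps0.
by have := eps_gt0 n; have := eps_gt0 (n + n); lra.
Qed.

(** With m the [Y]-value of the centre of member [i], step [m] tested an approximation of this very
    centre and moved to the far quarter, at distance at least 4^-m / 4 from it. A point of the
    member cannot be that far away. *)
Lemma diag_avoids i : i < k + 1 -> ltRM (a @ i) diagE -> ltRM diagE (b @ i) -> False.
Proof.
move=> ik az zb; have [ra [rb /cover_good]] := ab_cover ik.
move=> /(good_codeP ra rb) [um hab]; set m := Y @ centre i in hab.
have em := search_found ik; rewrite -/m in em.
have [ra' [rb' /cover_good]] := ab_cover (search_lt m (or_intror erefl)).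
move=> /(good_codeP ra' rb') [um' _].
have eqm := Y_inj um' um em.
have rz := diag_unit.1.
(* With L = 4^-m the error 2^-n is L/64. The diagonal approximation is within 3L/32 of the midpoint
   of the member, which is within 3L/32 of the tested rational: in total less than L/4. *)
pose n := prec m + (1 + 1).
have h1 := ltRM_lt n ra rz az; have h2 := ltRM_lt n rz rb zb.
have [h3 h4] := hab n; have [h5 h6] := eqm n; have [h7 h8] := um'.1 (prec m) (1 + 1).
have en : (eps n = eps (m + m)%M / 64)%R by rewrite /n epsD eps_prec epsS eps1; lra.
(* Writing [n] as an index beyond m+1 places the approximation at [n] inside the quarter chosen at
   step [m]. *)
have nE : n = m + 1 + (m + (1 + 1 + 1 + 1 + 1)).
  by rewrite inj_eq /n !injE; lra.
have := diag_nested (m + 1) (m + (1 + 1 + 1 + 1 + 1)); rewrite -nE eps_double diagS.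
have := eps_gt0 (n + n); have := eps_gt0 (m + m).
move: h3 h4 h5 h6 h7 h8; rewrite -/n !(ap_mid (a @ i)) eps_prec en.
move=> h3 h4 h5 h6 h7 h8 g0 gn.
by rewrite en in h1 h2; case: ifPn; rewrite -?leNgt => hc; lra.
Qed.

End Diagonal.

Lemma cover_no_finite : ~ exists k : ω, exists a b : dom M (Arr N (Arr N N)),
  (forall i : ω, i < k + 1 -> in_R2M (a @ i) (b @ i) coverE) /\
  (forall x : real, unitM x ->
    exists i : ω, i < k + 1 /\ (ltRM (a @ i) x /\ ltRM x (b @ i))).
Proof.
move=> [k [a [b [hab hx]]]].
have [i [ik [az zb]]] := hx _ (diag_unit k a b).
exact: (diag_avoids hab ik az zb).
Qed.

End Main.

Theorem corollary3p22 : RCA0ω_proves (Imp HBC0 NIN).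
Proof.
apply: completeness => S HS ρ; pose M := Model HS.
rewrite -[S]/(str M) in ρ *; rewrite sat_Imp sat_HBC0 sat_NIN => HBC Y Y_fun.
apply: contrapT => nY.
have Y_inj x y : unitM x -> unitM y -> Y @ x = Y @ y -> eqRM x y.
  by move=> ux uy eY; apply: contrapT => nxy; apply: nY; exists x, y.
apply: (cover_no_finite Y_fun Y_inj); apply: HBC.
- by split; [exact: cover_fun|exact: cover_set].
- by exists (indexE Y); split; [exact: index_fun|exact: index_inj].
- exact: cover_covers.
Qed.
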